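(* The promise problem $\textsc{Nim}_6(\mathrm{Succinct},\mathrm{HD})$ is $\mathbf{PSPACE}$-hard under polynomial-time many-one reductions.
   Context: Poset game on a finite poset $P$: players alternate; a move chooses a point $x$ of the current poset $Q$ and replaces $Q$ by $\{y\in Q: x\not\le y\}$; the first player unable to move loses; $P$ is an $\exists$-game if the first player has a winning strategy. $\textsc{Nim}_6(\mathrm{Succinct},\mathrm{HD})$ is the promise problem: Input: a Boolean circuit with one output bit and two $n$-bit inputs computing the edge relation of a directed graph $G$ on vertex set $\{0,1\}^n$ (or on a subset of $\{0,1\}^n$ specified by an additional membership circuit). Promise: $G$ is acyclic and the poset $P$ whose order is the reachability relation of $G$ is a parallel (disjoint, mutually incomparable) union of at most $6$ chains. Question: is $P$ an $\exists$-game? *)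

(* Defs.v *)
From mathcomp Require Import all_boot.
Set Implicit Arguments. Unset Strict Implicit. Unset Printing Implicit Defensive.

(* 1. Machine model: deterministic single-tape Turing machines over the  *)
(*    alphabet {0,1} plus blank (None), two-way unbounded tape.          *)

Inductive move := MLeft | MRight | MStay.

Record TM := {
  tm_nstates : nat;
  tm_delta : 'I_tm_nstates.+1 -> option bool ->
             'I_tm_nstates.+1 * option bool * move;
  tm_halt : 'I_tm_nstates.+1 -> bool;
  tm_accept : 'I_tm_nstates.+1 -> bool
}.

Arguments tm_delta t _ _ : clear implicits.
Arguments tm_halt t _ : clear implicits.
Arguments tm_accept t _ : clear implicits.

Definition tm_state (M : TM) := 'I_(tm_nstates M).+1.

(* left part is stored reversed (nearest cell first) *)
Record config (Q : Type) := Cfg {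
  c_state : Q;
  c_left : seq (option bool);
  c_cur : option bool;
  c_right : seq (option bool)
}.

Definition step (M : TM) (c : config (tm_state M)) : config (tm_state M) :=
  let: Cfg q l a r := c in
  if tm_halt M q then c else
  let: (q', b, m) := tm_delta M q a in
  match m with
  | MStay => Cfg q' l b r
  | MLeft => match l with
             | [::] => Cfg q' [::] None (b :: r)
             | h :: l' => Cfg q' l' h (b :: r)
             end
  | MRight => match r with
              | [::] => Cfg q' (b :: l) None [::]
              | h :: r' => Cfg q' (b :: l) h r'
              end
  end.

Arguments step M c : clear implicits.

Definition init (M : TM) (x : seq bool) : config (tm_state M) :=
  match x with
  | [::] => Cfg (ord0 : tm_state M) [::] None [::]
  | b :: x' => Cfg (ord0 : tm_state M) [::] (Some b) (map Some x')
  end.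

Arguments init M x : clear implicits.

Definition run (M : TM) (x : seq bool) (t : nat) : config (tm_state M) :=
  iter t (step M) (init M x).

Definition halted (M : TM) (c : config (tm_state M)) : bool :=
  tm_halt M (c_state c).

(* number of tape cells visited so far (the tape only grows on visits) *)
Definition space_of (Q : Type) (c : config Q) : nat :=
  size (c_left c) + 1 + size (c_right c).

Fixpoint read_bits (s : seq (option bool)) : seq bool :=
  match s with
  | Some b :: s' => b :: read_bits s'
  | _ => [::]
  end.

Definition output (Q : Type) (c : config Q) : seq bool :=
  read_bits (c_cur c :: c_right c).

Definition polybnd (k n : nat) : nat := k * n ^ k + k.

Definition PolyTimeComputable (f : seq bool -> seq bool) : Prop :=
  exists (M : TM) (k : nat), forall x : seq bool,
    exists t, t <= polybnd k (size x) /\ halted (run M x t) /\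
              output (run M x t) = f x.

Definition InPSPACE (L : seq bool -> Prop) : Prop :=
  exists (M : TM) (k : nat), forall x : seq bool,
    (forall t, space_of (run M x t) <= polybnd k (size x)) /\
    exists t, halted (run M x t) /\
              (tm_accept M (c_state (run M x t)) = true <-> L x).

Definition PSPACE_hard_promise (YES NO : seq bool -> Prop) : Prop :=
  forall L : seq bool -> Prop, InPSPACE L ->
    exists f, PolyTimeComputable f /\
      forall x, (L x -> YES (f x)) /\ (~ L x -> NO (f x)).

(*    Wires 0..m-1 are the inputs, wire m+k is the output of gate k;      *)
(*    the output of the circuit is the last wire.                         *)

Inductive gate := GAnd of nat & nat | GOr of nat & nat | GNot of nat.
Definition circuit := seq gate.

Definition eval_gate (ws : seq bool) (g : gate) : bool :=
  match g with
  | GAnd i j => nth false ws i && nth false ws j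
  | GOr i j => nth false ws i || nth false ws j
  | GNot i => ~~ nth false ws i
  end.

Definition eval_wires (C : circuit) (inp : seq bool) : seq bool :=
  foldl (fun ws g => rcons ws (eval_gate ws g)) inp C.

Definition circuit_out (C : circuit) (inp : seq bool) : bool :=
  last false (eval_wires C inp).

Definition gate_wf (k : nat) (g : gate) : bool :=
  match g with
  | GAnd i j | GOr i j => (i < k) && (j < k)
  | GNot i => i < k
  end.

Fixpoint wf_from (k : nat) (C : circuit) : bool :=
  match C with
  | [::] => true
  | g :: C' => gate_wf k g && wf_from k.+1 C'
  end.

Definition circuit_wf (m : nat) (C : circuit) : bool :=
  (0 < size C) && wf_from m C.

Definition code_nat (k : nat) : seq bool := nseq k true ++ [:: false].

Definition code_gate (g : gate) : seq bool :=
  match g with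
  | GAnd i j => [:: true; true] ++ code_nat i ++ code_nat j
  | GOr i j => [:: true; false] ++ code_nat i ++ code_nat j
  | GNot i => [:: false; true] ++ code_nat i
  end.

Definition code_circuit (C : circuit) : seq bool :=
  code_nat (size C) ++ flatten (map code_gate C).

(* an instance: n, edge circuit (2n inputs), optional membership circuit
   (n inputs) *)
Record instance := Inst {
  i_n : nat;
  i_edge : circuit;
  i_mem : option circuit
}.

Definition encode (I : instance) : seq bool :=
  code_nat (i_n I) ++ code_circuit (i_edge I) ++
  match i_mem I with
  | None => [:: false]
  | Some Mc => true :: code_circuit Mc
  end.

Definition inst_wf (I : instance) : bool :=
  circuit_wf (2 * i_n I) (i_edge I) &&
  match i_mem I with None => true | Some Mc => circuit_wf (i_n I) Mc end.

Definition inV (n : nat) (mem : option circuit) (v : n.-tuple bool) : bool :=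
  match mem with None => true | Some Mc => circuit_out Mc v end.

Definition Vset (n : nat) (mem : option circuit) : {set n.-tuple bool} :=
  [set v | inV mem v].

Definition edge (n : nat) (E : circuit) (mem : option circuit)
    : rel (n.-tuple bool) :=
  fun u v => [&& inV mem u, inV mem v & circuit_out E (val u ++ val v)].

Definition reach (n : nat) (E : circuit) (mem : option circuit)
    : rel (n.-tuple bool) :=
  connect (edge E mem).

Definition acyclic (T : finType) (e : rel T) : Prop :=
  forall u v, e u v -> ~~ connect e v u.

(* (V, le) is a parallel union of at most k chains: V is partitioned into
   k (possibly empty) classes, each a chain, distinct classes mutually
   incomparable *)
Definition parallel_chains (T : finType) (k : nat) (V : {set T}) (le : rel T)
    : Prop :=
  exists col : T -> 'I_k, forall u v, u \in V -> v \in V ->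
    ((le u v || le v u) <-> col u = col v).

Definition after_move (T : finType) (le : rel T) (Q : {set T}) (x : T)
    : {set T} := [set y in Q | ~~ le x y].

Fixpoint wins_fuel (T : finType) (le : rel T) (k : nat) (Q : {set T}) : bool :=
  match k with
  | 0 => false
  | k'.+1 => [exists x in Q, ~~ wins_fuel le k' (after_move le Q x)]
  end.

(* the player to move wins on position Q (le reflexive, so each move
   strictly shrinks Q and #|Q| is sufficient fuel) *)
Definition exists_game (T : finType) (le : rel T) (Q : {set T}) : bool :=
  wins_fuel le #|Q| Q.

Definition promise6 (I : instance) : Prop :=
  acyclic (edge (n := i_n I) (i_edge I) (i_mem I)) /\
  parallel_chains 6 (Vset (i_n I) (i_mem I)) (reach (i_edge I) (i_mem I)).

Definition Nim6_YES (x : seq bool) : Prop :=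
  exists I : instance, x = encode I /\ inst_wf I /\ promise6 I /\
    exists_game (reach (n := i_n I) (i_edge I) (i_mem I))
                (Vset (i_n I) (i_mem I)).

Definition Nim6_NO (x : seq bool) : Prop :=
  exists I : instance, x = encode I /\ inst_wf I /\ promise6 I /\
    ~~ exists_game (reach (n := i_n I) (i_edge I) (i_mem I))
                   (Vset (i_n I) (i_mem I)).

(* Main.v *)
From Stdlib Require Import ZArith Lia FunctionalExtensionality.
From mathcomp Require Import all_boot zify_ssreflect.
Require Import Defs.
Set Implicit Arguments. Unset Strict Implicit. Unset Printing Implicit Defensive.

(* Run a space bounded machine as a cellular automaton on S cells and attach a
   clock: the node (cells, t) has the parent (next cells, t + 1), and at the last
   value of the clock its parent is the root 0...0 if the cells accept and the root
   1...1 if not.  The bit strings form a forest with two trees, and the input is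
   accepted iff the initial node i lies in the tree of 0...0.  The Euler tours of
   the trees visit pairs (c, a), where a runs in binary order through all bit
   strings as candidate children of c: from (c, a) the tour goes to (a, 0...0) if
   c is the parent of a and to (c, a + 1) if not, and from (c, 1...1) to
   (parent of c, c + 1).  A finite automaton can check this relation blockwise, so
   a circuit of polynomial size computes it.

   Take two strands of both tours, exchange the strands on leaving (i, 1...1), and
   cut off the first and the last vertex of the tour of 1...1 on strand 0.  This
   leaves two chains of equal length (the tour of 0...0), two single vertices, and
   two chains which have equal lengths if the exchange happens on the tour of
   1...1 and whose lengths differ by two otherwise.  In the first case the second
   player wins by mirroring, in the second the first player restores the symmetry.

   The reduction is a loop program on a fixed number of stacks, which a single tape
   machine simulates by interleaving the stacks on the left half of its tape. *)

(** * Structured tape programs *)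

(** A union of chains needs in- and out-degree at most one, but configurations of a deterministic
    machine merge, so a run is only a path in a forest. Walking around the trees removes the
    merging, at the price of tours of unknown length. Since Nim sees nothing but lengths, each tour
    is doubled to make the lengths cancel, and the one bit to be read off is the side on which the
    exchange takes place. The cut reads this bit. On the tour of 1...1, the path starting on strand
    0 loses its first vertex and the path ending on strand 0 loses its last. After an exchange these
    are different paths, otherwise it is the same one. All bit strings of the right length are
    vertices, meaningful or not; hence cells are decoded by a total function, and the clock brings
    every string to one of the two roots. The input word enters the graph only through its length
    and the vertex of the exchange. Polynomial time means a single-tape machine here, so the
    construction of the circuit has to be programmed. This stays manageable because every column
    contributes a block of gates that is fixed up to wire numbers of the form counter plus
    constant. *)

Definition tape := Z -> option bool.

Definition updt (T : tape) (h : Z) (a : option bool) : tape :=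
  fun z => if Z.eqb z h then a else T z.

Definition moved (m : move) (h : Z) : Z :=
  match m with MLeft => (h - 1)%Z | MRight => (h + 1)%Z | MStay => h end.

Inductive tprog :=
| Act of (option bool -> option bool) & move
| TSeq of tprog & tprog
| If of (option bool -> bool) & tprog & tprog
| While of (option bool -> bool) & tprog.

(** The last index counts the steps of the code below exactly: the first branch of [If] pays for the
    test and for the jump over the second branch, the second branch for the test alone, and a round
    of [While] for the test and the jump back. *)
Inductive texec : tprog -> Z -> tape -> Z -> tape -> nat -> Prop :=
| XAct w m h T : texec (Act w m) h T (moved m h) (updt T h (w (T h))) 1
| XSeq c1 c2 h T h1 T1 h2 T2 t1 t2 :
    texec c1 h T h1 T1 t1 -> texec c2 h1 T1 h2 T2 t2 ->
    texec (TSeq c1 c2) h T h2 T2 (t1 + t2)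
| XIfT (p : option bool -> bool) c1 c2 h T h1 T1 t : p (T h) -> texec c1 h T h1 T1 t ->
    texec (If p c1 c2) h T h1 T1 t.+2
| XIfF (p : option bool -> bool) c1 c2 h T h1 T1 t : ~~ p (T h) -> texec c2 h T h1 T1 t ->
    texec (If p c1 c2) h T h1 T1 t.+1
| XWhileF (p : option bool -> bool) c h T : ~~ p (T h) -> texec (While p c) h T h T 1
| XWhileT (p : option bool -> bool) c h T h1 T1 h2 T2 t1 t2 : p (T h) ->
    texec c h T h1 T1 t1 -> texec (While p c) h1 T1 h2 T2 t2 ->
    texec (While p c) h T h2 T2 (t2 + t1.+2).

(* ITest p l falls through when p holds of the scanned symbol and jumps to l
   otherwise, so ITest xpred0 l is an unconditional jump. *)
Inductive instr :=
| IAct of (option bool -> option bool) & move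
| ITest of (option bool -> bool) & nat.

Fixpoint clen (c : tprog) : nat :=
  match c with
  | Act _ _ => 1
  | TSeq c1 c2 => clen c1 + clen c2
  | If _ c1 c2 => (clen c1 + 1 + clen c2).+1
  | While _ c => (clen c + 1).+1
  end.

Fixpoint code (b : nat) (c : tprog) : seq instr :=
  match c with
  | Act w m => [:: IAct w m]
  | TSeq c1 c2 => code b c1 ++ code (b + clen c1) c2
  | If p c1 c2 =>
      ITest p (b + (clen c1).+2) ::
      code b.+1 c1 ++ ITest xpred0 (b + clen c) :: code (b + (clen c1).+2) c2
  | While p c1 =>
      ITest p (b + clen c) :: code b.+1 c1 ++ [:: ITest xpred0 b]
  end.

Lemma size_code c b : size (code b c) = clen c.
Proof.
elim: c b => [w m|c1 IH1 c2 IH2|p c1 IH1 c2 IH2|p c IH] b //=.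
- by rewrite size_cat IH1 IH2.
- by rewrite size_cat /= IH1 IH2 -addnA add1n.
- by rewrite size_cat /= IH.
Qed.

(** The state is the program counter. The address just behind the last instruction is the halting
    state, so a program halts by running off its end. *)
Definition machine (prog : seq instr) : TM :=
  {| tm_nstates := size prog;
     tm_delta := fun q a =>
       match nth (IAct id MStay) prog q with
       | IAct w m => (inord q.+1, w a, m)
       | ITest p l => (inord (if p a then q.+1 else l), a, MStay)
       end;
     tm_halt := fun q => q == size prog :> nat;
     tm_accept := fun _ => false |}.

(** The default [None] of [nth] lets the finite lists of a configuration stand for an infinite tape;
    it also covers the moves in which a list is empty and the head enters a fresh cell. *)
Definition at_pc (M : TM) (c : config (tm_state M)) (pc : nat) (h : Z) (T : tape) :=
  [/\ c_state c = pc :> nat, c_cur c = T h,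
      forall j, nth None (c_left c) j = T (h - 1 - Z.of_nat j)%Z &
      forall j, nth None (c_right c) j = T (h + 1 + Z.of_nat j)%Z].

Lemma at_pc_move (M : TM) (q q' : tm_state M) l a r h T b m pc :
  at_pc (Cfg q l a r) pc h T ->
  at_pc (match m with
    | MStay => Cfg q' l b r
    | MLeft => match l with
               | [::] => Cfg q' [::] None (b :: r)
               | x :: l' => Cfg q' l' x (b :: r)
               end
    | MRight => match r with
                | [::] => Cfg q' (b :: l) None [::]
                | x :: r' => Cfg q' (b :: l) x r'
                end
    end) q' (moved m h) (updt T h b).
Proof.
case=> /= _ Ea El Er; rewrite /updt; case: m => /=.
- case: l El => [|x l'] El; split=> //=.
  + by rewrite ifF; [rewrite -{1}(nth_nil None 0) El; congr T|]; lia.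
  + by move=> j; rewrite ifF; [rewrite nth_nil -{1}(nth_nil None j.+1) El; congr T|]; lia.
  + case=> [|j] /=; first by rewrite ifT //; lia.
    by rewrite Er ifF; [congr T|]; lia.
  + by rewrite ifF; [move: (El 0) => /= ->; congr T|]; lia.
  + by move=> j; rewrite ifF; [move: (El j.+1) => /= ->; congr T|]; lia.
  + case=> [|j] /=; first by rewrite ifT //; lia.
    by rewrite Er ifF; [congr T|]; lia.
- case: r Er => [|x r'] Er; split=> //=.
  + by rewrite ifF; [rewrite -{1}(nth_nil None 0) Er; congr T|]; lia.
  + case=> [|j] /=; first by rewrite ifT //; lia.
    by rewrite El ifF; [congr T|]; lia.
  + by move=> j; rewrite ifF; [rewrite nth_nil -{1}(nth_nil None j.+1) Er; congr T|]; lia.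
  + by rewrite ifF; [move: (Er 0) => /= ->; congr T|]; lia.
  + case=> [|j] /=; first by rewrite ifT //; lia.
    by rewrite El ifF; [congr T|]; lia.
  + by move=> j; rewrite ifF; [move: (Er j.+1) => /= ->; congr T|]; lia.
- split=> //=; first by rewrite Z.eqb_refl.
  + by move=> j; rewrite El ifF //; lia.
  + by move=> j; rewrite Er ifF //; lia.
Qed.

Lemma updt_id T h : updt T h (T h) = T.
Proof.
by apply: functional_extensionality => z; rewrite /updt; case: Z.eqb_spec => [->|].
Qed.

Lemma step_act prog pc c h T w m : pc < size prog ->
  nth (IAct id MStay) prog pc = IAct w m ->
  @at_pc (machine prog) c pc h T ->
  @at_pc (machine prog) (step (machine prog) c) pc.+1 (moved m h) (updt T h (w (T h))).
Proof.
case: c => q l a r ltpc Enth A; case: (A) => /= Eq Ea _ _.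
rewrite Eq (ltn_eqF ltpc) Enth.
have := @at_pc_move (machine prog) q (inord pc.+1) l a r h T (w a) m pc A.
by rewrite inordK // Ea.
Qed.

Lemma step_test prog pc c h T p l : pc < size prog ->
  nth (IAct id MStay) prog pc = ITest p l -> l <= size prog ->
  @at_pc (machine prog) c pc h T ->
  @at_pc (machine prog) (step (machine prog) c) (if p (T h) then pc.+1 else l) h T.
Proof.
case: c => q L a r ltpc Enth lel A; case: (A) => /= Eq Ea _ _.
rewrite Eq (ltn_eqF ltpc) Enth.
set l' := (if p a then _ else _).
have := @at_pc_move (machine prog) q (inord l') L a r h T a MStay pc A.
rewrite Ea updt_id inordK //= /l' Ea; first by [].
by case: ifP => _; rewrite ltnS.
Qed.

Lemma nth_cat_size (T : Type) (x0 : T) s1 y s2 : nth x0 (s1 ++ y :: s2) (size s1) = y.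
Proof. by rewrite nth_cat ltnn subnn. Qed.

(** Induction on the execution rather than on the program, since a loop runs the same code again.
    The code stands between arbitrary [pre] and [post] so that the hypothesis applies to subprograms
    in place. *)
Lemma code_correct c h T h' T' t : texec c h T h' T' t ->
  forall pre post prog cf, prog = pre ++ code (size pre) c ++ post ->
  @at_pc (machine prog) cf (size pre) h T ->
  @at_pc (machine prog) (iter t (step (machine prog)) cf) (size pre + clen c) h' T'.
Proof.
elim=> {c h T h' T' t}.
- move=> w m h T pre post prog cf Ep A /=.
  rewrite addn1; apply: step_act A => //=; last by rewrite Ep nth_cat_size.
  by rewrite Ep size_cat /=; lia.
- move=> c1 c2 h T h1 T1 h2 T2 t1 t2 _ IH1 _ IH2 pre post prog cf Ep A.
  rewrite addnC iterD /= addnA.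
  have := IH2 (pre ++ code (size pre) c1) post prog.
  rewrite !size_cat !size_code; apply.
    by rewrite Ep /= -!catA.
  by apply: (IH1 pre (code (size pre + clen c1) c2 ++ post)) => //; rewrite Ep /= -catA.
- move=> p c1 c2 h T h1 T1 t pT _ IH pre post prog cf Ep A.
  have lt0 : size pre + clen (If p c1 c2) <= size prog.
    by rewrite Ep !size_cat size_code addnA leq_addr.
  have A1 : @at_pc (machine prog) (step (machine prog) cf) (size pre).+1 h T.
    have := @step_test prog (size pre) cf h T p (size pre + (clen c1).+2).
    rewrite pT; apply=> //; first by move: lt0 => /=; lia.
      by rewrite Ep /= nth_cat_size.
    by move: lt0 => /=; lia.
  have := IH (pre ++ [:: ITest p (size pre + (clen c1).+2)])
     (ITest xpred0 (size pre + clen (If p c1 c2))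
        :: code (size pre + (clen c1).+2) c2 ++ post) prog (step (machine prog) cf).
  rewrite size_cat /= addn1 => /(_ _ A1) A2.

  rewrite -iterSr in A2; have {}A2 := A2 _.
  have /A2 {}A2 : prog = (pre ++ [:: ITest p (size pre + (clen c1).+2)]) ++
        code (size pre).+1 c1 ++
        ITest xpred0 (size pre + (clen c1 + 1 + clen c2).+1)
        :: code (size pre + (clen c1).+2) c2 ++ post.
    by rewrite Ep /= -!catA.
  have := @step_test prog ((size pre).+1 + clen c1) _ h1 T1 xpred0
     (size pre + clen (If p c1 c2)) _ _ _ A2.
  apply=> //; first by move: lt0 => /=; lia.
  set pr := pre ++ ITest p (size pre + (clen c1).+2) :: code (size pre).+1 c1.
  have -> : (size pre).+1 + clen c1 = size pr.
    by rewrite /pr size_cat /= size_code; lia.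
  rewrite (_ : prog = pr ++ ITest xpred0 (size pre + clen (If p c1 c2)) ::
       code (size pre + (clen c1).+2) c2 ++ post) ?nth_cat_size //.
  by rewrite Ep /pr /= -!catA /= -?catA.
- move=> p c1 c2 h T h1 T1 t pT _ IH pre post prog cf Ep A.
  have lt0 : size pre + clen (If p c1 c2) <= size prog.
    by rewrite Ep !size_cat size_code addnA leq_addr.
  have A1 : @at_pc (machine prog) (step (machine prog) cf) (size pre + (clen c1).+2) h T.
    have := @step_test prog (size pre) cf h T p (size pre + (clen c1).+2).
    rewrite (negbTE pT); apply=> //; first by move: lt0 => /=; lia.
      by rewrite Ep /= nth_cat_size.
    by move: lt0 => /=; lia.
  set pr := pre ++ ITest p (size pre + (clen c1).+2) :: code (size pre).+1 c1
     ++ [:: ITest xpred0 (size pre + clen (If p c1 c2))].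
  have Es : size pr = size pre + (clen c1).+2.
    by rewrite /pr size_cat /= size_cat size_code /=; lia.
  rewrite iterSr.
  have := IH pr post prog (step (machine prog) cf); rewrite Es.
  have -> : size pre + (clen c1).+2 + clen c2 = size pre + clen (If p c1 c2).
    by rewrite /=; lia.
  by apply=> //; rewrite Ep /pr /= -!catA /= -!catA.
- move=> p c h T pT pre post prog cf Ep A.
  have lt0 : size pre + clen (While p c) <= size prog.
    by rewrite Ep !size_cat size_code addnA leq_addr.
  have := @step_test prog (size pre) cf h T p (size pre + clen (While p c)).
  rewrite (negbTE pT); apply=> //; first by move: lt0 => /=; lia.
  by rewrite Ep /= nth_cat_size.
- move=> p c h T h1 T1 h2 T2 t1 t2 pT _ IH1 _ IH2 pre post prog cf Ep A.
  have lt0 : size pre + clen (While p c) <= size prog.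
    by rewrite Ep !size_cat size_code addnA leq_addr.
  have A1 : @at_pc (machine prog) (step (machine prog) cf) (size pre).+1 h T.
    have := @step_test prog (size pre) cf h T p (size pre + clen (While p c)).
    rewrite pT; apply=> //; first by move: lt0 => /=; lia.
    by rewrite Ep /= nth_cat_size.
  rewrite iterD; apply: (IH2 _ _ _ _ Ep).

  set pr0 := pre ++ [:: ITest p (size pre + clen (While p c))].
  have Es0 : size pr0 = (size pre).+1 by rewrite /pr0 size_cat /= addn1.
  have A2 := IH1 pr0 (ITest xpred0 (size pre) :: post) prog (step (machine prog) cf).
  rewrite Es0 in A2.
  have {}A2 := A2 _ A1; rewrite -iterSr in A2.
  have /A2 {}A2 : prog = pr0 ++ code (size pre).+1 c ++ ITest xpred0 (size pre) :: post.
    by rewrite Ep /pr0 /= -!catA.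
  have := @step_test prog ((size pre).+1 + clen c) _ h1 T1 xpred0 (size pre) _ _ _ A2.
  apply=> //; first by move: lt0 => /=; lia.
    set pr := pre ++ ITest p (size pre + clen (While p c)) :: code (size pre).+1 c.
    have -> : (size pre).+1 + clen c = size pr.
      by rewrite /pr size_cat /= size_code; lia.
    rewrite (_ : prog = pr ++ ITest xpred0 (size pre) :: post) ?nth_cat_size //.
    by rewrite Ep /pr /= -!catA /= -?catA.
  by move: lt0 => /=; lia.
Qed.

(** The index [size o] is included: there the right side is [None], and this blank stops
    [read_bits]. *)
Lemma read_bits_nth (o : seq bool) s :
  (forall j, j <= size o -> nth None s j = nth None (map Some o) j) ->
  read_bits s = o.
Proof.
elim: o s => [|b o IH] [|a s] //= H.
- by have := H 0 isT => /= ->.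
- by have := H 0 isT.
- have /= -> := H 0 isT; rewrite IH // => j lj; exact: (H j.+1).
Qed.

(** The input starts at cell 1 so that it already is stack 0 of the layout below. *)
Definition input_tape (x : seq bool) : tape :=
  fun z => if Z.ltb z 1 then None else nth None (map Some x) (Z.to_nat (z - 1)).


Lemma tprog_polytime (c : tprog) (f : seq bool -> seq bool) (k : nat) :
  (forall x, exists T t, [/\ t <= polybnd k (size x),
     texec c 1 (input_tape x) 1 T t &
     forall j, j <= size (f x) -> T (1 + Z.of_nat j)%Z = nth None (map Some (f x)) j]) ->
  PolyTimeComputable f.
Proof.
move=> H; exists (machine (code 0 c)), k => x.
have [T [t [let_ X Ho]]] := H x.
have A : @at_pc (machine (code 0 c)) (init (machine (code 0 c)) x) 0 1 (input_tape x).
  have nil0 j : nth None (map Some [::]) j = None :> option bool by rewrite nth_nil.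
  rewrite /input_tape; case: x {H let_ X Ho} => [|b x]; split=> // j;
    rewrite ?[c_left _]/= ?[c_right _]/=.
  - by rewrite nth_nil ifT //; lia.
  - by rewrite nth_nil ifF ?nil0 //; lia.
  - by rewrite nth_nil ifT //; lia.
  - rewrite ifF; last by lia.
    by rewrite -[LHS]/(nth None (Some b :: map Some x) j.+1); congr nth; lia.
exists t; split=> //.
have := code_correct X (pre := [::]) (post := [::]) (prog := code 0 c) _ A.
rewrite cats0 add0n => /(_ erefl) [E1 E2 _ E4]; split.
  by rewrite /halted /= /run E1 size_code.
apply: read_bits_nth => j lj; rewrite -Ho //.
case: j lj => [|j] lj; first by rewrite /run /= E2.
by rewrite /run [LHS]/= E4; congr T; lia.
Qed.

(** * Stack programs *)

(** A popping loop is at once the loop, the conditional and the only way to read or remove a bit, so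
    three constructs suffice. *)
Inductive stm :=
| Push of nat & bool
| Seq of stm & stm
| ForPop of nat & stm & stm.

Definition store := nat -> seq bool.

Definition upd (s : store) (i : nat) (v : seq bool) : store :=
  fun j => if j == i then v else s j.

Inductive exec : stm -> store -> store -> nat -> Prop :=
| EPush i b s : exec (Push i b) s (upd s i (b :: s i)) 1
| ESeq c1 c2 s s1 s2 t1 t2 :
    exec c1 s s1 t1 -> exec c2 s1 s2 t2 -> exec (Seq c1 c2) s s2 (t1 + t2)
| EPopN i c0 c1 s : s i = [::] -> exec (ForPop i c0 c1) s s 1
| EPopC i c0 c1 s b st s1 s2 t1 t2 : s i = b :: st ->
    exec (if b then c1 else c0) (upd s i st) s1 t1 ->
    exec (ForPop i c0 c1) s1 s2 t2 ->
    exec (ForPop i c0 c1) s s2 (t1 + t2).+1.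

Fixpoint stm_ok (W : nat) (c : stm) : bool :=
  match c with
  | Push i _ => i < W
  | Seq c1 c2 => stm_ok W c1 && stm_ok W c2
  | ForPop i c0 c1 => [&& i < W, stm_ok W c0 & stm_ok W c1]
  end.

Definition empty_from (W : nat) (s : store) := forall i, W <= i -> s i = [::].

Section Layout.

Variable W : nat.
Hypothesis W_gt0 : 0 < W.

(* Stack 0 occupies the cells 1, 2, ... bottom first; stacks 1, ..., W - 1 are
   interleaved with period W on the cells -2, -3, ...  The W-th track stays
   blank and cell -1 holds a mark, so that a head walking right along that track
   recognizes the end.  Between operations the head rests on the blank cell 0. *)
Definition cellpos (i r : nat) : Z :=
  (if i == 0%N then 1 + Z.of_nat r else -1 - Z.of_nat i - Z.of_nat (W * r))%Z.

Lemma cellpos0 r : cellpos 0 r = (1 + Z.of_nat r)%Z.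
Proof. by []. Qed.

Lemma cellposS i r :
  cellpos i.+1 r = (-1 - Z.of_nat i.+1 - Z.of_nat (W * r))%Z.
Proof. by []. Qed.

Definition cells (st : seq bool) : nat -> option bool :=
  nth None (map Some (rev st)).

Definition layout (s : store) : tape := fun z =>
  if Z.ltb 0 z then cells (s 0) (Z.to_nat (z - 1))
  else if Z.eqb z 0 then None
  else if Z.eqb z (-1) then Some true
  else let j := Z.to_nat (-2 - z) in cells (s (j %% W).+1) (j %/ W).

Arguments layout _ _%_Z.

Lemma cells_out st r : size st <= r -> cells st r = None.
Proof. by move=> le; rewrite /cells nth_default // size_map size_rev. Qed.

Lemma cells_in st r : r < size st -> isSome (cells st r).
Proof. by move=> lt; rewrite /cells (nth_map false) // size_rev. Qed.

Lemma cells_top b st : cells (b :: st) (size st) = Some b.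
Proof.
by rewrite /cells (nth_map false) ?size_rev //= rev_cons nth_rcons size_rev ltnn eqxx.
Qed.

Lemma cells_cons b st r :
  cells (b :: st) r = if r == size st then Some b else cells st r.
Proof.
case: eqP => [->|ne]; first exact: cells_top.
rewrite /cells rev_cons map_rcons nth_rcons size_map size_rev.
case: ltngtP ne => //= lt _; rewrite nth_default // size_map size_rev; exact: ltnW.
Qed.

(** The bound admits [i = W]: the blank track is read through the same formula when the head walks
    home. *)
Lemma layout_cell s i r : i <= W -> layout s (cellpos i r) = cells (s i) r.
Proof.
rewrite /layout; case: i => [|i] leW; rewrite ?cellpos0 ?cellposS.
  by rewrite ifT; [congr cells|]; lia.
rewrite ifF; last by lia.
rewrite ifF; last by lia.
rewrite ifF; last by lia.
have -> : Z.to_nat (-2 - (-1 - Z.of_nat i.+1 - Z.of_nat (W * r))) = r * W + i by lia.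
by rewrite modnMDl modn_small // divnMDl // divn_small // addn0.
Qed.

Lemma updt_layout s i r v x : i < W ->
  (forall r', cells x r' = if r' == r then v else cells (s i) r') ->
  updt (layout s) (cellpos i r) v = layout (upd s i x).
Proof.
move=> ltW H; apply: functional_extensionality => z; rewrite /updt.
case: Z.eqb_spec => [->|ne].
  by rewrite layout_cell 1?ltnW // /upd eqxx H eqxx.
rewrite /layout /upd; case: ifP => z0.
  case: eqP => // i0; rewrite H -i0 ifF //; apply/eqP => E.
  by apply: ne; rewrite -i0 cellpos0 -E; lia.
case: ifP => // z1; case: ifP => // z2.
case: eqP => // Ei; rewrite Ei H ifF //; apply/eqP => E.
apply: ne; rewrite -Ei cellposS -E.
move Ej: (Z.to_nat (-2 - z)) => j.
move: z0 z1 z2 (divn_eq j W); rewrite mulnC.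
by move: (j %% W) (W * (j %/ W)) => a c; lia.
Qed.

Lemma layout_push s i b : i < W ->
  updt (layout s) (cellpos i (size (s i))) (Some b) =
  layout (upd s i (b :: s i)).
Proof. by move=> lt; apply: updt_layout => // r'; exact: cells_cons. Qed.

Lemma layout_pop s i b st : i < W -> s i = b :: st ->
  updt (layout s) (cellpos i (size st)) None = layout (upd s i st).
Proof.
move=> lt E; apply: updt_layout => // r'; rewrite E cells_cons.
by case: (r' =P size st) => // ->; rewrite cells_out.
Qed.

Definition tmove m := Act id m.

Fixpoint tmoves (n : nat) (m : move) : tprog :=
  if n is n'.+1 then TSeq (tmove m) (tmoves n' m) else tmove MStay.

Definition shifted (m : move) (n : nat) (h : Z) : Z :=
  match m with
  | MLeft => h - Z.of_nat n | MRight => h + Z.of_nat n | MStay => h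
  end%Z.

Lemma tmove_exec m h T : texec (tmove m) h T (moved m h) T 1.
Proof. by have := XAct id m h T; rewrite updt_id. Qed.

Lemma tmoves_exec n m h T : texec (tmoves n m) h T (shifted m n h) T n.+1.
Proof.
elim: n h => [|n IH] h /=.
  rewrite [shifted _ _ _](_ : _ = h); first exact: tmove_exec.
  by rewrite /shifted; case: (m); lia.
rewrite -add1n; apply: XSeq (tmove_exec _ _ _) _.
rewrite (_ : shifted m n.+1 h = shifted m n (moved m h)) //.
by rewrite /shifted /moved; case: (m); lia.
Qed.

Lemma texec_pos c h T h1 T1 t h' h1' :
  texec c h T h1 T1 t -> h = h' -> h1 = h1' -> texec c h' T h1' T1 t.
Proof. by move=> X <- <-. Qed.

Definition tgoto i := if i == 0 then tmove MRight else tmoves i.+1 MLeft.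
Definition tup i := if i == 0 then tmove MRight else tmoves W MLeft.
Definition tdown i := if i == 0 then tmove MLeft else tmoves W MRight.
(** The head may rest on the blank cell above the top of stack 0, hence one unconditional step
    before walking down to cell 0. From another stack, [i] steps to the right reach the blank track
    or the mark itself, and strides of length [W] then stop at the mark. *)
Definition thome i :=
  if i == 0 then TSeq (tmove MLeft) (While isSome (tmove MLeft))
  else TSeq (tmoves i MRight)
         (TSeq (While (fun a => ~~ isSome a) (tmoves W MRight)) (tmove MRight)).

Lemma tgoto_exec i T : i < W ->
  exists2 t, t <= W + 2 & texec (tgoto i) 0 T (cellpos i 0) T t.
Proof.
rewrite /tgoto; case: i => [|i] lt; rewrite ?cellpos0 ?cellposS.
  by exists 1; [lia|apply: texec_pos (tmove_exec _ _ _) _ _].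
exists i.+3; first by lia.
by apply: texec_pos (tmoves_exec _ _ _ _) _ _ => //; rewrite /shifted; lia.
Qed.

Lemma tup_exec i r T :
  exists2 t, t <= W.+1 & texec (tup i) (cellpos i r) T (cellpos i r.+1) T t.
Proof.
rewrite /tup; case: i => [|i]; rewrite ?cellpos0 ?cellposS.
  by exists 1 => //; apply: texec_pos (tmove_exec _ _ _) _ _ => //; rewrite /moved; lia.
exists W.+1 => //.
by apply: texec_pos (tmoves_exec _ _ _ _) _ _ => //; rewrite /shifted mulnS; lia.
Qed.

Lemma tdown_exec i r T :
  exists2 t, t <= W.+1 & texec (tdown i) (cellpos i r.+1) T (cellpos i r) T t.
Proof.
rewrite /tdown; case: i => [|i]; rewrite ?cellpos0 ?cellposS.
  by exists 1 => //; apply: texec_pos (tmove_exec _ _ _) _ _ => //; rewrite /moved; lia.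
exists W.+1 => //.
by apply: texec_pos (tmoves_exec _ _ _ _) _ _ => //; rewrite /shifted mulnS; lia.
Qed.

Lemma tscan_exec i r s : i < W -> r <= size (s i) ->
  exists2 t, t <= (W + 3) * (size (s i) - r) + 1 &
    texec (While isSome (tup i)) (cellpos i r) (layout s)
      (cellpos i (size (s i))) (layout s) t.
Proof.
move=> ltW; move E: (size _ - r) => d; elim: d r E => [|d IH] r E le.
  have -> : r = size (s i) by lia.
  exists 1; first by rewrite muln0.
  by apply: XWhileF; rewrite layout_cell 1?ltnW // cells_out.
have [t1 l1 X1] := tup_exec i r (layout s).
have [t2 l2 X2] := IH r.+1 ltac:(lia) ltac:(lia).
exists (t2 + t1.+2); first by rewrite mulnS; lia.
by apply: XWhileT X1 X2; rewrite layout_cell ?cells_in //; lia.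
Qed.

Lemma thome0_exec r s : r <= size (s 0) ->
  exists2 t, t <= 3 * r + 1 &
    texec (While isSome (tmove MLeft)) (Z.of_nat r) (layout s) 0 (layout s) t.
Proof.
elim: r => [|r IH] le; first by exists 1 => //; exact: XWhileF.
have [|t l X] := IH; first exact: ltnW.
exists (t + 3); first by lia.
apply: (XWhileT (h1 := Z.of_nat r) (T1 := layout s)) X.
  rewrite (_ : Z.of_nat r.+1 = cellpos 0 r); last by rewrite cellpos0; lia.
  by rewrite layout_cell // cells_in.
by apply: texec_pos (tmove_exec _ _ _) _ _ => //; rewrite /moved; lia.
Qed.

Lemma thomeW_exec r s : empty_from W s ->
  exists2 t, t <= (W + 3) * r + 1 &
    texec (While (fun a => ~~ isSome a) (tmoves W MRight)) (-1 - Z.of_nat (W * r))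
      (layout s) (-1) (layout s) t.
Proof.
move=> sW; elim: r => [|r [t l X]].
  by rewrite !muln0; exists 1 => //; exact: XWhileF.
exists (t + W.+3); first by rewrite mulnS; lia.
apply: (XWhileT (h1 := (-1 - Z.of_nat (W * r))%Z) (T1 := layout s)) X.
  rewrite (_ : (-1 - _)%Z = cellpos W r).
    by rewrite layout_cell // sW // cells_out.
  by rewrite -(prednK W_gt0) cellposS (prednK W_gt0) mulnS; lia.
by apply: texec_pos (tmoves_exec _ _ _ _) _ _ => //; rewrite /shifted mulnS; lia.
Qed.

Lemma thome_exec i r s : i < W -> empty_from W s -> r <= size (s i) ->
  exists2 t, t <= (W + 3) * r.+1 &
    texec (thome i) (cellpos i r) (layout s) 0 (layout s) t.
Proof.
move=> ltW sW; rewrite /thome; case: i ltW => [|i] ltW le; rewrite ?cellpos0 ?cellposS.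
  have [t l X] := thome0_exec le; exists (1 + t).
    rewrite mulnS; have : 3 * r <= (W + 3) * r by rewrite leq_mul2r; lia.
    lia.
  by apply: XSeq X; apply: texec_pos (tmove_exec _ _ _) _ _ => //; rewrite /moved; lia.
have [t l X] := thomeW_exec r sW.
exists (i.+2 + (t + 1)); first by rewrite mulnS; lia.
apply: XSeq.
  by apply: texec_pos (tmoves_exec _ _ _ _) _ (erefl _).
apply: XSeq.
  by apply: texec_pos X _ _; rewrite /shifted //; lia.
by apply: (tmove_exec MRight (-1)).
Qed.

Definition twrite (a : option bool) := Act (fun _ => a) MStay.

Lemma twrite_exec a h T : texec (twrite a) h T h (updt T h a) 1.
Proof. exact: (XAct (fun _ => a) MStay h T). Qed.

(** The loop tests the bottom cell, which is nonblank exactly when the stack is nonempty. The popped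
    bit has to be remembered during the walk home; the branch taken remembers it, which is why both
    branches erase the cell themselves. *)
Definition tpoploop (i : nat) (c0 c1 : tprog) : tprog :=
  While isSome
    (TSeq (TSeq (While isSome (tup i)) (tdown i))
       (If (fun a => a == Some true)
          (TSeq (TSeq (twrite None) (thome i)) (TSeq c1 (tgoto i)))
          (TSeq (TSeq (twrite None) (thome i)) (TSeq c0 (tgoto i))))).

Fixpoint compile (c : stm) : tprog :=
  match c with
  | Push i b =>
      TSeq (tgoto i) (TSeq (While isSome (tup i)) (TSeq (twrite (Some b)) (thome i)))
  | Seq c1 c2 => TSeq (compile c1) (compile c2)
  | ForPop i c0 c1 =>
      TSeq (tgoto i) (TSeq (tpoploop i (compile c0) (compile c1)) (thome i))
  end.

Definition bounded (H : nat) (s : store) := forall i, size (s i) <= H.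

Lemma bounded_upd H s i v : bounded H s -> size v <= H -> bounded H (upd s i v).
Proof. by move=> B le j; rewrite /upd; case: eqP. Qed.

Lemma bounded_le H H' s : H <= H' -> bounded H s -> bounded H' s.
Proof. by move=> le B i; apply: leq_trans (B i) le. Qed.

Lemma empty_upd s i v : i < W -> empty_from W s -> empty_from W (upd s i v).
Proof. by move=> lt E j le; rewrite /upd ifF ?E //; apply/eqP; lia. Qed.

Lemma tpop_exec i b st s c0 c1 s1 t H : i < W -> empty_from W s -> empty_from W s1 ->
  bounded H s -> s i = b :: st ->
  texec (if b then c1 else c0) 0 (layout (upd s i st)) 0 (layout s1) t ->
  exists2 t', t' <= t + (W + 3) * (2 * H + 4) &
   forall s2 t2,
   texec (tpoploop i c0 c1) (cellpos i 0) (layout s1) (cellpos i 0) (layout s2) t2 ->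
   texec (tpoploop i c0 c1) (cellpos i 0) (layout s) (cellpos i 0) (layout s2) (t2 + t').
Proof.
move=> ltW sW sW1 B E X.
have szH : size st < H by have := B i; rewrite E.
have [t1 l1 X1] := @tscan_exec i 0 s ltW (leq0n _).
have [t3 l3 X3] := tdown_exec i (size st) (layout s).
have [|t4 l4 X4] := @thome_exec i (size st) (upd s i st) ltW (empty_upd _ ltW sW).
  by rewrite /upd eqxx.
have [t5 l5 X5] := tgoto_exec (layout s1) ltW.
have Xw := twrite_exec None (cellpos i (size st)) (layout s).
rewrite (layout_pop ltW E) in Xw.
have Xin := XSeq (XSeq Xw X4) (XSeq X X5).
have Es : size (s i) = (size st).+1 by rewrite E.
rewrite Es in X1 l1.
have top : layout s (cellpos i (size st)) = Some b.
  by rewrite layout_cell 1?ltnW // E cells_top.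
have lsz : (W + 3) * (size st).+1 <= (W + 3) * H by rewrite leq_mul2l szH orbT.
have pos0 : isSome (layout s (cellpos i 0)).
  by rewrite layout_cell 1?ltnW // cells_in // Es.
have bnd : t1 + t3 + (1 + t4 + (t + t5)).+2 + 2 <= t + (W + 3) * (2 * H + 4).
  by lia.
case: b {E} X Xin top => X Xin top.
  exists (t1 + t3 + (1 + t4 + (t + t5)).+2).+2; first by move: bnd; lia.
  move=> s2 t2 X2; apply: XWhileT X2 => //; apply: XSeq (XSeq X1 X3) _.
  by apply: XIfT => //; rewrite top.
exists (t1 + t3 + (1 + t4 + (t + t5)).+1).+2; first by move: bnd; lia.
move=> s2 t2 X2; apply: XWhileT X2 => //; apply: XSeq (XSeq X1 X3) _.
by apply: XIfF => //; rewrite top.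
Qed.

Definition unit_cost (M : nat) := (W + 3) * (4 * M + 8).

(** Strengthens the induction in [compile_exec]: the rest of a popping loop is again an execution of
    the whole statement, but the compiled code repeats only the bare loop, without the walks to and
    from the stack. The summand [(W + 3) * (M + 3)] reserves time for these two walks. *)
Definition loop_exec c s s' u M :=
  if c is ForPop i c0 c1 then
    exists2 t, t + (W + 3) * (M + 3) <= u &
      texec (tpoploop i (compile c0) (compile c1))
        (cellpos i 0) (layout s) (cellpos i 0) (layout s') t
  else True.

(** A step pushes at most one bit, so the heights stay below [H + t]; the common bound [M] allows
    one cost for all steps. *)
Lemma compile_exec c s s' t : exec c s s' t -> stm_ok W c -> empty_from W s ->
  forall H M, bounded H s -> H + t <= M ->
  [/\ empty_from W s', bounded (H + t) s' &
    exists t', [/\ t' <= t * unit_cost M,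
      texec (compile c) 0 (layout s) 0 (layout s') t' &
      loop_exec c s s' (t * unit_cost M) M]].
Proof.
have wrap i c0 c1 s1 s2 t1 t2 M : i < W -> empty_from W s2 ->
   t1 + (W + 3) * (M + 3) <= t2 * unit_cost M ->
   texec (tpoploop i (compile c0) (compile c1))
           (cellpos i 0) (layout s1) (cellpos i 0) (layout s2) t1 ->
   exists t', [/\ t' <= t2 * unit_cost M,
      texec (compile (ForPop i c0 c1)) 0 (layout s1) 0 (layout s2) t' &
      loop_exec (ForPop i c0 c1) s1 s2 (t2 * unit_cost M) M].
  move=> ltW sW le X.
  have [t3 l3 X3] := tgoto_exec (layout s1) ltW.
  have [t4 l4 X4] := thome_exec ltW sW (leq0n (size (s2 i))).
  exists (t3 + (t1 + t4)); split; last by exists t1.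
    by apply: leq_trans le; rewrite mulnDr; lia.
  exact: XSeq X3 (XSeq X X4).
elim=> {c s s' t}.
- move=> i b s /= ltW sW H M B le.
  have [t1 l1 X1] := tgoto_exec (layout s) ltW.
  have [t2 l2 X2] := @tscan_exec i 0 s ltW (leq0n _).
  have Xw := twrite_exec (Some b) (cellpos i (size (s i))) (layout s).
  rewrite (layout_push s b ltW) in Xw.
  have [|t3 l3 X3] := @thome_exec i (size (s i)) (upd s i (b :: s i))
     ltW (empty_upd _ ltW sW).
    by rewrite /upd eqxx.
  split; first exact: empty_upd.
    apply: bounded_upd; first by apply: bounded_le B; lia.
    by rewrite /= addn1 ltnS.
  exists (t1 + (t2 + (1 + t3))); split=> //; last exact: XSeq X1 (XSeq X2 (XSeq Xw X3)).
  have lM : (W + 3) * size (s i) <= (W + 3) * M.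
    by rewrite leq_mul2l; apply/orP; right; apply: leq_trans (B i) _; lia.
  by rewrite /unit_cost; lia.
- move=> c1 c2 s s1 s2 t1 t2 _ IH1 _ IH2 /= /andP[ok1 ok2] sW H M B le.
  have [|sW1 B1 [u1 [l1 X1 _]]] := IH1 ok1 sW H M B; first by lia.
  have [|sW2 B2 [u2 [l2 X2 _]]] := IH2 ok2 sW1 _ M B1; first by lia.
  rewrite addnA; split=> //; exists (u1 + u2); split=> //; first by rewrite mulnDl leq_add.
  exact: XSeq X1 X2.
- move=> i c0 c1 s E /and3P[ltW _ _] sW H M B le; split=> //.
    by apply: bounded_le B; rewrite leq_addr.
  apply: (wrap _ _ _ _ _ 1) => //.
    by rewrite /unit_cost; lia.
  by apply: XWhileF; rewrite layout_cell 1?ltnW // E cells_out.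
- move=> i c0 c1 s b st s1 s2 t1 t2 E _ IH1 _ IH2 /and3P[ltW ok0 ok1] sW H M B le.
  have B0 : bounded H (upd s i st).
    by apply: (bounded_upd _ B); have := B i; rewrite E; exact: ltnW.
  have okb : stm_ok W (if b then c1 else c0) by case: (b).
  have [|sW1 B1 [u1 [l1 X1 _]]] := IH1 okb (empty_upd _ ltW sW) H M B0; first by lia.
  have okF : stm_ok W (ForPop i c0 c1) by apply/and3P; split.
  have [|sW2 B2 [_ [_ _ [u2 l2 X2]]]] := IH2 okF sW1 _ M B1; first by lia.
  split=> //; first by apply: bounded_le B2; lia.
  have X1' : texec (if b then compile c1 else compile c0) 0 (layout (upd s i st)) 0 (layout s1) u1.
    by case: (b) X1.
  have [u3 l3 XX] := tpop_exec ltW sW sW1 B E X1'.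
  apply: (wrap _ _ _ _ _ (u2 + u3)) => //; last exact: XX.
  have : (W + 3) * (2 * H + 4) <= unit_cost M by rewrite /unit_cost leq_mul2l; lia.
  by rewrite mulSn mulnDl; lia.
Qed.

End Layout.

(** * Polynomially bounded runs *)

Lemma polybnd_ge a b c n : a * n ^ b + c <= polybnd (a + b + c) n.
Proof.
rewrite /polybnd; set K := a + b + c; case: n => [|n].
  have le1 : a * 0 ^ b <= a by case: (b) => [|b']; rewrite ?expn0 ?exp0n //; lia.
  by rewrite /K; lia.
suff : a * n.+1 ^ b <= K * n.+1 ^ K by rewrite /K; lia.
by apply: leq_mul; [|apply: leq_pexp2l]; rewrite // /K; lia.
Qed.

Lemma polybnd_pos k n : 0 < n -> polybnd k n <= 2 * k * n ^ k.
Proof.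
move=> n0; rewrite /polybnd -mulnA mul2n -addnn leq_add2l leq_pmulr //.
by rewrite expn_gt0 n0.
Qed.

Lemma polybnd_0 k : polybnd k 0 <= k.
Proof. by rewrite /polybnd; case: k => [|k] //; rewrite exp0n // muln0. Qed.

Lemma polybnd_mono k l n : k <= l -> polybnd k n <= polybnd l n.
Proof.
move=> le; case: n => [|n].
  rewrite /polybnd; case: k le => [|k] le; first by rewrite mul0n.
  by rewrite exp0n // muln0; apply: leq_trans le (leq_addl _ _).
by rewrite /polybnd leq_add // leq_mul // leq_pexp2l.
Qed.

Lemma polybnd_mul k l : exists K, forall n, polybnd k n * polybnd l n <= polybnd K n.
Proof.
(* For positive [n] each factor is at most [2 * k * n ^ k], whence the coefficient [4 * k * l] and
   the exponent [k + l]; the constant [k * l] covers [n = 0]. *)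
exists (4 * k * l + (k + l) + k * l) => n.
apply: leq_trans (polybnd_ge _ _ _ _); case: n => [|n].
  by apply: leq_trans (leq_addl _ _); apply: leq_mul; apply: polybnd_0.
apply: leq_trans (leq_addr _ _).
rewrite expnD (_ : 4 * k * l * _ = (2 * k * n.+1 ^ k) * (2 * l * n.+1 ^ l)); last by lia.
by apply: leq_mul; apply: polybnd_pos.
Qed.

Lemma polybnd_add k l n : polybnd k n + polybnd l n <= polybnd (2 * (k + l)) n.
Proof.
have H1 := polybnd_mono n (leq_addr l k); have H2 := polybnd_mono n (leq_addl k l).
set j := k + l in H1 H2 *.
apply: leq_trans (leq_add H1 H2) _; case: n {H1 H2} => [|n].
  by apply: leq_trans (leq_addl _ _); rewrite mul2n -addnn leq_add // polybnd_0.
rewrite addnn -mul2n /polybnd mulnDr mulnA leq_add2r leq_mul // leq_pexp2l //; lia.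
Qed.

Section Bounds.

Variables (P : Type) (D : P -> Prop) (sz : P -> nat).

Definition pbounded (g : P -> nat) :=
  exists k, forall p, D p -> g p <= polybnd k (sz p).

Lemma pbounded_le g h : (forall p, D p -> g p <= h p) -> pbounded h -> pbounded g.
Proof. by move=> le [k H]; exists k => p Dp; apply: leq_trans (le p Dp) (H p Dp). Qed.

Lemma pbounded_const c : pbounded (fun=> c).
Proof. by exists c => p _; rewrite /polybnd leq_addl. Qed.

Lemma pbounded_size : pbounded sz.
Proof.
exists 1 => p _; rewrite /polybnd expn1; lia.
Qed.

Lemma pbounded_add g h : pbounded g -> pbounded h -> pbounded (fun p => g p + h p).
Proof.
move=> [k Hk] [l Hl]; exists (2 * (k + l)) => p Dp.
by apply: leq_trans (polybnd_add _ _ _); apply: leq_add; [apply: Hk|apply: Hl].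
Qed.

Lemma pbounded_mul g h : pbounded g -> pbounded h -> pbounded (fun p => g p * h p).
Proof.
move=> [k Hk] [l Hl]; have [K HK] := polybnd_mul k l; exists K => p Dp.
by apply: leq_trans (HK _); apply: leq_mul; [apply: Hk|apply: Hl].
Qed.

Lemma pbounded_exp g m : pbounded g -> pbounded (fun p => g p ^ m).
Proof.
move=> H; elim: m => [|m IH]; first exact: pbounded_const.
by apply: pbounded_le (pbounded_mul H IH) => p _; rewrite expnS.
Qed.

(** One program on a family of stores, with time polynomial in [sz p] rather than in the size of the
    store. Indexing a loop body by pairs [(p, j)] with the size of [p] makes its bound uniform in
    the round [j]. *)
Definition Run (c : stm) (s s' : P -> store) :=
  exists k, forall p, D p -> exists2 t, t <= polybnd k (sz p) & exec c (s p) (s' p) t.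

Lemma Run_eq c s s' r r' : (forall p, D p -> s p = r p) -> (forall p, D p -> s' p = r' p) ->
  Run c s s' -> Run c r r'.
Proof.
by move=> E E' [k H]; exists k => p Dp; have := H p Dp; rewrite E // E'.
Qed.

Lemma Run_push i b s : Run (Push i b) s (fun p => upd (s p) i (b :: s p i)).
Proof. by exists 1 => p _; exists 1; [rewrite /polybnd leq_addl|exact: EPush]. Qed.

Lemma Run_seq c1 c2 s s1 s2 : Run c1 s s1 -> Run c2 s1 s2 -> Run (Seq c1 c2) s s2.
Proof.
move=> [k H] [l H']; exists (2 * (k + l)) => p Dp.
have [t le X] := H p Dp; have [t' le' X'] := H' p Dp.
exists (t + t'); last exact: ESeq X X'.
by apply: leq_trans (polybnd_add _ _ _); apply: leq_add.
Qed.

End Bounds.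

(** [F (p, j)] is the store after [j] rounds and [B p] the initial content of the stack. There are
    polynomially many rounds, each of a cost bounded independently of [j]. *)
Lemma Run_forpop (P : Type) (D : P -> Prop) (sz : P -> nat) (i : nat) (c0 c1 : stm)
    (B : P -> seq bool) (F : P * nat -> store) :
  pbounded D sz (fun p => size (B p)) ->
  (forall p j, D p -> j <= size (B p) -> F (p, j) i = drop j (B p)) ->
  (forall b : bool, Run
    (fun pj => D pj.1 /\ pj.2 < size (B pj.1) /\ nth false (B pj.1) pj.2 = b)
    (fun pj => sz pj.1) (if b then c1 else c0)
    (fun pj => upd (F pj) i (drop pj.2.+1 (B pj.1)))
    (fun pj => F (pj.1, pj.2.+1))) ->
  Run D sz (ForPop i c0 c1) (fun p => F (p, 0)) (fun p => F (p, size (B p))).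
Proof.
move=> [kB HB] HF Hb.
have [k1 H1] := Hb true; have [k0 H0] := Hb false.
have [K HK] := polybnd_mul kB (2 * (k1 + k0 + 1)).
exists (2 * (K + 1)) => p Dp.
suff [t le X] : exists2 t, t <= size (B p) * polybnd (2 * (k1 + k0 + 1)) (sz p) + 1 &
   exec (ForPop i c0 c1) (F (p, 0)) (F (p, size (B p))) t.
  exists t => //; apply: leq_trans le _; apply: leq_trans (polybnd_add _ _ _).
  apply: leq_add; last by rewrite /polybnd leq_addl.
  by apply: leq_trans (HK _); rewrite leq_mul2r HB ?orbT.
rewrite -[X in X * _]subn0.
suff G j d : d = size (B p) - j -> j <= size (B p) ->
  exists2 t, t <= d * polybnd (2 * (k1 + k0 + 1)) (sz p) + 1 &
   exec (ForPop i c0 c1) (F (p, j)) (F (p, size (B p))) t by exact: G.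
elim: d j => [|d IH] j Ed lej.
  have -> : j = size (B p) by lia.
  by exists 1 => //; apply: EPopN; rewrite HF // drop_size.
have ltj : j < size (B p) by lia.
have [t2 l2 X2] := IH j.+1 ltac:(lia) ltj.
have E : F (p, j) i = nth false (B p) j :: drop j.+1 (B p).
  by rewrite HF // (drop_nth false).
have [t1 l1 X1] : exists2 t, t <= polybnd (k1 + k0) (sz p) &
    exec (if nth false (B p) j then c1 else c0)
      (upd (F (p, j)) i (drop j.+1 (B p))) (F (p, j.+1)) t.
  case Eb: (nth false (B p) j).
    have [|t le X] := H1 (p, j); first by [].
    by exists t => //; apply: leq_trans le _; apply: polybnd_mono; rewrite leq_addr.
  have [|t le X] := H0 (p, j); first by [].
  by exists t => //; apply: leq_trans le _; apply: polybnd_mono; rewrite leq_addl.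
exists (t1 + t2).+1; last exact: EPopC E X1 X2.
have := polybnd_add (k1 + k0) 1 (sz p); rewrite {2}/polybnd mulSn; lia.
Qed.

(** With only stack 0 filled the layout is the same for every width, so width 1 stands for all. The
    reversal arises because the head of a list is the top of the stack while cell 1 holds the
    bottom. *)
Lemma tape_layout (x : seq bool) :
  updt (input_tape x) (-1) (Some true) = layout 1 (fun i => if i == 0 then rev x else [::]).
Proof.
apply: functional_extensionality => z; rewrite /updt /layout /input_tape.
case: Z.eqb_spec => [->|ne] //; case: ifP => z1.
  rewrite ifF; last by lia.
  by case: ifP => // z2; rewrite cells_out.
by rewrite ifT; [rewrite /cells /= revK|lia].
Qed.

Lemma stm_polytime (W : nat) (c : stm) (f : seq bool -> seq bool) (s' : seq bool -> store) :
  0 < W -> stm_ok W c ->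
  Run (fun _ => True) size c (fun x i => if i == 0 then rev x else [::]) s' ->
  (forall x, s' x 0 = rev (f x)) -> PolyTimeComputable f.
Proof.
move=> W0 ok [k Hk] Hf.
pose setup := TSeq (tmove MLeft) (TSeq (tmove MLeft) (Act (fun=> Some true) MRight)).
have [K HK] : pbounded (fun _ : seq bool => True) size (fun x =>
    3 + (polybnd k (size x) * unit_cost W (size x + polybnd k (size x)) + 1)).
  have Hp : pbounded (fun _ : seq bool => True) size (fun x => polybnd k (size x)).
    by exists k.
  rewrite /unit_cost.
  by do ?[exact: pbounded_const | exact: pbounded_size | exact: Hp
    | apply: pbounded_add | apply: pbounded_mul].
apply: (@tprog_polytime (TSeq setup (TSeq (compile W c) (tmove MRight))) _ K) => x.
have [t le X] := Hk x I.
have E0 : empty_from W (fun i => if i == 0 then rev x else [::]).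
  by move=> i lei; case: eqP => // i0; lia.
have B0 : bounded (size x) (fun i => if i == 0 then rev x else [::]).
  by move=> i; case: eqP; rewrite ?size_rev.
have [_ _ [t1 [l1 X1 _]]] := compile_exec W0 X ok E0 B0 (leqnn _).
have Xs := XSeq (tmove_exec MLeft 1 (input_tape x)) (XSeq (tmove_exec MLeft 0 _)
   (XAct (fun=> Some true) MRight (-1) _)).
rewrite tape_layout in Xs.
exists (layout W (s' x)), (1 + (1 + 1) + (t1 + 1)); split.
- apply: leq_trans (HK x I).
  rewrite leq_add2l leq_add2r; apply: leq_trans l1 _; apply: leq_mul => //.
  by rewrite /unit_cost leq_mul2l; lia.
- apply: XSeq Xs _; apply: XSeq (tmove_exec MRight 0 _).
  suff -> : layout 1 (fun i => if i == 0 then rev x else [::]) =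
            layout W (fun i => if i == 0 then rev x else [::]) by [].
  apply: functional_extensionality => z; rewrite /layout.
  by case: ifP => // _; case: ifP => // _; case: ifP => // _; rewrite !cells_out.
- by move=> j _; rewrite -[(1 + _)%Z]/(cellpos W 0 j) layout_cell // /cells Hf revK.
Qed.

(** * Counters and output *)

Ltac store_eq :=
  apply: functional_extensionality => ?; rewrite /upd; repeat (case: eqP => ?; subst);
  try lia; try done.

Lemma upd_id s i : upd s i (s i) = s.
Proof. by store_eq. Qed.

Lemma upd_same s i v w : upd (upd s i v) i w = upd s i w.
Proof. by store_eq. Qed.

(* Stack 0 holds the output read backwards, stack 2 is scratch space. *)
Notation scratch := 2.

(** Neutral because [scratch] is kept empty between operations, so that neither body is ever run. *)
Definition skip : stm := ForPop scratch (Push scratch true) (Push scratch true).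
Definition sseq (cs : seq stm) : stm := foldr Seq skip cs.
Definition loop (i : nat) (c : stm) : stm := ForPop i c c.
Definition addto (v w : nat) : stm :=
  Seq (loop v (Seq (Push scratch true) (Push w true))) (loop scratch (Push v true)).
Definition pushes (i : nat) (bs : seq bool) : stm := sseq [seq Push i b | b <- bs].
Definition addc (v c : nat) : stm := pushes v (nseq c true).
Definition emits (bs : seq bool) : stm := pushes 0 bs.

(* The operand (v, c) denotes the value of counter v plus c. *)
Definition operand := (nat * nat)%type.
Definition emitnat (o : operand) : stm :=
  Seq (addto o.1 0) (Seq (addc 0 o.2) (Push 0 false)).

Section Macros.

Variables (P : Type) (D : P -> Prop) (sz : P -> nat).
Implicit Types (s : P -> store).
Local Notation Run := (Run D sz).

Definition scratch_empty s := forall p, D p -> s p scratch = [::].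

Lemma Run_skip s : scratch_empty s -> Run skip s s.
Proof.
by move=> E; exists 1 => p Dp; exists 1; [rewrite /polybnd leq_addl|apply: EPopN; exact: E].
Qed.

Lemma Run_pushes s i bs : scratch_empty s -> i != scratch ->
  Run (pushes i bs) s (fun p => upd (s p) i (rev bs ++ s p i)).
Proof.
move=> E ne; elim: bs s E => [|b bs IH] s E.
  by apply: Run_eq (Run_skip E) => // p _; rewrite upd_id.
apply: Run_seq (Run_push _ _ i b s) _.
have E1 : scratch_empty (fun p => upd (s p) i (b :: s p i)).
  by move=> p Dp; rewrite /upd eq_sym (negbTE ne) E.
apply: Run_eq (IH _ E1) => // p _.
by rewrite upd_same /upd eqxx rev_cons cat_rcons.
Qed.

Lemma Run_addc s v c : scratch_empty s -> v != scratch ->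
  Run (addc v c) s (fun p => upd (s p) v (nseq c true ++ s p v)).
Proof.
move=> E ne; apply: Run_eq (Run_pushes _ E ne) => // p _.
by rewrite rev_nseq.
Qed.

Lemma Run_emits s bs : scratch_empty s ->
  Run (emits bs) s (fun p => upd (s p) 0 (rev bs ++ s p 0)).
Proof. by move=> E; exact: Run_pushes. Qed.

End Macros.

Lemma Run_loop (P : Type) (D : P -> Prop) sz i c (n : P -> nat) (F : P * nat -> store) :
  pbounded D sz n ->
  (forall p j, D p -> j <= n p -> F (p, j) i = nseq (n p - j) true) ->
  Run (fun pj => D pj.1 /\ pj.2 < n pj.1) (fun pj => sz pj.1) c
    (fun pj => upd (F pj) i (nseq (n pj.1 - pj.2.+1) true))
    (fun pj => F (pj.1, pj.2.+1)) ->
  Run D sz (loop i c) (fun p => F (p, 0)) (fun p => F (p, n p)).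
Proof.
move=> Bn HF [k Hc].
suff : Run D sz (loop i c) (fun p => F (p, 0)) (fun p => F (p, size (nseq (n p) true))).
  by apply: Run_eq => // p _; rewrite size_nseq.
apply: Run_forpop.
- by apply: pbounded_le Bn => p _; rewrite size_nseq.
- by move=> p j Dp; rewrite size_nseq drop_nseq; exact: HF.
- move=> b; exists k => -[p j] /= [Dp]; rewrite size_nseq => -[lt _].
  by rewrite drop_nseq; case: b; apply: (Hc (p, j)).
Qed.

Definition counter (P : Type) (D : P -> Prop) sz (s : P -> store) (v : nat) (n : P -> nat) :=
  pbounded D sz n /\ forall p, D p -> s p v = nseq (n p) true.

Lemma Run_addto (P : Type) (D : P -> Prop) sz s v w n :
  scratch_empty D s -> counter D sz s v n ->
  v != scratch -> w != scratch -> v != w ->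
  Run D sz (addto v w) s (fun p => upd (s p) w (nseq (n p) true ++ s p w)).
Proof.
move=> E [Bn Ev] /eqP vt /eqP wt /eqP vw.
pose F (pj : P * nat) := let: (p, j) := pj in
  upd (upd (upd (s p) v (nseq (n p - j) true)) scratch (nseq j true)) w
    (nseq j true ++ s p w).
pose G (pj : P * nat) := let: (p, j) := pj in
  upd (upd (upd (s p) scratch (nseq (n p - j) true)) v (nseq j true)) w
    (nseq (n p) true ++ s p w).
have RF : Run D sz (loop v (Seq (Push scratch true) (Push w true)))
    (fun p => F (p, 0)) (fun p => F (p, n p)).
  apply: (Run_loop (F := F)) => //.
    by move=> p j Dp le; rewrite /F /upd eqxx !ifF //; apply/eqP.
  apply: Run_eq (Run_seq (Run_push _ _ _ _ _) (Run_push _ _ _ _ _)); first by [].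
  move=> [p j] /= [Dp lt]; rewrite /F; store_eq.
have RG : Run D sz (loop scratch (Push v true)) (fun p => G (p, 0)) (fun p => G (p, n p)).
  apply: (Run_loop (F := G)) => //.
    by move=> p j Dp le; rewrite /G /upd eqxx !ifF //; apply/eqP; congruence.
  apply: Run_eq (Run_push _ _ _ _ _); first by [].
  by move=> [p j] /= [Dp lt]; rewrite /G; store_eq.
have RG' : Run D sz (loop scratch (Push v true)) (fun p => F (p, n p))
   (fun p => upd (s p) w (nseq (n p) true ++ s p w)).
  by apply: Run_eq RG => p Dp; rewrite /F /G ?subnn ?subn0; store_eq; rewrite ?E ?Ev.
apply: Run_seq _ RG'.
by apply: Run_eq RF => // p Dp; rewrite /F subn0; store_eq; rewrite ?E ?Ev.
Qed.

Lemma nseq_cat (T : Type) a b (x : T) l : nseq a x ++ nseq b x ++ l = nseq (a + b) x ++ l.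
Proof. by rewrite catA -nseqD. Qed.

Section Arithmetic.

Variables (P : Type) (D : P -> Prop) (sz : P -> nat).
Implicit Types (s : P -> store).
Local Notation Run := (Run D sz).

Lemma scratch_upd s i (v : P -> seq bool) :
  scratch_empty D s -> i != scratch -> scratch_empty D (fun p => upd (s p) i (v p)).
Proof. by move=> E ne p Dp; rewrite /upd eq_sym (negbTE ne) E. Qed.

Lemma counter_upd s i (v : P -> seq bool) j n :
  counter D sz s j n -> i != j -> counter D sz (fun p => upd (s p) i (v p)) j n.
Proof. by move=> [B E] ne; split=> // p Dp; rewrite /upd eq_sym (negbTE ne) E. Qed.

Lemma counter_set s i n :
  pbounded D sz n -> counter D sz (fun p => upd (s p) i (nseq (n p) true)) i n.
Proof. by move=> B; split=> // p _; rewrite /upd eqxx. Qed.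

Definition addm (m v w : nat) : stm := sseq (nseq m (addto v w)).

Lemma Run_addm m s v w n : scratch_empty D s -> counter D sz s v n ->
  v != scratch -> w != scratch -> v != w ->
  Run (addm m v w) s (fun p => upd (s p) w (nseq (m * n p) true ++ s p w)).
Proof.
move=> E C v2 w2 vw; elim: m s E C => [|m IH] s E C.
  by apply: Run_eq (Run_skip _ E) => // p _; rewrite upd_id.
apply: Run_seq (Run_addto E C v2 w2 vw) _.
have wv : w != v by rewrite eq_sym.
apply: Run_eq (IH _ (scratch_upd _ E w2) (counter_upd _ C wv)) => // p _.
by rewrite upd_same /upd eqxx nseq_cat mulSn addnC.
Qed.

(** The product cannot be collected in [u], which drives the loop; it is collected in [t] and then
    moved, so [t] is empty again at the end. *)
Definition mulin (u n t : nat) : stm := Seq (loop u (addto n t)) (loop t (Push u true)).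

Lemma Run_mulin s u n t a b : scratch_empty D s ->
  counter D sz s u a -> counter D sz s n b -> (forall p, D p -> s p t = [::]) ->
  uniq [:: u; n; t; scratch] ->
  Run (mulin u n t) s (fun p => upd (s p) u (nseq (a p * b p) true)).
Proof.
rewrite /= !inE !negb_or -!andbA => E [Ba Ea] [Bb Eb] Et.
move=> /and5P[un ut u2 nt /and3P[n2 t2 _]].
have [tu nu] : t != u /\ n != u by rewrite eq_sym ut eq_sym un.
have [s2t s2u] : scratch != t /\ scratch != u by rewrite eq_sym t2 eq_sym u2.
pose F (pj : P * nat) := let: (p, j) := pj in
  upd (upd (s p) u (nseq (a p - j) true)) t (nseq (j * b p) true).
pose G (pj : P * nat) := let: (p, j) := pj in
  upd (upd (s p) u (nseq j true)) t (nseq (a p * b p - j) true).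
have RF : Run (loop u (addto n t)) (fun p => F (p, 0)) (fun p => F (p, a p)).
  apply: (Run_loop (F := F)) => //.
    by move=> p j Dp le; rewrite /F /upd (negbTE ut) eqxx.
  apply: Run_eq (Run_addto (n := fun pj => b pj.1) _ _ n2 t2 nt); first by [].
  - move=> [p j] /= [Dp lt]; rewrite /F; apply: functional_extensionality => i.
    rewrite /upd eqxx (negbTE tu); case: (i =P t) => // _.
      by rewrite -nseqD -mulSn.
    by case: eqP.
  - by move=> [p j] /= [Dp lt]; rewrite /F /upd (negbTE s2u) (negbTE s2t) E.
  - split=> [|[p j] /= [Dp lt]]; last first.
      by rewrite /F /upd (negbTE nt) (negbTE nu) Eb.
    by case: Bb => k Hk; exists k => -[p j] [Dp _]; exact: Hk.
have RG : Run (loop t (Push u true)) (fun p => G (p, 0)) (fun p => G (p, a p * b p)).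
  apply: (Run_loop (F := G)) => //; first exact: pbounded_mul.
    by move=> p j Dp le; rewrite /G /upd eqxx.
  apply: Run_eq (Run_push _ _ _ _ _); first by [].
  move=> [p j] /= [Dp lt]; rewrite /G; apply: functional_extensionality => i.
  rewrite /upd (negbTE ut) eqxx; case: (i =P u) => [->|_].
    by rewrite (negbTE ut).
  by case: eqP.
have RG' : Run (loop t (Push u true)) (fun p => F (p, a p))
   (fun p => upd (s p) u (nseq (a p * b p) true)).
  apply: Run_eq RG => p Dp; first by rewrite /F /G subnn subn0.
  apply: functional_extensionality => i; rewrite /G /upd subnn.
  by case: eqP => // ->; rewrite eq_sym (negbTE ut) Et.
apply: Run_seq _ RG'.
apply: Run_eq RF => // p Dp; apply: functional_extensionality => i.
rewrite /F /upd subn0 mul0n.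
by case: eqP => [->|_]; [rewrite Et|case: eqP => // ->; rewrite Ea].
Qed.

Definition powin (k u n t : nat) : stm := sseq (nseq k (mulin u n t)).

Lemma Run_powin k s u n t a b : scratch_empty D s ->
  counter D sz s u a -> counter D sz s n b -> (forall p, D p -> s p t = [::]) ->
  uniq [:: u; n; t; scratch] ->
  Run (powin k u n t) s (fun p => upd (s p) u (nseq (a p * b p ^ k) true)).
Proof.
move=> E Ca Cb Et U; elim: k s a E Ca Cb Et => [|k IH] s a E Ca Cb Et.
  by apply: Run_eq (Run_skip _ E) => // p Dp; rewrite expn0 muln1 -(Ca.2 p Dp) upd_id.
apply: Run_seq (Run_mulin E Ca Cb Et U) _.
move: (U); rewrite /= !inE !negb_or -!andbA.
move=> /and5P[un ut u2 nt /and3P[n2 t2 _]].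
have Ca' := counter_set s u (pbounded_mul Ca.1 Cb.1).
apply: Run_eq (IH _ _ (scratch_upd _ E u2) Ca' (counter_upd _ Cb un) _) => //.
  by move=> p _; rewrite upd_same expnS mulnA.
by move=> p Dp; rewrite /upd eq_sym (negbTE ut) Et.
Qed.

Lemma Run_emitnat s o n : scratch_empty D s -> counter D sz s o.1 n ->
  o.1 != 0 -> o.1 != scratch ->
  Run (emitnat o) s (fun p => upd (s p) 0 (rev (code_nat (n p + o.2)) ++ s p 0)).
Proof.
move=> E C v0 v2; apply: Run_seq (Run_addto E C v2 _ v0) _ => //.
apply: Run_seq (Run_addc _ _ (scratch_upd _ E _) _) _ => //.
apply: Run_eq (Run_push _ _ _ _ _) => // p Dp.
by rewrite !upd_same /upd eqxx nseq_cat /code_nat rev_cat rev_nseq addnC.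
Qed.

End Arithmetic.

(** * Symbolic gates *)

(** Wire numbers are relative to counters: a list of symbolic gates is a constant of the program,
    and each valuation [r] of the counters yields a copy of it at another place. *)
Inductive sgate := SAnd of operand & operand | SOr of operand & operand | SNot of operand.

Definition opval (r : nat -> nat) (o : operand) := r o.1 + o.2.

Definition instg (r : nat -> nat) (g : sgate) : gate :=
  match g with
  | SAnd a b => GAnd (opval r a) (opval r b)
  | SOr a b => GOr (opval r a) (opval r b)
  | SNot a => GNot (opval r a)
  end.

Definition emitgate (g : sgate) : stm :=
  match g with
  | SAnd a b => Seq (emits [:: true; true]) (Seq (emitnat a) (emitnat b))
  | SOr a b => Seq (emits [:: true; false]) (Seq (emitnat a) (emitnat b))
  | SNot a => Seq (emits [:: false; true]) (emitnat a)
  end.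

Definition sgate_in (vs : seq nat) (g : sgate) : bool :=
  match g with
  | SAnd a b | SOr a b => (a.1 \in vs) && (b.1 \in vs)
  | SNot a => a.1 \in vs
  end.

Definition emitgates (gs : seq sgate) : stm := sseq (map emitgate gs).

Section Emit.

Variables (P : Type) (D : P -> Prop) (sz : P -> nat).
Local Notation Run := (Run D sz).

Lemma Run_emitgate s vs r g : scratch_empty D s ->
  (forall v, v \in vs -> counter D sz s v (r ^~ v)) ->
  0 \notin vs -> scratch \notin vs -> sgate_in vs g ->
  Run (emitgate g) s (fun p => upd (s p) 0 (rev (code_gate (instg (r p) g)) ++ s p 0)).
Proof.
move=> E C n0 n2.
have nz v : v \in vs -> v != 0 by move=> vin; apply: contraNneq n0 => <-.
have nt v : v \in vs -> v != scratch by move=> vin; apply: contraNneq n2 => <-.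
have step1 s0 o : scratch_empty D s0 -> (forall v, v \in vs -> counter D sz s0 v (r ^~ v)) ->
   o.1 \in vs -> Run (emitnat o) s0
     (fun p => upd (s0 p) 0 (rev (code_nat (opval (r p) o)) ++ s0 p 0)).
  by move=> E0 C0 oin; apply: Run_emitnat => //; [exact: C0|exact: nz|exact: nt].
have C1 s0 w : (forall v, v \in vs -> counter D sz s0 v (r ^~ v)) ->
  forall v, v \in vs -> counter D sz (fun p => upd (s0 p) 0 (w p)) v (r ^~ v).
  by move=> C0 v vin; apply: counter_upd; [exact: C0|rewrite eq_sym nz].
case: g => [a b|a b|a] /=; try case/andP=> ain bin; try move=> ain;
  (apply: Run_seq (Run_emits _ _ E) _);
  try (apply: Run_seq (step1 _ _ (scratch_upd _ E _) (C1 _ _ C) ain) _ => //).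
- apply: Run_eq (step1 _ _ (scratch_upd _ (scratch_upd _ E _) _) (C1 _ _ (C1 _ _ C)) bin) => //.
  by move=> p _; rewrite !upd_same /upd !eqxx /= !(rev_cons, rev_cat) -!cats1 -!catA.
- apply: Run_eq (step1 _ _ (scratch_upd _ (scratch_upd _ E _) _) (C1 _ _ (C1 _ _ C)) bin) => //.
  by move=> p _; rewrite !upd_same /upd !eqxx /= !(rev_cons, rev_cat) -!cats1 -!catA.
- apply: Run_eq (step1 _ _ (scratch_upd _ E _) (C1 _ _ C) ain) => //.
  by move=> p _; rewrite !upd_same /upd !eqxx /= !(rev_cons, rev_cat) -!cats1 -!catA.
Qed.

Lemma Run_emitgates s vs r gs : scratch_empty D s ->
  (forall v, v \in vs -> counter D sz s v (r ^~ v)) ->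
  0 \notin vs -> scratch \notin vs -> all (sgate_in vs) gs ->
  Run (emitgates gs) s
    (fun p => upd (s p) 0 (rev (flatten (map code_gate (map (instg (r p)) gs))) ++ s p 0)).
Proof.
move=> E C n0 n2; elim: gs s E C => [|g gs IH] s E C /=.
  by move=> _; apply: Run_eq (Run_skip _ E) => // p _; rewrite upd_id.
case/andP=> gin gsin; apply: Run_seq (Run_emitgate E C n0 n2 gin) _.
apply: Run_eq (IH _ (scratch_upd _ E _) _ gsin) => //.
  by move=> p _; rewrite upd_same /upd eqxx rev_cat catA.
move=> v vin; apply: counter_upd; first exact: C.
by apply: contraNneq n0 => ->.
Qed.

End Emit.

(** * Circuits from formulas *)

Inductive form := FVar of nat | FNot of form | FAnd of form & form | FOr of form & form.

Fixpoint feval (e : nat -> bool) (f : form) : bool :=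
  match f with
  | FVar v => e v
  | FNot f => ~~ feval e f
  | FAnd f g => feval e f && feval e g
  | FOr f g => feval e f || feval e g
  end.

Fixpoint fsize (f : form) : nat :=
  match f with
  | FVar _ => 1
  | FNot f => (fsize f).+1
  | FAnd f g | FOr f g => (fsize f + fsize g).+1
  end.

Fixpoint fbelow (m : nat) (f : form) : bool :=
  match f with
  | FVar v => v < m
  | FNot f => fbelow m f
  | FAnd f g | FOr f g => fbelow m f && fbelow m g
  end.

Lemma fsize_gt0 f : 0 < fsize f. Proof. by case: f. Qed.

Definition oadd (b : operand) (k : nat) : operand := (b.1, b.2 + k).

Lemma opval_oadd r b k : opval r (oadd b k) = opval r b + k.
Proof. by rewrite /opval /oadd /= addnA. Qed.

(** The gates occupy the wires from [b] on, and the last one carries the value. A variable costs one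
    gate, its conjunction with itself, so that this also holds for variables and the number of gates
    is [fsize]. *)
Fixpoint fgates (b : operand) (w : nat -> operand) (f : form) : seq sgate :=
  match f with
  | FVar v => [:: SAnd (w v) (w v)]
  | FNot f => rcons (fgates b w f) (SNot (oadd b (fsize f).-1))
  | FAnd f g =>
      rcons (fgates b w f ++ fgates (oadd b (fsize f)) w g)
        (SAnd (oadd b (fsize f).-1) (oadd b (fsize f + (fsize g).-1)))
  | FOr f g =>
      rcons (fgates b w f ++ fgates (oadd b (fsize f)) w g)
        (SOr (oadd b (fsize f).-1) (oadd b (fsize f + (fsize g).-1)))
  end.

Lemma size_fgates b w f : size (fgates b w f) = fsize f.
Proof.
by elim: f b => [v|f IH|f IHf g IHg|f IHf g IHg] b //=;
  rewrite size_rcons ?size_cat ?IH ?IHf ?IHg.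
Qed.

Lemma fgates_in vs b w f m : fbelow m f -> b.1 \in vs ->
  (forall v, v < m -> (w v).1 \in vs) -> all (sgate_in vs) (fgates b w f).
Proof.
move=> fm bin win; elim: f fm b bin => [v|f IH|f IHf g IHg|f IHf g IHg] /=.
- by move=> vm b _; rewrite win.
- by move=> fm b bin; rewrite all_rcons /= bin IH.
- by case/andP=> fm gm b bin; rewrite all_rcons all_cat /= bin IHf ?IHg.
- by case/andP=> fm gm b bin; rewrite all_rcons all_cat /= bin IHf ?IHg.
Qed.

Lemma eval_wires_cat C1 C2 ws : eval_wires (C1 ++ C2) ws = eval_wires C2 (eval_wires C1 ws).
Proof. by rewrite /eval_wires foldl_cat. Qed.

Lemma eval_wires_rcons C g ws :
  eval_wires (rcons C g) ws = rcons (eval_wires C ws) (eval_gate (eval_wires C ws) g).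
Proof. by rewrite -cats1 eval_wires_cat. Qed.

Lemma wf_from_cat k C1 C2 : wf_from k (C1 ++ C2) = wf_from k C1 && wf_from (k + size C1) C2.
Proof. by elim: C1 k => [|g C1 IH] k /=; rewrite ?addn0 // IH andbA addSnnS. Qed.

Lemma wf_from_rcons k C g : wf_from k (rcons C g) = wf_from k C && gate_wf (k + size C) g.
Proof. by rewrite -cats1 wf_from_cat /= andbT. Qed.

Section Compile.

Variables (r : nat -> nat).

Definition runs (C : circuit) (ws xs : seq bool) :=
  wf_from (size ws) C /\ eval_wires C ws = ws ++ xs.

Lemma runs_size C ws xs : runs C ws xs -> size xs = size C.
Proof.
case=> _ /(congr1 size); rewrite size_cat => E.
suff : size (eval_wires C ws) = size ws + size C by lia.
elim: C ws {E} => [|g C IH] ws /=; first by rewrite addn0.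
by rewrite IH size_rcons addSnnS.
Qed.

Lemma runs_nil ws : runs [::] ws [::].
Proof. by split; rewrite ?cats0. Qed.

Lemma runs_cat C1 C2 ws xs ys : runs C1 ws xs -> runs C2 (ws ++ xs) ys ->
  runs (C1 ++ C2) ws (xs ++ ys).
Proof.
move=> R1; have s1 := runs_size R1; case: R1 => wf1 e1 [wf2 e2]; split.
  by rewrite wf_from_cat wf1 -s1 -size_cat.
by rewrite eval_wires_cat e1 e2 catA.
Qed.

Lemma runs_rcons C g ws xs : runs C ws xs -> gate_wf (size ws + size xs) g ->
  runs (rcons C g) ws (rcons xs (eval_gate (ws ++ xs) g)).
Proof.
move=> R1; have s1 := runs_size R1; case: R1 => wf1 e1 gw; split.
  by rewrite wf_from_rcons wf1 -s1.
by rewrite eval_wires_rcons e1 rcons_cat.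
Qed.

Lemma fgates_runs f b w m ws : fbelow m f -> size ws = opval r b ->
  (forall v, v < m -> opval r (w v) < size ws) ->
  exists xs, [/\ runs (map (instg r) (fgates b w f)) ws xs, size xs = fsize f &
    nth false xs (fsize f).-1 = feval (fun v => nth false ws (opval r (w v))) f].
Proof.
have two g1 g2 b0 ws0 : (forall b ws, fbelow m g1 -> size ws = opval r b ->
    (forall v, v < m -> opval r (w v) < size ws) ->
    exists xs, [/\ runs (map (instg r) (fgates b w g1)) ws xs, size xs = fsize g1 &
    nth false xs (fsize g1).-1 = feval (fun v => nth false ws (opval r (w v))) g1]) ->
    (forall b ws, fbelow m g2 -> size ws = opval r b ->
    (forall v, v < m -> opval r (w v) < size ws) ->
    exists xs, [/\ runs (map (instg r) (fgates b w g2)) ws xs, size xs = fsize g2 &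
    nth false xs (fsize g2).-1 = feval (fun v => nth false ws (opval r (w v))) g2]) ->
    fbelow m g1 && fbelow m g2 -> size ws0 = opval r b0 ->
    (forall v, v < m -> opval r (w v) < size ws0) ->
    exists xs, [/\ runs (map (instg r) (fgates b0 w g1 ++ fgates (oadd b0 (fsize g1)) w g2)) ws0 xs,
     size xs = fsize g1 + fsize g2,
     nth false xs (fsize g1).-1 = feval (fun v => nth false ws0 (opval r (w v))) g1 &
     nth false xs (fsize g1 + (fsize g2).-1) = feval (fun v => nth false ws0 (opval r (w v))) g2].
  move=> H1 H2 /andP[m1 m2] sz lt.
  have [xs [R1 s1 n1]] := H1 b0 ws0 m1 sz lt.
  have [||ys [R2 s2 n2]] := H2 (oadd b0 (fsize g1)) (ws0 ++ xs) m2.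
  - by rewrite opval_oadd size_cat s1 sz.
  - by move=> v /lt; rewrite size_cat; lia.
  exists (xs ++ ys); split.
  - by rewrite map_cat; exact: runs_cat R1 R2.
  - by rewrite size_cat s1 s2.
  - by rewrite nth_cat ifT // s1; have := fsize_gt0 g1; lia.
  - rewrite nth_cat ifF; last by rewrite s1; lia.
    rewrite s1 addKn n2.
    (* The second formula is evaluated behind the gates of the first; its variables point below
       [size ws0], where nothing has changed. *)
    have E v : v < m -> nth false (ws0 ++ xs) (opval r (w v)) = nth false ws0 (opval r (w v)).
      by move/lt => l; rewrite nth_cat l.
    elim: (g2) m2 => [v|h IH|h IHh h' IHh'|h IHh h' IHh'] /=.
    + exact: E.
    + by move/IH->.
    + by case/andP=> /IHh-> /IHh'->.
    + by case/andP=> /IHh-> /IHh'->.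
elim: f b ws => [v|f IH|f IHf g IHg|f IHf g IHg] b ws /=.
- move=> vm sz lt; exists [:: nth false ws (opval r (w v))]; split=> //.
  by split=> /=; rewrite ?lt // andbb cats1.
- move=> fm sz lt; have [xs [R1 s1 n1]] := IH b ws fm sz lt.
  rewrite map_rcons; eexists; split; first apply: (runs_rcons R1).
  + by rewrite /= opval_oadd s1 sz; have := fsize_gt0 f; lia.
  + by rewrite size_rcons s1.
  + rewrite nth_rcons s1 ltnn eqxx /= opval_oadd -sz nth_cat ifF; last by lia.
    by rewrite addKn n1.
- move=> fm sz lt; have [xs [R1 s1 n1 n2]] := two f g b ws IHf IHg fm sz lt.
  rewrite map_rcons; eexists; split; first apply: (runs_rcons R1).
  + by rewrite /= !opval_oadd s1 sz; have := fsize_gt0 f; have := fsize_gt0 g; lia.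
  + by rewrite size_rcons s1.
  + rewrite nth_rcons s1 ltnn eqxx /= !opval_oadd -sz !nth_cat !ifF; try by lia.
    by rewrite !addKn n1 n2.
- move=> fm sz lt; have [xs [R1 s1 n1 n2]] := two f g b ws IHf IHg fm sz lt.
  rewrite map_rcons; eexists; split; first apply: (runs_rcons R1).
  + by rewrite /= !opval_oadd s1 sz; have := fsize_gt0 f; have := fsize_gt0 g; lia.
  + by rewrite size_rcons s1.
  + rewrite nth_rcons s1 ltnn eqxx /= !opval_oadd -sz !nth_cat !ifF; try by lia.
    by rewrite !addKn n1 n2.
Qed.

End Compile.

Definition ftrue := FOr (FVar 0) (FNot (FVar 0)).
Definition ffalse := FAnd (FVar 0) (FNot (FVar 0)).
Definition fconst (b : bool) := if b then ftrue else ffalse.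

Lemma feval_const e b : feval e (fconst b) = b.
Proof. by case: b => /=; rewrite ?orbN ?andbN. Qed.

Lemma fsize_const b : fsize (fconst b) = 4. Proof. by case: b. Qed.

(* Shannon expansion of a Boolean function of the variables i, ..., i + k - 1;
   the constants at the leaves mention variable 0. *)
Fixpoint shannon (i k : nat) (F : seq bool -> bool) : form :=
  match k with
  | 0 => fconst (F [::])
  | k'.+1 =>
      FOr (FAnd (FVar i) (shannon i.+1 k' (fun s => F (true :: s))))
        (FAnd (FNot (FVar i)) (shannon i.+1 k' (fun s => F (false :: s))))
  end.

Lemma feval_shannon e i k F : feval e (shannon i k F) = F [seq e j | j <- iota i k].
Proof.
elim: k i F => [|k IH] i F; first exact: feval_const.
by rewrite /= !IH; case: (e i); rewrite ?orbF.
Qed.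

Lemma fbelow_shannon m i k F : 0 < m -> i + k <= m -> fbelow m (shannon i k F).
Proof.
move=> m0; elim: k i F => [|k IH] i F le; first by rewrite /=; case: (F _); rewrite /= m0.
by rewrite /= !IH ?andbT; lia.
Qed.

Fixpoint shannon_size (k : nat) : nat :=
  if k is k'.+1 then (2 + shannon_size k' + (3 + shannon_size k')).+1 else 4.

Lemma fsize_shannon i k F : fsize (shannon i k F) = shannon_size k.
Proof. by elim: k i F => [|k IH] i F /=; rewrite ?fsize_const ?IH. Qed.

(* All formulas of the list have size z; the copies at the end make the values
   of the formulas contiguous. *)
Fixpoint forms_gates (b : operand) (w : nat -> operand) (z : nat) (fs : seq form) :=
  if fs is f :: fs' then fgates b w f ++ forms_gates (oadd b z) w z fs' else [::].

Definition forms_block b w z fs : seq sgate :=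
  forms_gates b w z fs ++
  [seq (let o := oadd b (z * j + z.-1) in SAnd o o) | j <- iota 0 (size fs)].

Lemma size_forms_gates b w z fs : all (fun f => fsize f == z) fs ->
  size (forms_gates b w z fs) = z * size fs.
Proof.
elim: fs b => [|f fs IH] b /=; first by rewrite muln0.
by case/andP=> /eqP E al; rewrite size_cat size_fgates E IH // mulnS.
Qed.

Lemma size_forms_block b w z fs : all (fun f => fsize f == z) fs ->
  size (forms_block b w z fs) = z * size fs + size fs.
Proof. by move=> al; rewrite size_cat size_forms_gates // size_map size_iota. Qed.

Lemma forms_block_in vs b w z fs m : all (fbelow m) fs -> b.1 \in vs ->
  (forall v, v < m -> (w v).1 \in vs) -> all (sgate_in vs) (forms_block b w z fs).
Proof.
move=> fm bin win; rewrite /forms_block all_cat; apply/andP; split; last first.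
  by rewrite all_map; apply/allP=> j _ /=; rewrite bin.
elim: fs b bin fm => //= f fs IH b bin /andP[fm fsm].
by rewrite all_cat (fgates_in fm) // IH.
Qed.

Lemma forms_gates_runs r fs b w z m ws : all (fun f => fsize f == z) fs ->
  all (fbelow m) fs -> size ws = opval r b ->
  (forall v, v < m -> opval r (w v) < size ws) ->
  exists xs, [/\ runs (map (instg r) (forms_gates b w z fs)) ws xs,
    size xs = z * size fs & forall j, j < size fs -> nth false xs (z * j + z.-1) =
      feval (fun v => nth false ws (opval r (w v))) (nth ftrue fs j)].
Proof.
(* [ws1] holds the gates already placed. The variables refer to [ws] alone, so the statement is
   generalized over the wires in between. *)
suff G ws1 : all (fun f => fsize f == z) fs ->
  all (fbelow m) fs -> size (ws ++ ws1) = opval r b ->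
  (forall v, v < m -> opval r (w v) < size ws) ->
  exists xs, [/\ runs (map (instg r) (forms_gates b w z fs)) (ws ++ ws1) xs,
    size xs = z * size fs & forall j, j < size fs -> nth false xs (z * j + z.-1) =
      feval (fun v => nth false ws (opval r (w v))) (nth ftrue fs j)].
  by have := G [::]; rewrite cats0.
elim: fs b ws1 => [|f fs IH] b ws1 /=.
  by exists [::]; split; rewrite ?muln0 //; exact: runs_nil.
move=> /andP[/eqP E al] /andP[fm fsm] sz lt.
have lt1 v : v < m -> opval r (w v) < size (ws ++ ws1).
  by move/lt; rewrite size_cat; lia.
have [xs [R1 s1 n1]] := fgates_runs fm sz lt1.
have [|ys [R2 s2 n2]] := IH (oadd b z) (ws1 ++ xs) al fsm _ lt.
  by rewrite catA size_cat sz s1 E opval_oadd.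
exists (xs ++ ys); split.
- by rewrite map_cat; apply: runs_cat R1 _; rewrite -catA.
- by rewrite size_cat s1 s2 E mulnS.
- have z0 : 0 < z by rewrite -E fsize_gt0.
  case=> [|j] lj.
    rewrite muln0 nth_cat s1 ifT; last by lia.
    rewrite -E n1 /=; elim: (f) fm => [v|g IHg|g IHg h IHh|g IHg h IHh] /=.
    + by move/lt => l; rewrite nth_cat l.
    + by move/IHg->.
    + by case/andP=> /IHg-> /IHh->.
    + by case/andP=> /IHg-> /IHh->.
  rewrite nth_cat s1 E ifF; last by rewrite mulnS; lia.
  by rewrite -n2 //; congr nth; rewrite mulnS; lia.
Qed.

Lemma copies_runs ws os : all (fun o => o < size ws) os ->
  runs [seq GAnd o o | o <- os] ws [seq nth false ws o | o <- os].
Proof.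
elim/last_ind: os => [|os o IH]; first by move=> _; exact: runs_nil.
rewrite all_rcons !map_rcons => /andP[lt /IH R].
have -> : nth false ws o = eval_gate (ws ++ [seq nth false ws o | o <- os]) (GAnd o o).
  by rewrite /= andbb nth_cat lt.
by apply: runs_rcons R _; rewrite /= andbb; lia.
Qed.

Lemma forms_block_runs r fs b w z m ws : all (fun f => fsize f == z) fs ->
  all (fbelow m) fs -> size ws = opval r b ->
  (forall v, v < m -> opval r (w v) < size ws) ->
  exists2 xs, size xs = z * size fs &
    runs (map (instg r) (forms_block b w z fs)) ws
      (xs ++ [seq feval (fun v => nth false ws (opval r (w v))) f | f <- fs]).
Proof.
move=> al fm sz lt; have [xs [R1 s1 n1]] := forms_gates_runs al fm sz lt.
exists xs => //; rewrite map_cat; apply: runs_cat R1 _.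
rewrite -map_comp (eq_map (g := (fun o => GAnd o o) \o
   (fun j => opval r b + (z * j + z.-1)))); last by move=> j /=; rewrite opval_oadd.
rewrite map_comp.
have -> : [seq feval (fun v => nth false ws (opval r (w v))) f | f <- fs] =
  [seq nth false (ws ++ xs) o | o <- [seq opval r b + (z * j + z.-1) | j <- iota 0 (size fs)]].
  rewrite -map_comp; apply: (@eq_from_nth _ false); rewrite !size_map ?size_iota // => j lj.
  rewrite (nth_map ftrue) // (nth_map 0) ?size_iota // nth_iota //= nth_cat sz ifF; last by lia.
  by rewrite addKn n1.
apply: copies_runs; apply/allP=> o /mapP[j]; rewrite mem_iota => /andP[_ lj] ->.
rewrite size_cat sz s1 ltn_add2l.
case: z al {n1 s1} => [|z] al.
  by case: fs al lj {fm} => //= f fs; have := fsize_gt0 f; case: (fsize f).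
have : z.+1 * j.+1 <= z.+1 * size fs by rewrite leq_mul2l lj orbT.
by rewrite mulnS; lia.
Qed.

(** * Circuits scanning their input with a finite automaton *)

(* Counters: 3 is zero, 8 the number of input bits of one vertex, 10-13 point to
   the current blocks of the four tracks and 14 to the wires of the state. *)
Definition op_vars : seq nat := [:: 3; 8; 10; 11; 12; 13; 14].

Section Automaton.

Variables (Gam : Type) (q sg : nat).
Variables (db : Gam -> seq bool -> seq bool -> seq bool) (st0 : seq bool).
Variable (acc : seq bool -> bool -> bool -> bool).
Hypothesis size_db : forall g st c, size (db g st c) = sg.
Hypothesis size_st0 : size st0 = sg.
Hypothesis sg_gt0 : 0 < sg.

Definition block_form (g : Gam) (j : nat) : form :=
  shannon 0 (sg + 4 * q) (fun s => nth false (db g (take sg s) (drop sg s)) j).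

Definition block_z := shannon_size (sg + 4 * q).

(** The variables of [block_form] are the [sg] state bits followed by [q] bits from each of the four
    tracks. *)
Definition block_var (v : nat) : operand :=
  if v < sg then (14, v)
  else if v - sg < q then (10, v - sg)
  else if v - sg < 2 * q then (11, v - sg - q)
  else if v - sg < 3 * q then (12, v - sg - 2 * q)
  else (13, v - sg - 3 * q).

Definition block_gates (g : Gam) : seq sgate :=
  forms_block (14, sg) block_var block_z [seq block_form g j | j <- iota 0 sg].

Definition block_len := block_z * sg + sg.

(** Even a constant needs some variable, for which the wire named by counter 3 serves. A constant
    formula has 4 gates, and the [4 * sg] gates in front of the copies are the offset in
    [start_shift]. *)
Definition init_gates : seq sgate :=
  forms_block (14, 0) (fun=> (3, 0)) 4 [seq fconst b | b <- st0].

Definition final_form : form :=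
  shannon 0 (sg + 2) (fun s => acc (take sg s) (nth false s sg) (nth false s sg.+1)).

(** The two bits read besides the state are the strand bits of the two vertices, which are the first
    bit of each; counter 3 addresses one and counter 8 the other. *)
Definition final_var (v : nat) : operand :=
  if v < sg then (14, v) else if v == sg then (3, 0) else (8, 0).

Definition final_gates : seq sgate := fgates (14, sg) final_var final_form.

(** The copies that end a block start [sg + block_z * sg] wires behind the old state, and this is
    [block_len]. *)
Definition advance (r : nat -> nat) (v : nat) : nat :=
  if v == 14 then r v + block_len
  else if (10 <= v) && (v <= 13) then r v + q else r v.

Fixpoint scan_gates (gs : seq Gam) (r : nat -> nat) : circuit :=
  if gs is g :: gs' then
    map (instg r) (block_gates g) ++ scan_gates gs' (advance r)
  else map (instg r) final_gates.

Definition start_shift (r : nat -> nat) (v : nat) : nat :=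
  if v == 14 then r v + 4 * sg else r v.

Definition automaton_circuit (gs : seq Gam) (r : nat -> nat) : circuit :=
  map (instg r) init_gates ++ scan_gates gs (start_shift r).

Definition slice (inp : seq bool) (i k : nat) : seq bool :=
  [seq nth false inp j | j <- iota i k].

Definition column (inp : seq bool) (r : nat -> nat) : seq bool :=
  slice inp (r 10) q ++ slice inp (r 11) q ++ slice inp (r 12) q ++ slice inp (r 13) q.

Fixpoint scan (inp : seq bool) (gs : seq Gam) (r : nat -> nat) (st : seq bool) :=
  if gs is g :: gs' then scan inp gs' (advance r) (db g st (column inp r)) else st.

Lemma size_block_gates g : size (block_gates g) = block_len.
Proof.
rewrite size_forms_block; first by rewrite size_map size_iota.
by rewrite all_map; apply/allP=> j _; rewrite /= fsize_shannon.
Qed.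

Lemma size_init_gates : size init_gates = 5 * sg.
Proof.
rewrite size_forms_block; first by rewrite size_map size_st0; lia.
by rewrite all_map; apply/allP=> j _; rewrite /= fsize_const.
Qed.

Lemma size_automaton_circuit gs r :
  size (automaton_circuit gs r) = 5 * sg + size gs * block_len + shannon_size (sg + 2).
Proof.
rewrite size_cat size_map size_init_gates -addnA; congr (_ + _).
elim: gs (start_shift r) => [|g gs IH] r' /=.
  by rewrite size_map size_fgates fsize_shannon.
by rewrite size_cat size_map size_block_gates IH mulSn addnA.
Qed.

Lemma block_gates_in g : all (sgate_in op_vars) (block_gates g).
Proof.
apply: (@forms_block_in _ _ _ _ _ (sg + 4 * q)) => //.
  rewrite all_map; apply/allP=> j _; apply: fbelow_shannon => //.
  by apply: leq_trans sg_gt0 (leq_addr _ _).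
by move=> v _; rewrite /block_var; repeat case: ifP => _.
Qed.

Lemma init_gates_in : all (sgate_in op_vars) init_gates.
Proof.
apply: (@forms_block_in _ _ _ _ _ 1) => //.
by rewrite all_map; apply/allP=> -[] _.
Qed.

Lemma final_gates_in : all (sgate_in op_vars) final_gates.
Proof.
apply: (@fgates_in _ _ _ _ (sg + 2)) => //.
  by apply: fbelow_shannon => //; rewrite addn2.
by move=> v _; rewrite /final_var; repeat case: ifP => _.
Qed.

Lemma size_slice inp i k : size (slice inp i k) = k.
Proof. by rewrite size_map size_iota. Qed.

Lemma slice_catl inp w i k : i + k <= size inp -> slice (inp ++ w) i k = slice inp i k.
Proof.
move=> le; apply/eq_in_map => j; rewrite mem_iota nth_cat => /andP[_ lt].
by rewrite ifT //; lia.
Qed.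

Lemma slice_catr inp w : slice (inp ++ w) (size inp) (size w) = w.
Proof.
apply: (@eq_from_nth _ false); rewrite size_slice // => j lj.
by rewrite (nth_map 0) ?size_iota // nth_iota // nth_cat ifF ?addKn //; lia.
Qed.

Lemma slice_iota inp (f : nat -> nat) a k i :
  (forall j, j < k -> f (a + j) = i + j) ->
  [seq nth false inp (f v) | v <- iota a k] = slice inp i k.
Proof.
move=> H; apply: (@eq_from_nth _ false); rewrite !size_map ?size_iota // => j lj.
by rewrite !(nth_map 0) ?size_iota // !nth_iota // H.
Qed.

Definition in_range (inp : seq bool) (r : nat -> nat) (k : nat) :=
  forall v, 10 <= v <= 13 -> r v + q * k <= size inp.

Lemma in_range_advance inp r k : in_range inp r k.+1 -> in_range inp (advance r) k.
Proof.
clear size_st0 sg_gt0 => H v vr; have := H v vr; rewrite /advance vr mulnS.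
by case: eqP => [E|_]; [move: vr; rewrite E|lia].
Qed.

Lemma block_runs g r inp w st : size st = sg -> size (inp ++ w) = r 14 -> in_range inp r 1 ->
  exists2 xs, size xs = block_z * sg &
    runs (map (instg r) (block_gates g)) ((inp ++ w) ++ st)
      (xs ++ db g st (column inp r)).
Proof.
move=> sst sz rng.
have rngq v : 10 <= v <= 13 -> r v + q <= size inp by move/rng; rewrite muln1.
have := @forms_block_runs r [seq block_form g j | j <- iota 0 sg] (14, sg) block_var
  block_z (sg + 4 * q) ((inp ++ w) ++ st).
case.
- by rewrite all_map; apply/allP=> j _; rewrite /= fsize_shannon.
- rewrite all_map; apply/allP=> j _; apply: fbelow_shannon => //.
  by apply: leq_trans sg_gt0 (leq_addr _ _).
- by rewrite size_cat sz /opval /= sst.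
- move=> v lv; rewrite size_cat sz sst /block_var.
  have := rngq 10 isT; have := rngq 11 isT; have := rngq 12 isT; have := rngq 13 isT.
  move: sz; rewrite size_cat => sz.
  by repeat case: ifP => ?; rewrite /opval /=; lia.
move=> xs sxs R; exists xs; first by rewrite sxs size_map size_iota.
set ys := [seq feval _ f | f <- _] in R; suff <- : ys = db g st (column inp r) by [].
rewrite /ys -map_comp.
pose e v := nth false ((inp ++ w) ++ st) (opval r (block_var v)).
have SI a k i := @slice_iota ((inp ++ w) ++ st) (fun v => opval r (block_var v)) a k i.
have Evars : [seq e v | v <- iota 0 (sg + 4 * q)] = st ++ column inp r.
  rewrite (_ : 4 * q = q + (q + (q + q))); last by lia.
  rewrite !iotaD !map_cat; congr (_ ++ (_ ++ (_ ++ (_ ++ _)))).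
  - rewrite (SI _ _ (r 14)); first by rewrite -sz -sst slice_catr.
    by move=> j lj; rewrite /block_var ifT.
  - rewrite (SI _ _ (r 10)); first by rewrite -catA slice_catl // rngq.
    move=> j lj; rewrite /block_var ifF; last by lia.
    by rewrite ifT; [rewrite /opval /=|]; lia.
  - rewrite (SI _ _ (r 11)); first by rewrite -catA slice_catl // rngq.
    move=> j lj; rewrite /block_var ifF; last by lia.
    rewrite ifF; last by lia.
    by rewrite ifT; [rewrite /opval /=|]; lia.
  - rewrite (SI _ _ (r 12)); first by rewrite -catA slice_catl // rngq.
    move=> j lj; rewrite /block_var ifF; last by lia.
    rewrite ifF; last by lia.
    rewrite ifF; last by lia.
    by rewrite ifT; [rewrite /opval /=|]; lia.
  - rewrite (SI _ _ (r 13)); first by rewrite -catA slice_catl // rngq.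
    move=> j lj; rewrite /block_var ifF; last by lia.
    rewrite ifF; last by lia.
    rewrite ifF; last by lia.
    by rewrite ifF; [rewrite /opval /=|]; lia.
apply: (@eq_from_nth _ false); rewrite size_map size_iota ?size_db // => j lj.
rewrite (nth_map 0) ?size_iota // nth_iota // /= feval_shannon -/e Evars.
by rewrite -sst take_size_cat // drop_size_cat.
Qed.

Lemma scan_runs gs r inp w st : size st = sg -> size (inp ++ w) = r 14 ->
  in_range inp r (size gs) ->
  r 3 < size inp -> r 8 < size inp ->
  exists xs, runs (scan_gates gs r) ((inp ++ w) ++ st)
    (rcons xs (acc (scan inp gs r st) (nth false inp (r 3)) (nth false inp (r 8)))).
Proof.
elim: gs r w st => [|g gs IH] r w st sst sz rng l3 l8 /=.
  have [|||xs [R sxs nxs]] := @fgates_runs r final_form (14, sg) final_var (sg + 2)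
      ((inp ++ w) ++ st).
  - by apply: fbelow_shannon => //; rewrite addn2.
  - by rewrite size_cat sz /opval /= sst.
  - move=> v lv; rewrite /final_var; move: sz; rewrite !size_cat sst => sz.
    by repeat case: ifP => ?; rewrite /opval /=; lia.
  have ne : 0 < size xs by rewrite sxs fsize_gt0.
  case/lastP: xs ne R sxs nxs => // xs x _ R sxs.
  rewrite -sxs size_rcons /= nth_rcons ltnn eqxx => Ex.
  exists xs; rewrite Ex feval_shannon in R.
  set out := acc _ _ _ in R.
  suff <- : out = acc st (nth false inp (r 3)) (nth false inp (r 8)) by [].
  rewrite /out iotaD map_cat /= add0n /final_var !eqxx ltnn.
  set e1 := map _ _.
  have -> : e1 = st.
    rewrite /e1 (@slice_iota _ (fun v => opval r (if v < sg then (14, v)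
      else if v == sg then (3, 0) else (8, 0))) _ _ (r 14)); first by rewrite -sz -sst slice_catr.
    by move=> j lj; rewrite ifT.
  rewrite ifF; last by lia.
  rewrite ifF; last by lia.
  have T a b : [/\ take sg (st ++ [:: a; b]) = st, nth false (st ++ [:: a; b]) sg = a &
      nth false (st ++ [:: a; b]) sg.+1 = b].
    by rewrite -sst take_size_cat // !nth_cat ltnn subnn ifF ?subSnn //; lia.
  have [-> -> ->] := T (nth false ((inp ++ w) ++ st) (opval r (3, 0)))
    (nth false ((inp ++ w) ++ st) (opval r (8, 0))).
  by rewrite /opval /= !addn0 -!catA !nth_cat l3 l8.
have [|xs sxs R1] := @block_runs g r inp w st sst sz.
  by move=> v vr; have := rng v vr; rewrite /= mulnS; lia.
have [|||||ys R2] := IH (advance r) (w ++ st ++ xs) (db g st (column inp r)).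
- exact: size_db.
- by rewrite /advance /= catA !size_cat -sz !size_cat sst sxs /block_len; lia.
- exact: in_range_advance.
- by [].
- by [].
exists ((xs ++ db g st (column inp r)) ++ ys).
rewrite rcons_cat; apply: runs_cat R1 _.
by move: R2; rewrite !catA.
Qed.

Theorem automaton_circuit_ok gs r inp : r 14 = size inp ->
  in_range inp r (size gs) -> r 3 < size inp -> r 8 < size inp ->
  circuit_wf (size inp) (automaton_circuit gs r) /\
  circuit_out (automaton_circuit gs r) inp =
    acc (scan inp gs r st0) (nth false inp (r 3)) (nth false inp (r 8)).
Proof.
move=> sz rng l3 l8.
have := @forms_block_runs r [seq fconst b | b <- st0] (14, 0) (fun=> (3, 0)) 4 1 inp.
case.
- by rewrite all_map; apply/allP=> j _; rewrite /= fsize_const.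
- by rewrite all_map; apply/allP=> -[] _.
- by rewrite /opval /= addn0.
- by move=> v _; rewrite /opval /= addn0.
rewrite size_map size_st0 -map_comp => xs sxs R1.
rewrite (eq_map (g := id)) in R1; last by move=> b /=; rewrite feval_const.
rewrite map_id in R1.
have [||||ys R2] := @scan_runs gs (start_shift r) inp xs st0 size_st0.
- by rewrite /start_shift /= size_cat sxs sz.
- move=> v vr; rewrite /start_shift ifF; first exact: rng.
  by apply/eqP => E; move: vr; rewrite E.
- by [].
- by [].
(* [start_shift] changes counter 14 only, whereas the scanned columns depend on counters 10 to
   13. *)
have Escan r1 r2 st : (forall v, 10 <= v <= 13 -> r1 v = r2 v) ->
    scan inp gs r1 st = scan inp gs r2 st.
  elim: gs r1 r2 st {rng R2} => //= g gs IH r1 r2 st E.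
  rewrite /column !E //; apply: IH => v vr; by rewrite /advance E.
rewrite -catA in R2; have [wf ev] := runs_cat R1 R2; split.
  rewrite /circuit_wf wf andbT size_automaton_circuit -addnA ltn_addr //.
  by rewrite muln_gt0.
rewrite /circuit_out ev -rcons_cat -rcons_cat last_rcons.
by rewrite (Escan _ r) // => v vr; rewrite /start_shift ifF //; apply/eqP => E; move: vr; rewrite E.
Qed.

End Automaton.

(** * Generating the circuit *)

(* The letters scanned along an input x: None marks the cell before x, Some a a
   cell with initial content a. *)
Definition letter := option (option bool).

Section Generator.

Variables (q sg : nat) (db : letter -> seq bool -> seq bool -> seq bool) (st0 : seq bool).
Variable (acc : seq bool -> bool -> bool -> bool).
Hypothesis size_st0 : size st0 = sg.
Hypothesis sg_gt0 : 0 < sg.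

Local Notation adv := (advance q sg).
Local Notation block_gates := (block_gates q sg db).
Local Notation block_len := (block_len q sg).

Definition gcode (C : circuit) : seq bool := flatten (map code_gate C).

Fixpoint blocks_code (gs : seq letter) (r : nat -> nat) : seq bool :=
  if gs is g :: gs' then gcode (map (instg r) (block_gates g)) ++ blocks_code gs' (adv r)
  else [::].

Lemma blocks_code_rcons gs g r : blocks_code (rcons gs g) r =
  blocks_code gs r ++ gcode (map (instg (iter (size gs) adv r)) (block_gates g)).
Proof.
elim: gs r => [|h gs IH] r /=; first by rewrite cats0.
by rewrite IH -catA -iterS iterSr.
Qed.

Lemma gcode_cat C1 C2 : gcode (C1 ++ C2) = gcode C1 ++ gcode C2.
Proof. by rewrite /gcode map_cat flatten_cat. Qed.

Lemma gcode_scan gs r : gcode (scan_gates q sg db acc gs r) =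
  blocks_code gs r ++ gcode (map (instg (iter (size gs) adv r)) (final_gates sg acc)).
Proof.
elim: gs r => [|g gs IH] r //=.
by rewrite gcode_cat IH -catA -iterS iterSr.
Qed.

Lemma iter_advance j r v : iter j adv r v =
  if v == 14 then r v + j * block_len
  else if (10 <= v) && (v <= 13) then r v + j * q else r v.
Proof.
elim: j => [|j IH]; first by rewrite !mul0n !addn0; case: ifP => // _; case: ifP.
rewrite iterS {1}/advance IH !mulSnr !addnA.
by case: (v == 14) => //; case: (_ && _).
Qed.

Definition put (s : store) (r : nat -> nat) (o : seq bool) : store := fun v =>
  if v == 0 then o else if (10 <= v) && (v <= 14) then nseq (r v) true else s v.

Definition emitted s gs r o : store :=
  put s (iter (size gs) adv r) (rev (blocks_code gs r) ++ o).

Definition body (g : letter) : stm :=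
  Seq (emitgates (block_gates g))
   (Seq (addc 10 q) (Seq (addc 11 q) (Seq (addc 12 q) (Seq (addc 13 q) (addc 14 block_len))))).

Section Blocks.

Variables (P : Type) (D : P -> Prop) (sz : P -> nat).
Local Notation Run := (Run D sz).

Definition ready (s : P -> store) (r : P -> nat -> nat) :=
  [/\ forall p, D p -> s p scratch = [::], forall p, D p -> s p 3 = nseq (r p 3) true,
     forall p, D p -> s p 8 = nseq (r p 8) true &
     forall v, v \in op_vars -> pbounded D sz (r ^~ v)].

Lemma ready_counter s r (o : P -> seq bool) v : ready s r -> v \in op_vars ->
  counter D sz (fun p => put (s p) (r p) (o p)) v (r ^~ v).
Proof.
case=> _ E3 E8 Bd vin; split; first exact: Bd.
move=> p Dp; move: vin; rewrite !inE.
by repeat case/orP; move/eqP->; rewrite /put /= ?E3 ?E8.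
Qed.

Lemma ready_scratch s r (o : P -> seq bool) : ready s r ->
  scratch_empty D (fun p => put (s p) (r p) (o p)).
Proof. by case=> E2 _ _ _ p Dp; rewrite /put /= E2. Qed.

Lemma Run_put_gates s r o gs : ready s r -> all (sgate_in op_vars) gs ->
  Run (emitgates gs) (fun p => put (s p) (r p) (o p))
    (fun p => put (s p) (r p) (rev (gcode (map (instg (r p)) gs)) ++ o p)).
Proof.
move=> rd gin; have E := ready_scratch o rd.
apply: Run_eq (Run_emitgates E (fun v vin => ready_counter o rd vin) _ _ gin) => // p _.
by rewrite /put /=; store_eq.
Qed.

Lemma Run_body1 s r o g : ready s r ->
  Run (body g) (fun p => put (s p) (r p) (o p))
    (fun p => put (s p) (adv (r p))
       (rev (gcode (map (instg (r p)) (block_gates g))) ++ o p)).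
Proof.
move=> rd; apply: Run_seq (Run_put_gates _ rd _) _.
  exact: block_gates_in.
have E := ready_scratch (fun p => rev (gcode (map (instg (r p)) (block_gates g))) ++ o p) rd.
apply: Run_seq (Run_addc _ _ E _) _ => //.
have {}E h := scratch_upd h E (i := 10) isT.
apply: Run_seq (Run_addc _ _ (E _) _) _ => //.
have {}E f h := scratch_upd h (E f) (i := 11) isT.
apply: Run_seq (Run_addc _ _ (E _ _) _) _ => //.
have {}E f h h' := scratch_upd h' (E f h) (i := 12) isT.
apply: Run_seq (Run_addc _ _ (E _ _ _) _) _ => //.
have {}E f h h' h'' := scratch_upd h'' (E f h h') (i := 13) isT.
apply: Run_eq (Run_addc _ _ (E _ _ _ _) _) => // p _.
apply: functional_extensionality => v; rewrite /upd /put /advance /=.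
by do 15?[case: v => [|v] //=]; rewrite -nseqD addnC.
Qed.

Lemma ready_iter s r (gs : P -> seq letter) : ready s r ->
  pbounded D sz (fun p => size (gs p)) ->
  ready s (fun p => iter (size (gs p)) adv (r p)).
Proof.
case=> E2 E3 E8 Bd Bg; split=> //.
- by move=> p Dp; rewrite iter_advance E3.
- by move=> p Dp; rewrite iter_advance E8.
- move=> v vin; apply: (pbounded_le (h := fun p => r p v + size (gs p) * (block_len + q))).
    move=> p _; rewrite iter_advance; repeat case: ifP => _; rewrite ?leq_add2l ?leq_addr //.
      by rewrite leq_mul2l leq_addr orbT.
    by rewrite leq_mul2l leq_addl orbT.
  by apply: pbounded_add; [exact: Bd|apply: pbounded_mul => //; exact: pbounded_const].
Qed.

Lemma Run_body s r o gs g : ready s r -> pbounded D sz (fun p => size (gs p)) ->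
  Run (body g) (fun p => emitted (s p) (gs p) (r p) (o p))
    (fun p => emitted (s p) (rcons (gs p) g) (r p) (o p)).
Proof.
move=> rd Bg; apply: Run_eq (Run_body1 _ g (ready_iter rd Bg)) => // p _.
by rewrite /emitted size_rcons blocks_code_rcons rev_cat -catA.
Qed.

End Blocks.

Lemma pbounded_fst (P : Type) (D : P -> Prop) sz g (D' : P * nat -> Prop) :
  (forall pj, D' pj -> D pj.1) -> pbounded D sz g ->
  pbounded D' (fun pj => sz pj.1) (fun pj => g pj.1).
Proof. by move=> H [k Hk]; exists k => pj /H; exact: Hk. Qed.

(** One loop for three purposes: the input word, where the popped bit selects the letter, and the
    two paddings, where the stack is a unary counter and the letter is constant. *)
Lemma Run_blocks (P : Type) (D : P -> Prop) sz (s : P -> store) (gs : P -> seq letter)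
    r o i (cs : P -> seq bool) (g : bool -> letter) :
  ready D sz s r -> pbounded D sz (fun p => size (gs p)) ->
  pbounded D sz (fun p => size (cs p)) -> (forall p, D p -> s p i = cs p) ->
  i \notin [:: 0; scratch; 3; 8; 10; 11; 12; 13; 14] ->
  Run D sz (ForPop i (body (g false)) (body (g true)))
    (fun p => emitted (s p) (gs p) (r p) (o p))
    (fun p => emitted (upd (s p) i [::]) (gs p ++ map g (cs p)) (r p) (o p)).
Proof.
move=> rd Bg Bc Ei; rewrite !inE !negb_or => /and5P[i0 i2 i3 i8 /and5P[i10 i11 i12 i13 i14]].
have nr : (10 <= i <= 14) = false by move: i10 i11 i12 i13 i14; lia.
pose F (pj : P * nat) := emitted (upd (s pj.1) i (drop pj.2 (cs pj.1)))
  (gs pj.1 ++ map g (take pj.2 (cs pj.1))) (r pj.1) (o pj.1).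
have put_upd s1 c r1 o1 : upd (put s1 r1 o1) i c = put (upd s1 i c) r1 o1.
  apply: functional_extensionality => v; rewrite /upd /put.
  by case: (v =P i) => [->|//]; rewrite (negbTE i0) nr.
suff : Run D sz (ForPop i (body (g false)) (body (g true)))
    (fun p => F (p, 0)) (fun p => F (p, size (cs p))).
  apply: Run_eq => p Dp; rewrite /F /=; last by rewrite drop_size take_size.
  by rewrite drop0 take0 cats0 -Ei // upd_id.
apply: Run_forpop => //.
  by move=> p j Dp _; rewrite /F /emitted /put /= (negbTE i0) nr /upd eqxx.
move=> b; set D' := fun pj : P * nat => _.
have HD pj : D' pj -> D pj.1 by case.
have rd' : ready D' (fun pj => sz pj.1) (fun pj => upd (s pj.1) i (drop pj.2.+1 (cs pj.1)))
    (fun pj => r pj.1).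
  case: rd => E2 E3 E8 Bd; split.
  - by move=> pj /HD /E2; rewrite /upd eq_sym (negbTE i2).
  - by move=> pj /HD /E3; rewrite /upd eq_sym (negbTE i3).
  - by move=> pj /HD /E8; rewrite /upd eq_sym (negbTE i8).
  - by move=> v /Bd; exact: pbounded_fst.
have Bg' : pbounded D' (fun pj => sz pj.1)
    (fun pj => size (gs pj.1 ++ map g (take pj.2 (cs pj.1)))).
  apply: pbounded_le (pbounded_fst HD (pbounded_add Bg Bc)) => pj _.
  by rewrite size_cat size_map size_take leq_add2l; case: ltnP => // /ltnW.
suff : Run D' (fun pj => sz pj.1) (body (g b))
  (fun pj => emitted (upd (s pj.1) i (drop pj.2.+1 (cs pj.1)))
     (gs pj.1 ++ map g (take pj.2 (cs pj.1))) (r pj.1) (o pj.1))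
  (fun pj => emitted (upd (s pj.1) i (drop pj.2.+1 (cs pj.1)))
     (rcons (gs pj.1 ++ map g (take pj.2 (cs pj.1))) (g b)) (r pj.1) (o pj.1)).
  have -> : body (g b) = (if b then body (g true) else body (g false)) by case: (b).
  apply: Run_eq => -[p j] [Dp [lt Eb]].
    by rewrite /F /emitted /= put_upd upd_same.
  by rewrite /F /= (take_nth false lt) map_rcons Eb rcons_cat.
exact: Run_body.
Qed.


Variable k : nat.

(** This is [polybnd k n + 2]: on either side of the input there are two cells more than the space
    bound, so that the head never reaches an end of the array. *)
Definition pad n := k * n ^ k + (k + 2).
Definition ncols n := n + (1 + 2 * pad n).
Definition nbits n := 1 + 2 * q * ncols n.

Definition letters (x : seq bool) : seq letter :=
  nseq (pad (size x)) (Some None) ++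
  None :: [seq Some (Some b) | b <- x] ++ nseq (pad (size x)) (Some None).

Lemma size_letters x : size (letters x) = ncols (size x).
Proof.
by clear size_st0 sg_gt0; rewrite size_cat /= size_cat size_map !size_nseq /ncols; lia.
Qed.

(** The edge circuit reads s, C, A, s', C', A' in this order. Entries 10 to 13 locate the four
    strings and entry 8 the bit s'; entry 14 is the number of inputs, hence the wire of the first
    gate. *)
Definition pointers (n v : nat) : nat :=
  nth 0 [:: 0; 0; 0; 0; 0; 0; 0; 0; nbits n; 0; 1; 1 + q * ncols n; 1 + nbits n;
            1 + (nbits n + q * ncols n); 2 * nbits n] v.

Definition the_circuit (x : seq bool) : circuit :=
  automaton_circuit q sg db st0 acc (letters x) (pointers (size x)).

(** The code of a circuit begins with the number of its gates, which therefore has to be computed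
    before any gate is written. Stack 9 receives the part proportional to the number of columns;
    this is the constant rest. *)
Definition final_size : nat := 5 * sg + shannon_size (sg + 2).

Definition generated (x : seq bool) : seq bool :=
  code_nat (nbits (size x)) ++
  (code_nat (size (the_circuit x)) ++ gcode (the_circuit x)) ++ [:: false].

(** Use of the stacks: 1 the input with its first bit on top, 4 its length, 5 and 6 the padding (two
    copies, since each padding loop consumes one), 7 the number of columns, 8 the number of bits of
    a vertex, 9 the gates of all blocks, 10 to 14 the pointers, 15 the power [n ^ k], 16 the
    accumulator of the multiplications. *)
Definition gen_arith : seq stm :=
  [:: ForPop 0 (Seq (Push 1 false) (Push 4 true)) (Seq (Push 1 true) (Push 4 true));
   addc 15 1; powin k 15 4 16; addm k 15 5; addc 5 (k + 2); addto 5 6;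
   addm 2 5 7; addc 7 1; addto 4 7; addm (2 * q) 7 8; addc 8 1;
   addm block_len 7 9; addc 10 1; addm q 7 11; addc 11 1;
   addto 8 12; addc 12 1; addm q 7 13; addto 8 13; addc 13 1; addm 2 8 14].

Definition gen_emit : seq stm :=
  [:: emitnat (8, 0); emitnat (9, final_size);
   emitgates (init_gates st0); addc 14 (4 * sg);
   ForPop 5 (body (Some None)) (body (Some None)); body None;
   ForPop 1 (body (Some (Some false))) (body (Some (Some true)));
   ForPop 6 (body (Some None)) (body (Some None));
   emitgates (final_gates sg acc)].

Definition gen_prog : stm := foldr Seq (Push 0 false) (gen_arith ++ gen_emit).

Definition St (o x : seq bool) (N B B2 S NN SE p0 p1 p2 p3 p4 a : nat) : store :=
  let T c := nseq c true in
  nth [::] [:: o; x; [::]; [::]; T N; T B; T B2; T S; T NN; T SE;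
    T p0; T p1; T p2; T p3; T p4; T a].

Local Notation pdX x := (pad (size x)).
Local Notation ncX x := (ncols (size x)).
Local Notation nbX x := (nbits (size x)).
Local Notation RunX := (Run (fun _ : seq bool => True) size).
Local Notation pbX := (pbounded (fun _ : seq bool => True) size).

Lemma RunX_step c1 c2 s s1 s1' s2 : RunX c1 s s1' -> (forall x, s1' x = s1 x) ->
  RunX c2 s1 s2 -> RunX (Seq c1 c2) s s2.
Proof.
move=> R1 E R2; apply: Run_seq (Run_eq (r := s) (r' := s1) _ _ R1) R2 => //.
Qed.

Lemma pbX_pad : pbX (fun x => pdX x).
Proof.
by do ?[exact: pbounded_const | exact: pbounded_size | apply: pbounded_add
  | apply: pbounded_mul | apply: pbounded_exp].
Qed.

Lemma pbX_ncols : pbX (fun x => ncX x).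
Proof.
by do ?[exact: pbounded_const | exact: pbounded_size | exact: pbX_pad | apply: pbounded_add
  | apply: pbounded_mul].
Qed.

Lemma pbX_nbits : pbX (fun x => nbX x).
Proof.
by do ?[exact: pbounded_const | exact: pbX_ncols | apply: pbounded_add
  | apply: pbounded_mul].
Qed.

Lemma all_true_eq l l' : all id l -> all id l' -> size l = size l' -> l = l'.
Proof.
have H s : all id s -> s = nseq (size s) true.
  by move=> al; apply/all_pred1P; apply: sub_all al => b /= ->.
by move=> al al' E; rewrite (H _ al) (H _ al') E.
Qed.

Ltac St_fin := apply: all_true_eq;
  rewrite ?all_cat /= ?all_nseq ?orbT ?size_cat /= ?size_nseq //; lia.

Ltac St_eq :=
  intros; apply: functional_extensionality; rewrite /upd /St;
  do 17?[case=> [|] //=]; intros; rewrite ?cats0 -?nseqD //; try (congr nseq; lia);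
  try St_fin.

Definition S_arith x : store :=
  let n := size x in
  St [::] x n (pad n) (pad n) (ncols n) (nbits n) (block_len * ncols n)
    (pointers n 10) (pointers n 11) (pointers n 12) (pointers n 13) (pointers n 14) (n ^ k).

Lemma Run_arith c s2 : RunX c S_arith s2 ->
  RunX (foldr Seq c gen_arith) (fun x i => if i == 0 then rev x else [::]) s2.
Proof.
move=> Rc /=.
have CN f : (forall x, f x 4 = nseq (size x) true) ->
    counter (fun _ : seq bool => True) size f 4 size.
  by move=> E; split; [exact: pbounded_size|move=> x _; exact: E].
have CB f i : (forall x, f x i = nseq (pdX x) true) ->
    counter (fun _ : seq bool => True) size f i (fun x => pdX x).
  by move=> E; split; [exact: pbX_pad|move=> x _; exact: E].
have CS f i : (forall x, f x i = nseq (ncX x) true) ->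
    counter (fun _ : seq bool => True) size f i (fun x => ncX x).
  by move=> E; split; [exact: pbX_ncols|move=> x _; exact: E].
have CNN f i : (forall x, f x i = nseq (nbX x) true) ->
    counter (fun _ : seq bool => True) size f i (fun x => nbX x).
  by move=> E; split; [exact: pbX_nbits|move=> x _; exact: E].
pose F (xj : seq bool * nat) := let: (x, j) := xj in
  St (drop j (rev x)) (rev (take j (rev x))) j 0 0 0 0 0 0 0 0 0 0 0.
apply: (RunX_step (s1 := fun x => St [::] x (size x) 0 0 0 0 0 0 0 0 0 0 0)
  (s1' := fun x => F (x, size (rev x)))).
- suff : RunX (ForPop 0 (Seq (Push 1 false) (Push 4 true)) (Seq (Push 1 true) (Push 4 true)))
      (fun x => F (x, 0)) (fun x => F (x, size (rev x))).
    by apply: Run_eq => // x _; rewrite /F drop0 take0; St_eq.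
  apply: Run_forpop => //.
    by apply: pbounded_le (pbounded_size _ _) => x _; rewrite size_rev.
  move=> b; have -> : (if b then Seq (Push 1 true) (Push 4 true)
     else Seq (Push 1 false) (Push 4 true)) = Seq (Push 1 b) (Push 4 true) by case: (b).
  apply: Run_eq (Run_seq (Run_push _ _ _ _ _) (Run_push _ _ _ _ _)); first by [].
  move=> [x j] /= [_ [lt E]]; rewrite (take_nth false lt) E rev_rcons.
  by St_eq.
- by move=> x; rewrite /F drop_size take_size revK size_rev.
apply: (RunX_step (s1 := fun x => St [::] x (size x) 0 0 0 0 0 0 0 0 0 0 1)).
- by apply: Run_addc.
- by St_eq.
apply: (RunX_step (s1 := fun x => St [::] x (size x) 0 0 0 0 0 0 0 0 0 0 (size x ^ k))).
- apply: (@Run_powin _ _ _ k _ 15 4 16 (fun=> 1) size) => //; last exact: CN.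
  by split; [exact: pbounded_const|].
- by St_eq; rewrite mul1n.
apply: (RunX_step (s1 := fun x =>
  St [::] x (size x) (k * size x ^ k) 0 0 0 0 0 0 0 0 0 (size x ^ k))).
- apply: (@Run_addm _ _ _ _ _ _ _ (fun x => size x ^ k)) => //.
  by split=> //; apply: pbounded_exp; exact: pbounded_size.
- by St_eq.
apply: (RunX_step (s1 := fun x =>
  St [::] x (size x) (pdX x) 0 0 0 0 0 0 0 0 0 (size x ^ k))).
- by apply: Run_addc.
- by St_eq; rewrite /pad; St_fin.
apply: (RunX_step (s1 := fun x =>
  St [::] x (size x) (pdX x) (pdX x) 0 0 0 0 0 0 0 0 (size x ^ k))).
- by apply: Run_addto => //; exact: CB.
- by St_eq.
apply: (RunX_step (s1 := fun x => St [::] x (size x) (pdX x) (pdX x)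
   (2 * pdX x) 0 0 0 0 0 0 0 (size x ^ k))).
- by apply: Run_addm => //; exact: CB.
- by St_eq.
apply: (RunX_step (s1 := fun x => St [::] x (size x) (pdX x) (pdX x)
   (1 + 2 * pdX x) 0 0 0 0 0 0 0 (size x ^ k))).
- by apply: Run_addc.
- by St_eq.
apply: (RunX_step (s1 := fun x => St [::] x (size x) (pdX x) (pdX x)
   (ncX x) 0 0 0 0 0 0 0 (size x ^ k))).
- by apply: Run_addto => //; exact: CN.
- by St_eq; rewrite /ncols; St_fin.
apply: (RunX_step (s1 := fun x => St [::] x (size x) (pdX x) (pdX x)
   (ncX x) (2 * q * ncX x) 0 0 0 0 0 0 (size x ^ k))).
- by apply: Run_addm => //; exact: CS.
- by St_eq.
apply: (RunX_step (s1 := fun x => St [::] x (size x) (pdX x) (pdX x)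
   (ncX x) (nbX x) 0 0 0 0 0 0 (size x ^ k))).
- by apply: Run_addc.
- by St_eq; rewrite /nbits; St_fin.
pose St' x := St [::] x (size x) (pdX x) (pdX x)
   (ncX x) (nbX x).
apply: (RunX_step (s1 := fun x => St' x (block_len * ncX x) 0 0 0 0 0 (size x ^ k))).
- by apply: Run_addm => //; exact: CS.
- by St_eq.
apply: (RunX_step (s1 := fun x => St' x (block_len * ncX x) 1 0 0 0 0 (size x ^ k))).
- by apply: Run_addc.
- by St_eq.
apply: (RunX_step (s1 := fun x =>
  St' x (block_len * ncX x) 1 (q * ncX x) 0 0 0 (size x ^ k))).
- by apply: Run_addm => //; exact: CS.
- by St_eq.
apply: (RunX_step (s1 := fun x =>
  St' x (block_len * ncX x) 1 (1 + q * ncX x) 0 0 0 (size x ^ k))).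
- by apply: Run_addc.
- by St_eq.
apply: (RunX_step (s1 := fun x => St' x (block_len * ncX x) 1
   (1 + q * ncX x) (nbX x) 0 0 (size x ^ k))).
- by apply: Run_addto => //; exact: CNN.
- by St_eq.
apply: (RunX_step (s1 := fun x => St' x (block_len * ncX x) 1
   (1 + q * ncX x) (1 + nbX x) 0 0 (size x ^ k))).
- by apply: Run_addc.
- by St_eq.
apply: (RunX_step (s1 := fun x => St' x (block_len * ncX x) 1
   (1 + q * ncX x) (1 + nbX x) (q * ncX x) 0 (size x ^ k))).
- by apply: Run_addm => //; exact: CS.
- by St_eq.
apply: (RunX_step (s1 := fun x => St' x (block_len * ncX x) 1
   (1 + q * ncX x) (1 + nbX x) (nbX x + q * ncX x) 0
   (size x ^ k))).
- by apply: Run_addto => //; exact: CNN.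
- by St_eq.
apply: (RunX_step (s1 := fun x => St' x (block_len * ncX x) 1
   (1 + q * ncX x) (1 + nbX x) (1 + (nbX x + q * ncX x))
   0 (size x ^ k))).
- by apply: Run_addc.
- by St_eq.
apply: RunX_step Rc.
- by apply: (@Run_addm _ _ _ _ _ _ _ (fun x => nbX x)) => //; exact: CNN.
- by rewrite /St' /S_arith; St_eq.
Qed.

Definition S_end x : store := upd (upd (upd (S_arith x) 5 [::]) 1 [::]) 6 [::].

Lemma Run_emit : RunX (foldr Seq (Push 0 false) gen_emit) S_arith
  (fun x => upd (put (S_end x)
     (iter (ncX x) adv (start_shift sg (pointers (size x)))) [::])
     0 (rev (generated x))).
Proof.
rewrite /=.
pose o1 (x : seq bool) := rev (code_nat (nbX x)).
pose o2 (x : seq bool) := rev (code_nat (size (the_circuit x))) ++ o1 x.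
pose o3 (x : seq bool) := rev (gcode (map (instg (pointers (size x))) (init_gates st0))) ++ o2 x.
pose r (x : seq bool) := pointers (size x).
pose r1 (x : seq bool) := start_shift sg (r x).
have pb v : v \in op_vars -> pbX (fun x => r x v).
  rewrite /r !inE; repeat case/orP; move/eqP->; rewrite /pointers /=.
  - exact: pbounded_const.
  - exact: pbX_nbits.
  - exact: pbounded_const.
  - by do ?[exact: pbounded_const | exact: pbX_ncols | apply: pbounded_add | apply: pbounded_mul].
  - by do ?[exact: pbounded_const | exact: pbX_nbits | apply: pbounded_add].
  - by do ?[exact: pbounded_const | exact: pbX_ncols | exact: pbX_nbits
            | apply: pbounded_add | apply: pbounded_mul].
  - by apply: pbounded_mul; [exact: pbounded_const|exact: pbX_nbits].
have rd : ready (fun _ : seq bool => True) size S_arith r by split.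
have pb1 v : v \in op_vars -> pbX (fun x => r1 x v).
  move=> /pb Hv; rewrite /r1 /start_shift; case: (v == 14) => //.
  by apply: pbounded_add; [exact: Hv|exact: pbounded_const].
have rd1 : ready (fun _ : seq bool => True) size S_arith r1 by split.
have rdS s i c : ready (fun _ : seq bool => True) size s r1 ->
    i \notin [:: scratch; 3; 8] ->
    ready (fun _ : seq bool => True) size (fun x => upd (s x) i (c x)) r1.
  rewrite !inE !negb_or => -[E2 E3 E8 _] /and3P[i2 i3 i8]; split=> // x _;
    rewrite /upd eq_sym ?(negbTE i2) ?(negbTE i3) ?(negbTE i8).
  - exact: E2.
  - exact: E3.
  - exact: E8.
apply: (RunX_step (s1 := fun x => upd (S_arith x) 0 (o1 x))).
- apply: (@Run_emitnat _ _ _ _ _ (fun x => nbX x)) => //.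
  by split; [exact: pbX_nbits|].
- by move=> x; cbv beta; rewrite addn0 cats0.
apply: (RunX_step (s1 := fun x => put (S_arith x) (r x) (o2 x))).
- apply: (@Run_emitnat _ _ _ _ _ (fun x => block_len * ncX x)) => //.
  split=> //; by apply: pbounded_mul; [exact: pbounded_const|exact: pbX_ncols].
- move=> x; apply: functional_extensionality; rewrite /put /upd.
  case=> [|v] /=; last by do 14?[case: v => [|v] //=].
  (* The announced number of gates is the size of the circuit that will follow. *)
  rewrite /o2; congr (rev (code_nat _) ++ _).
  by rewrite size_automaton_circuit // size_letters /final_size mulnC; lia.
apply: (RunX_step (s1 := fun x => put (S_arith x) (r x) (o3 x))).
- by apply: Run_put_gates => //; exact: init_gates_in.
- by [].
apply: (RunX_step (s1 := fun x => emitted (S_arith x) [::] (r1 x) (o3 x))).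
- by apply: Run_addc => //; apply: ready_scratch rd.
- move=> x; rewrite /emitted /=; apply: functional_extensionality.
  rewrite /put /upd /r1 /start_shift => v; case: (v =P 14) => // ->.
  by rewrite -[14 == 0]/false -[9 < 14 <= 14]/true -nseqD addnC.
apply: (RunX_step (s1 := fun x => emitted (upd (S_arith x) 5 [::])
    (nseq (pdX x) (Some None)) (r1 x) (o3 x))).
- apply: (@Run_blocks _ _ _ _ _ _ _ 5 (fun x => nseq (pdX x) true) (fun=> Some None)) => //.
  + exact: pbounded_const.
  + by apply: pbounded_le pbX_pad => x _; rewrite size_nseq.
- by move=> x; rewrite /= map_nseq.
have rd2 := rdS _ 5 (fun=> [::]) rd1 isT.
apply: (RunX_step (s1 := fun x => emitted (upd (S_arith x) 5 [::])
    (rcons (nseq (pdX x) (Some None)) None) (r1 x) (o3 x))).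
- apply: Run_body => //.
  by apply: pbounded_le pbX_pad => x _; rewrite size_nseq.
- by [].
apply: (RunX_step (s1 := fun x => emitted (upd (upd (S_arith x) 5 [::]) 1 [::])
    (rcons (nseq (pdX x) (Some None)) None ++ [seq Some (Some b) | b <- x]) (r1 x) (o3 x))).
- apply: (@Run_blocks _ _ _ _ _ _ _ 1 id (fun b => Some (Some b))) => //.
  + apply: (pbounded_le (h := fun x => pdX x + 1)).
      by move=> x _; rewrite size_rcons size_nseq addn1.
    by apply: pbounded_add; [exact: pbX_pad|exact: pbounded_const].
  + exact: pbounded_size.
- by [].
have rd3 := rdS _ 1 (fun=> [::]) rd2 isT.
apply: (RunX_step (s1 := fun x => emitted (S_end x) (letters x) (r1 x) (o3 x))).
- apply: (@Run_blocks _ _ _ _ _ _ _ 6 (fun x => nseq (pdX x) true) (fun=> Some None)) => //.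
  + apply: (pbounded_le (h := fun x => ncX x) _ pbX_ncols).
    move=> x _; rewrite size_cat size_rcons size_map size_nseq /ncols; lia.
  + by apply: pbounded_le pbX_pad => x _; rewrite size_nseq.
- by move=> x; rewrite /= map_nseq /letters cat_rcons -catA.
have rd4 := rdS _ 6 (fun=> [::]) rd3 isT.
have Bl : pbX (fun x => size (letters x)).
  by apply: pbounded_le pbX_ncols => x _; rewrite size_letters.
apply: (Run_seq (Run_put_gates (fun x => rev (blocks_code (letters x) (r1 x)) ++ o3 x)
  (ready_iter rd4 Bl) (final_gates_in sg acc))).
apply: Run_eq (Run_push _ _ _ _ _) => // x _.
apply: functional_extensionality => v; rewrite [LHS]/upd [RHS]/upd /put.
case: (v == 0); last by rewrite size_letters.
rewrite -[0 == 0]/true; cbv iota.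
rewrite /generated !rev_cat /= /the_circuit /automaton_circuit gcode_cat gcode_scan.
by rewrite /o3 /o2 /o1 !rev_cat !catA.
Qed.

(** * Bounds on the stack indices of the generator *)

Lemma ok_sseq W cs : 2 < W -> stm_ok W (sseq cs) = all (stm_ok W) cs.
Proof. by move=> W2; elim: cs => [|c cs IH] /=; rewrite ?W2 // IH. Qed.

Lemma ok_pushes W i bs : 2 < W -> i < W -> stm_ok W (pushes i bs).
Proof. by move=> W2 lt; rewrite ok_sseq // all_map; apply/allP. Qed.

Lemma ok_addto W v w : 2 < W -> v < W -> w < W -> stm_ok W (addto v w).
Proof. by move=> W2 lv lw; rewrite /= W2 lv lw. Qed.

Lemma ok_addm W m v w : 2 < W -> v < W -> w < W -> stm_ok W (addm m v w).
Proof. by move=> W2 lv lw; rewrite ok_sseq // all_nseq ok_addto ?orbT. Qed.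

Lemma ok_powin W m u n t : 2 < W -> u < W -> n < W -> t < W -> stm_ok W (powin m u n t).
Proof.
move=> W2 lu ln lt; rewrite ok_sseq // all_nseq; apply/orP; right.
by rewrite /= lu ln lt W2.
Qed.

Lemma ok_emitnat W o : 2 < W -> o.1 < W -> stm_ok W (emitnat o).
Proof.
move=> W2 lo; have W0 : 0 < W by lia.
by rewrite /emitnat -[stm_ok _ _]/(stm_ok W (addto _ _) && (stm_ok W (addc _ _) && (0 < W)))
  ok_addto // ok_pushes.
Qed.

Lemma ok_Seq W c1 c2 : stm_ok W c1 -> stm_ok W c2 -> stm_ok W (Seq c1 c2).
Proof. by move=> /= -> ->. Qed.

Lemma ok_emitgates W vs gs : 2 < W -> all (fun v => v < W) vs -> all (sgate_in vs) gs ->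
  stm_ok W (emitgates gs).
Proof.
move=> W2 /allP Hv; have W0 : 0 < W by lia.
have okn o : o.1 \in vs -> stm_ok W (emitnat o) by move=> /Hv; exact: ok_emitnat.
elim: gs => [|g gs IH]; first by rewrite /= W2.
rewrite [all _ _]/= => /andP[gin /IH ok]; apply: ok_Seq ok.
case: g gin => [a b|a b|a]; rewrite [sgate_in _ _]/=.
- by case/andP=> /okn oka /okn okb; apply: ok_Seq (ok_pushes _ _ _) (ok_Seq oka okb).
- by case/andP=> /okn oka /okn okb; apply: ok_Seq (ok_pushes _ _ _) (ok_Seq oka okb).
- by move=> /okn oka; apply: ok_Seq (ok_pushes _ _ _) oka.
Qed.

Lemma ok_body g : stm_ok 17 (body g).
Proof.
rewrite /body; set c := emitgates _.
have ok : stm_ok 17 c by apply: (ok_emitgates (vs := op_vars)) => //; exact: block_gates_in.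
by rewrite -[stm_ok _ _]/(stm_ok 17 c && [&& stm_ok 17 (addc _ _), stm_ok 17 (addc _ _),
   stm_ok 17 (addc _ _), stm_ok 17 (addc _ _) & stm_ok 17 (addc _ _)]) ok !ok_pushes.
Qed.

Lemma ok_foldr W c cs : stm_ok W (foldr Seq c cs) = all (stm_ok W) cs && stm_ok W c.
Proof. by elim: cs => //= c1 cs ->; rewrite andbA. Qed.

Lemma ok_forpop W i c0 c1 : i < W -> stm_ok W c0 -> stm_ok W c1 -> stm_ok W (ForPop i c0 c1).
Proof. by move=> /= -> -> ->. Qed.

Lemma all_cons_intro (T : Type) (p : pred T) x s : p x -> all p s -> all p (x :: s).
Proof. by move=> /= -> ->. Qed.

Theorem generated_polytime : PolyTimeComputable generated.
Proof.
(* Stacks 0 to 16 are in use. *)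
apply: (@stm_polytime 17 gen_prog) => //.
- rewrite /gen_prog ok_foldr andbT all_cat; apply/andP; split.
    do 21?[apply: all_cons_intro; [first [exact: ok_addm | exact: ok_addto
      | exact: ok_pushes | exact: ok_powin | by []]|]] => //.
  apply: all_cons_intro; first exact: ok_emitnat.
  apply: all_cons_intro; first exact: ok_emitnat.
  apply: all_cons_intro; first by apply: (ok_emitgates (vs := op_vars)) => //; exact: init_gates_in.
  apply: all_cons_intro; first exact: ok_pushes.
  do 4?[apply: all_cons_intro; [first [exact: ok_body | by apply: ok_forpop; rewrite ?ok_body]|]].
  apply: all_cons_intro => //.
  by apply: (ok_emitgates (vs := op_vars)) => //; exact: final_gates_in.
- rewrite /gen_prog foldr_cat; apply: Run_arith; exact: Run_emit.
- by move=> x; rewrite /upd.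
Qed.

End Generator.

(** * Regular predicates *)

Record col := Col {
  c_letter : letter; c_C : seq bool; c_A : seq bool; c_C' : seq bool; c_A' : seq bool }.

(** Recognition by a one-way finite automaton over columns that sees the two strand bits only at the
    end. Asserting mere existence lets the edge relation be assembled from Boolean closure
    properties, without writing down the product automaton. *)
Definition Reg (P : seq col -> bool -> bool -> bool) : Prop :=
  exists (A : finType) (a0 : A) (d : A -> col -> A) (acc : A -> bool -> bool -> bool),
    forall cs s s', P cs s s' = acc (foldl d a0 cs) s s'.

Lemma Reg_eq P Q : (forall cs s s', P cs s s' = Q cs s s') -> Reg P -> Reg Q.
Proof.
by move=> E [A [a0 [d [acc H]]]]; exists A, a0, d, acc => cs s s'; rewrite -E H.
Qed.

Lemma Reg_fold (A : finType) (a0 : A) d (acc : A -> bool) :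
  Reg (fun cs _ _ => acc (foldl d a0 cs)).
Proof. by exists A, a0, d, (fun a _ _ => acc a). Qed.

Lemma Reg_bits (p : bool -> bool -> bool) : Reg (fun _ s s' => p s s').
Proof. by exists unit, tt, (fun a _ => a), (fun _ => p). Qed.

Lemma Reg_op (op : bool -> bool -> bool) P Q : Reg P -> Reg Q ->
  Reg (fun cs s s' => op (P cs s s') (Q cs s s')).
Proof.
move=> [A [a0 [d [acc H]]]] [B [b0 [e [bcc K]]]].
exists (A * B)%type, (a0, b0), (fun ab c => (d ab.1 c, e ab.2 c)),
  (fun ab s s' => op (acc ab.1 s s') (bcc ab.2 s s')) => cs s s'.
rewrite H K; congr op; congr (_ _ s s').
  by elim: cs a0 b0 {H K} => //= c cs IH a0 b0; exact: IH.
by elim: cs a0 b0 {H K} => //= c cs IH a0 b0; exact: IH.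
Qed.

Lemma Reg_and P Q : Reg P -> Reg Q -> Reg (fun cs s s' => P cs s s' && Q cs s s').
Proof. exact: Reg_op. Qed.

Lemma Reg_or P Q : Reg P -> Reg Q -> Reg (fun cs s s' => P cs s s' || Q cs s s').
Proof. exact: Reg_op. Qed.

Lemma Reg_not P : Reg P -> Reg (fun cs s s' => ~~ P cs s s').
Proof. by move=> R; exact: (Reg_op (fun a _ => ~~ a) R R). Qed.

Lemma Reg_all (p : col -> bool) : Reg (fun cs _ _ => all p cs).
Proof.
apply: Reg_eq (Reg_fold true (fun a c => a && p c) id) => cs s s'.
suff G b : foldl (fun a c => a && p c) b cs = b && all p cs by rewrite G.
by elim: cs b => [|c cs IH] b /=; rewrite ?andbT // IH andbA.
Qed.

Section Encoding.

Variables (A : finType) (a0 : A).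

(** The same code is used for the cells of the graph, where it has a second merit: with at least two
    cells no code is constant, so nodes never coincide with the constant roots. *)
Definition onehot (a : A) : seq bool := [seq b == a | b <- enum A].
Definition unhot (st : seq bool) : A := nth a0 (enum A) (index true st).

Lemma onehotK a : unhot (onehot a) = a.
Proof.
rewrite /unhot /onehot (_ : index true _ = index a (enum A)) ?nth_index ?mem_enum //.
by elim: (enum A) => //= b s ->; rewrite eqb_id; case: (b == a).
Qed.

Lemma size_onehot a : size (onehot a) = #|A|.
Proof. by rewrite size_map cardE. Qed.

End Encoding.

Section Columns.

Variable q : nat.

Fixpoint cols (gs : seq letter) (C A C' A' : seq bool) : seq col :=
  if gs is g :: gs' then
    Col g (take q C) (take q A) (take q C') (take q A') ::
    cols gs' (drop q C) (drop q A) (drop q C') (drop q A')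
  else [::].

Lemma cols_cat gs C A C' A' t1 t2 t3 t4 :
  size C = q * size gs -> size A = q * size gs -> size C' = q * size gs ->
  size A' = q * size gs ->
  cols gs (C ++ t1) (A ++ t2) (C' ++ t3) (A' ++ t4) = cols gs C A C' A'.
Proof.
elim: gs C A C' A' => //= g gs IH C A C' A' sC sA sC' sA'.
have H (s : seq bool) t : size s = q * (size gs).+1 ->
   [/\ take q (s ++ t) = take q s, drop q (s ++ t) = drop q s ++ t &
       size (drop q s) = q * size gs].
  rewrite mulnS => E; rewrite take_cat drop_cat size_drop E addKn.
  case: ltngtP => // [|E1]; first by rewrite ltnNge leq_addr.
  by rewrite -E1 subnn take0 drop0 cats0 take_oversize ?drop_oversize ?E -?E1 //=; split=> //; lia.
have [-> -> dC] := H _ t1 sC; have [-> -> dA] := H _ t2 sA.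
have [-> -> dC'] := H _ t3 sC'; have [-> -> dA'] := H _ t4 sA'.
by rewrite IH.
Qed.

Lemma slice_take inp i k : i + k <= size inp -> slice inp i k = take k (drop i inp).
Proof.
move=> le; apply: (@eq_from_nth _ false).
  by rewrite size_slice size_take size_drop; case: ltnP => //; lia.
rewrite size_slice => j lj.
by rewrite (nth_map 0) ?size_iota // nth_iota // nth_take // nth_drop.
Qed.

Variables (A : finType) (a0 : A) (d : A -> col -> A) (acc : A -> bool -> bool -> bool).

Definition reg_db (g : letter) (st cb : seq bool) : seq bool :=
  onehot (d (unhot a0 st) (Col g (take q cb) (take q (drop q cb))
    (take q (drop (q + q) cb)) (take q (drop (q + (q + q)) cb)))).

Lemma scan_reg inp gs r a : in_range q inp r (size gs) ->
  scan q #|A| reg_db inp gs r (onehot a) =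
  onehot (foldl d a (cols gs (drop (r 10) inp) (drop (r 11) inp) (drop (r 12) inp)
    (drop (r 13) inp))).
Proof.
elim: gs r a => //= g gs IH r a rng.
have rngq v : 10 <= v <= 13 -> r v + q <= size inp.
  by move=> /rng; rewrite mulnS; lia.
have -> : reg_db g (onehot a) (column q inp r) = onehot (d a
   (Col g (take q (drop (r 10) inp)) (take q (drop (r 11) inp)) (take q (drop (r 12) inp))
   (take q (drop (r 13) inp)))).
  rewrite /reg_db onehotK /column !slice_take ?rngq //.
  set s1 := take q (drop (r 10) inp); set s2 := take q (drop (r 11) inp).
  set s3 := take q (drop (r 12) inp); set s4 := take q (drop (r 13) inp).
  have sz v : 10 <= v <= 13 -> size (take q (drop (r v) inp)) = q.
    by move=> vr; rewrite -slice_take ?rngq // size_slice.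
  have [z1 z2 z3 z4] : [/\ size s1 = q, size s2 = q, size s3 = q & size s4 = q].
    by split; exact: sz.
  congr (onehot (d a (Col _ _ _ _ _))).
  - by rewrite take_size_cat.
  - by rewrite drop_size_cat // take_size_cat.
  - by rewrite -drop_drop !drop_size_cat // take_size_cat.
  - by rewrite addnA -!drop_drop !drop_size_cat // take_oversize ?z4.
rewrite (IH _ _ (in_range_advance _ rng)).
by rewrite /advance /= !drop_drop ![q + _]addnC.
Qed.

End Columns.

(** Separates the programming from the combinatorics: for an edge relation only regularity remains
    to be shown. A column is one letter of the padded input together with one block from each of the
    four strings. *)
Theorem reg_polytime P (q k : nat) : Reg P ->
  exists C : seq bool -> circuit,
    PolyTimeComputable (fun x => encode (Inst (nbits q k (size x)) (C x) None)) /\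
    forall x, circuit_wf (2 * nbits q k (size x)) (C x) /\
      forall s1 C1 A1 s2 C2 A2, let m := q * ncols k (size x) in
        [/\ size C1 = m, size A1 = m, size C2 = m & size A2 = m] ->
      circuit_out (C x) ((s1 :: C1 ++ A1) ++ (s2 :: C2 ++ A2)) =
      P (cols q (letters k x) C1 A1 C2 A2) s1 s2.
Proof.
move=> [A [a0 [d [acc H]]]].
have A0 : 0 < #|A| by apply/card_gt0P; exists a0.
pose db := reg_db q a0 d.
pose ac st := acc (unhot a0 st).
pose C := the_circuit q #|A| db (onehot a0) ac k.
have sdb g st c : size (db g st c) = #|A| by rewrite size_onehot.
exists C; split.
  have := @generated_polytime q #|A| db (onehot a0) ac (size_onehot a0) A0 k.
  by congr PolyTimeComputable.
move=> x.
have Enb : nbits q k (size x) = 1 + 2 * (q * ncols k (size x)) by rewrite /nbits mulnA.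
have rng inp : size inp = 2 * nbits q k (size x) ->
    in_range q inp (pointers q k (size x)) (size (letters k x)).
  move=> sz v; rewrite size_letters sz => /andP[].
  by rewrite /pointers; do 14?[case: v => [|v] //=] => _ _; move: Enb;
     move: (nbits _ _ _) (q * _); lia.
have ok inp : size inp = 2 * nbits q k (size x) ->
   circuit_wf (size inp) (C x) /\
   circuit_out (C x) inp =
     ac (scan q #|A| db inp (letters k x) (pointers q k (size x)) (onehot a0))
       (nth false inp 0) (nth false inp (nbits q k (size x))).
  move=> sz; apply: (automaton_circuit_ok ac sdb (size_onehot a0) A0 _ (rng inp sz)).
  - by rewrite /pointers /= sz.
  - by rewrite /pointers /= sz Enb; lia.
  - by rewrite /pointers /= sz Enb; lia.
split.
  have [] := ok (nseq (2 * nbits q k (size x)) false).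
    by rewrite size_nseq.
  by rewrite size_nseq.
move=> s1 C1 A1 s2 C2 A2 m [sC1 sA1 sC2 sA2].
have En : nbits q k (size x) = size (s1 :: C1 ++ A1).
  by rewrite /= size_cat sC1 sA1 Enb -/m; lia.
set inp := (_ ++ _).
have sz : size inp = 2 * nbits q k (size x).
  by rewrite size_cat -En /= size_cat sC2 sA2 Enb -/m; lia.
have [_ ->] := ok _ sz; rewrite /ac.
rewrite scan_reg; last exact: rng.
rewrite onehotK H.
have nth0 : nth false inp 0 = s1 by [].
have nthn : nth false inp (nbits q k (size x)) = s2.
  by rewrite /inp nth_cat En ltnn subnn.
rewrite nth0 nthn; congr (acc (foldl d a0 _) _ _).
have D p t i : inp = p ++ t -> i = size p -> drop i inp = t.
  by move=> -> ->; rewrite drop_size_cat.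
rewrite -[pointers _ _ _ 10]/1 -[pointers _ _ _ 11]/(1 + m).
rewrite -[pointers _ _ _ 12]/(1 + nbits q k (size x)).
rewrite -[pointers _ _ _ 13]/(1 + (nbits q k (size x) + m)).
rewrite (D [:: s1] (C1 ++ (A1 ++ (s2 :: C2 ++ A2)))) //; last by rewrite /inp /= -!catA.
rewrite (D (s1 :: C1) (A1 ++ (s2 :: C2 ++ A2))); first last.
- by rewrite /= sC1.
- by rewrite /inp /= -!catA.
rewrite (D (s1 :: C1 ++ A1 ++ [:: s2]) (C2 ++ A2)); first last.
- by rewrite En /= !size_cat /=; lia.
- by rewrite /inp /= -!catA.
rewrite (D (s1 :: C1 ++ A1 ++ s2 :: C2) (A2 ++ [::])); first last.
- by rewrite En /= !size_cat /= sC2; lia.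
- by rewrite /inp cats0 /= -!catA.
by rewrite cols_cat // size_letters.
Qed.

(** * The poset game on a union of chains *)

Section Mirror.

Variables (T : finType) (le : rel T) (f : T -> T).
Hypothesis le_refl : reflexive le.

Lemma card_after_move (Q : {set T}) x : x \in Q -> #|after_move le Q x| < #|Q|.
Proof.
move=> xQ; apply: proper_card; apply/properP; split.
  by apply/subsetP => y; rewrite inE => /andP[].
by exists x => //; rewrite inE le_refl andbF.
Qed.

(** The last condition makes the answer [f x] survive the move [x]; the other three make the
    position after both moves symmetric again. *)
Definition mirrored (Q : {set T}) :=
  [/\ forall x, x \in Q -> f x \in Q,
     forall x y, x \in Q -> y \in Q -> le (f x) (f y) = le x y,
     forall x, x \in Q -> f (f x) = x &
     forall x, x \in Q -> ~~ le x (f x)].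

Lemma mirrored_moves (Q : {set T}) x : mirrored Q -> x \in Q ->
  f x \in after_move le Q x /\ mirrored (after_move le (after_move le Q x) (f x)).
Proof.
move=> [H1 H2 H3 H4] xQ; split; first by rewrite inE H1 // H4.
have sub y : y \in after_move le (after_move le Q x) (f x) ->
    [/\ y \in Q, ~~ le x y & ~~ le (f x) y].
  by rewrite !inE -andbA => /and3P[].
split.
- move=> y /sub[yQ n1 n2]; rewrite !inE H1 //= -{1}(H3 x xQ) !H2 ?H1 //.
  by rewrite n2 n1.
- by move=> y z /sub[yQ _ _] /sub[zQ _ _]; exact: H2.
- by move=> y /sub[yQ _ _]; exact: H3.
- by move=> y /sub[yQ _ _]; exact: H4.
Qed.

(* The second player answers x by its mirror image f x. *)
Lemma mirror_lose k Q : mirrored Q -> #|Q| <= k -> ~~ wins_fuel le k Q.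
Proof.
elim/ltn_ind: k Q => -[|k] IH Q MQ cQ //=.
apply/existsPn => x; apply/negP => /andP[xQ]; apply/negP; rewrite negbK.
have [fx M2] := mirrored_moves MQ xQ.
have c1 := card_after_move xQ; have c2 := card_after_move fx.
case: k IH cQ => [|k] IH cQ /=; first by lia.
by apply/existsP; exists (f x); rewrite fx IH //; lia.
Qed.

Lemma mirror_win (Q : {set T}) x : x \in Q -> mirrored (after_move le Q x) -> exists_game le Q.
Proof.
move=> xQ M; have c1 := card_after_move xQ; rewrite /exists_game.
case: #|Q| c1 => // k c1 /=; apply/existsP; exists x.
by rewrite xQ mirror_lose.
Qed.

End Mirror.

(** * Deterministic graphs as unions of chains *)

Section Chains.

Variables (T : finType) (e : rel T) (x0 : T) (chs : seq (seq T)).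

Definition sink (x : T) := forall y, ~~ e x y.
Local Notation ch i := (nth [::] chs i).

Hypothesis e_det : forall x y z, e x y -> e x z -> y = z.
Hypothesis chs_path : forall i, i < size chs -> sorted e (ch i).
Hypothesis chs_sink : forall i, i < size chs -> sink (last x0 (ch i)).
Hypothesis chs_last : forall i j, i < size chs -> j < size chs ->
  last x0 (ch i) = last x0 (ch j) -> i = j.
Hypothesis chs_cover : forall x, exists2 i, i < size chs & x \in ch i.

Lemma path_to_sink_unique x p p' : path e x p -> path e x p' ->
  sink (last x p) -> sink (last x p') -> p = p'.
Proof.
elim: p p' x => [|y p IH] [|z p'] x //=.
- by move=> _ /andP[xz _] s; have := s z; rewrite xz.
- by move=> /andP[xy _] _ _ s; have := s y; rewrite xy.
- by move=> /andP[xy py] /andP[xz pz]; rewrite (e_det xz xy) in pz *; move=> s s';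
    rewrite (IH _ _ py pz s s').
Qed.

Definition pt i j := nth x0 (ch i) j.
Definition valid i j := (i < size chs) && (j < size (ch i)).

Lemma sorted_drop (s : seq T) j : sorted e s -> sorted e (drop j s).
Proof. by rewrite -{1}(cat_take_drop j s) => /cat_sorted2[]. Qed.

(** Neither disjointness of the chains nor absence of repetitions is assumed. From a common point
    determinism forces the same rest, hence the same sink and by [chs_last] the same chain; the
    length of the rest then fixes the position. *)
Lemma pt_inj i j i' j' : valid i j -> valid i' j' -> pt i j = pt i' j' ->
  i = i' /\ j = j'.
Proof.
move=> /andP[li lj] /andP[li' lj'] E.
have D := drop_nth x0 lj; have D' := drop_nth x0 lj'.
have lastE i1 j1 : j1 < size (ch i1) -> last x0 (ch i1) = last (pt i1 j1) (drop j1.+1 (ch i1)).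
  by move=> l; rewrite -[in LHS](cat_take_drop j1 (ch i1)) last_cat (drop_nth x0 l).
have P i1 j1 : i1 < size chs -> j1 < size (ch i1) ->
    path e (pt i1 j1) (drop j1.+1 (ch i1)).
  by move=> l1 l2; have := sorted_drop j1 (chs_path l1); rewrite (drop_nth x0 l2).
have Es : drop j.+1 (ch i) = drop j'.+1 (ch i').
  apply: (@path_to_sink_unique (pt i j)); rewrite ?P //; first by rewrite E P.
    by rewrite -lastE //; exact: chs_sink.
  by rewrite E -lastE //; exact: chs_sink.
have Ei : i = i' by apply: chs_last => //; rewrite !(lastE _ _ lj) (lastE _ _ lj') Es E.
split=> //; move/(congr1 size): Es; rewrite -Ei !size_drop.
by rewrite -Ei in lj'; lia.
Qed.

Definition cid x := find (fun c => x \in c) chs.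
Definition ix x := index x (ch (cid x)).

Lemma cid_ix_valid x : valid (cid x) (ix x).
Proof.
have [i li xi] := chs_cover x.
have hs : has (fun c => x \in c) chs by apply/hasP; exists (ch i); rewrite ?mem_nth.
by rewrite /valid -has_find hs index_mem (nth_find [::] hs).
Qed.

Lemma cid_lt x : cid x < size chs. Proof. by case/andP: (cid_ix_valid x). Qed.
Lemma ix_lt x : ix x < size (ch (cid x)). Proof. by case/andP: (cid_ix_valid x). Qed.

Lemma pt_cid_ix x : pt (cid x) (ix x) = x.
Proof. by rewrite /pt nth_index // -index_mem ix_lt. Qed.

Lemma cid_pt i j : valid i j -> cid (pt i j) = i /\ ix (pt i j) = j.
Proof. by move=> V; apply: pt_inj; rewrite ?cid_ix_valid ?pt_cid_ix. Qed.

Lemma pt_edge i j : i < size chs -> j.+1 < size (ch i) -> e (pt i j) (pt i j.+1).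
Proof.
move=> li lj; have := sorted_drop j (chs_path li).
by rewrite (drop_nth x0 (ltnW lj)) (drop_nth x0 lj) /= => /andP[].
Qed.

Lemma edge_succ x y : e x y -> cid x = cid y /\ ix y = (ix x).+1.
Proof.
move=> xy; have := cid_ix_valid x; case/andP=> li lj.
case: (ltnP (ix x).+1 (size (ch (cid x)))) => [lj1|ge].
  have := pt_edge li lj1; rewrite pt_cid_ix => /(e_det xy) ->.
  by have [-> ->] := @cid_pt (cid x) (ix x).+1 ltac:(rewrite /valid li lj1 //).
have := chs_sink li y; rewrite (_ : last x0 _ = x) ?xy //.
rewrite -[RHS]pt_cid_ix /pt -nth_last; congr nth.
by move: ge lj; case: (size _) => //= n; lia.
Qed.

Lemma connect_chain x y : connect e x y = (cid x == cid y) && (ix x <= ix y).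
Proof.
apply/idP/idP.
  case/connectP=> p + ->; elim: p x => [|z p IH] x /=; first by rewrite eqxx leqnn.
  by case/andP=> /edge_succ[-> E] /IH/andP[-> le]; rewrite /= (leq_trans _ le) // E.
case/andP=> /eqP Ec le; rewrite -(pt_cid_ix x) -(pt_cid_ix y) -Ec.
have ly : ix y < size (ch (cid x)) by rewrite Ec ix_lt.
elim: (ix y) le ly => [|j IH] le ly.
  by move: le; rewrite leqn0 => /eqP->; exact: connect0.
move: le; rewrite leq_eqVlt => /predU1P[->|lt]; first exact: connect0.
apply: connect_trans (IH lt (ltnW ly)) (connect1 _).
by apply: pt_edge => //; exact: cid_lt.
Qed.

Lemma chains_acyclic : acyclic e.
Proof.
move=> u v /edge_succ[Ec E]; rewrite connect_chain Ec eqxx /= E.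
by rewrite -ltnNge.
Qed.

Lemma chains_parallel k : size chs <= k -> parallel_chains k [set: T] (connect e).
Proof.
move=> lek.
exists (fun x => Ordinal (leq_trans (cid_lt x) lek)) => u v _ _.
rewrite !connect_chain; split.
  by move=> H; apply: val_inj => /=; case/orP: H => /andP[/eqP].
by move/(congr1 val) => /= ->; rewrite eqxx leq_total.
Qed.

Section Game.

Variable swap : nat -> nat.
Hypothesis swapK : forall i, swap (swap i) = i.
Hypothesis swap_ne : forall i, swap i != i.
Hypothesis swap_lt : forall i, i < size chs -> swap i < size chs.

Variable h : nat -> nat.
Hypothesis h_le : forall i, i < size chs -> h i <= size (ch i).
Hypothesis h_swap : forall i, i < size chs -> h (swap i) = h i.

(** Truncating each chain at a height describes both positions in which mirroring is used: the full
    poset, and the poset after the move that shortens a chain to the length of its partner. *)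
Definition lower := [set x | ix x < h (cid x)].
Definition flip x := pt (swap (cid x)) (ix x).

Lemma lower_mirrored : mirrored (connect e) flip lower.
Proof.
have V x : x \in lower -> valid (swap (cid x)) (ix x).
  rewrite inE => lt; rewrite /valid swap_lt ?cid_lt //=.
  by apply: leq_trans (h_le (swap_lt (cid_lt x))); rewrite h_swap // cid_lt.
split.
- by move=> x xQ; rewrite inE /flip; have [-> ->] := cid_pt (V x xQ);
    rewrite h_swap ?cid_lt //; move: xQ; rewrite inE.
- move=> x y /V/cid_pt[cx ix_x] /V/cid_pt[cy iy]; rewrite !connect_chain cx cy ix_x iy.
  by rewrite (can_eq swapK).
- move=> x /V/cid_pt[cx ix_x]; rewrite {1}/flip cx ix_x swapK; exact: pt_cid_ix.
- by move=> x /V/cid_pt[cx ix_x]; rewrite connect_chain cx eq_sym (negbTE (swap_ne _)).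
Qed.

End Game.

Variable swap : nat -> nat.
Hypothesis swapK : forall i, swap (swap i) = i.
Hypothesis swap_ne : forall i, swap i != i.
Hypothesis swap_lt : forall i, i < size chs -> swap i < size chs.

Lemma chains_lose : (forall i, i < size chs -> size (ch (swap i)) = size (ch i)) ->
  ~~ exists_game (connect e) [set: T].
Proof.
move=> H; have := @lower_mirrored swap swapK swap_ne swap_lt (fun i => size (ch i))
  (fun _ _ => leqnn _) H.
suff -> : lower (fun i => size (ch i)) = [set: T].
  by move=> M; apply: mirror_lose M (leqnn _); exact: connect0.
by apply/setP => x; rewrite !inE ix_lt.
Qed.

Lemma chains_win i0 : i0 < size chs -> size (ch (swap i0)) < size (ch i0) ->
  (forall i, i < size chs -> i != i0 -> i != swap i0 -> size (ch (swap i)) = size (ch i)) ->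
  exists_game (connect e) [set: T].
Proof.
move=> li0 lt H.
(* The winning move is the point with this index on chain [i0]: a move removes its point and
   everything behind it, so exactly the length of the partner remains. *)
pose L := size (ch (swap i0)).
pose h i := if i == i0 then L else size (ch i).
have hle i : i < size chs -> h i <= size (ch i).
  by rewrite /h; case: eqP => // -> _; exact: ltnW.
have hswap i : i < size chs -> h (swap i) = h i.
  move=> li; rewrite /h; case: (i =P i0) => [->|ne]; first by rewrite (negbTE (swap_ne _)).
  case: (swap i =P i0) => [E|ne']; first by rewrite /L -E swapK.
  by apply: H => //; apply/eqP => // E; apply: ne'; rewrite E swapK.
have V : valid i0 L by rewrite /valid li0.
have [cx ixx] := cid_pt V.
apply: (@mirror_win _ _ (flip swap) (connect0 e) _ (pt i0 L)); first by rewrite inE.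
suff -> : after_move (connect e) [set: T] (pt i0 L) = lower h.
  exact: lower_mirrored.
apply/setP => y; rewrite !inE connect_chain cx ixx /h eq_sym.
by case: (cid y =P i0) => [E|_] /=; rewrite -?ltnNge // ix_lt.
Qed.

End Chains.

(** * Euler tours *)

Section Tour.

Variables (X : finType) (z mx : X) (nx : rel X) (en : seq X).
Hypothesis nx_det : forall x y y', nx x y -> nx x y' -> y = y'.
Hypothesis nx_mx : forall y, ~~ nx mx y.
Hypothesis en_path : path nx z en.
Hypothesis en_last : last z en = mx.
Hypothesis en_all : forall x, x \in z :: en.
Hypothesis z_mx : z != mx.

(* R a c: the node c is the parent of a; the roots are z and mx. *)
Variables (R : rel X) (rk : X -> nat).
Hypothesis R_det : forall a c c', R a c -> R a c' -> c = c'.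
Hypothesis R_rk : forall a c, R a c -> rk a < rk c.
Hypothesis R_z : forall c, ~~ R z c.
Hypothesis R_mx : forall c, ~~ R mx c.
Hypothesis R_total : forall a, a != z -> a != mx -> exists c, R a c.

Definition tour_edge (u v : X * X) : bool :=
  [|| [&& ~~ R u.2 u.1, v.1 == u.1 & nx u.2 v.2],
      [&& R u.2 u.1, v.1 == u.2 & v.2 == z] |
      [&& u.2 == mx, R u.1 v.1 & nx u.1 v.2]].

(** The three cases exclude one another because [mx] has neither a successor under [nx] nor a
    parent. *)
Lemma tour_edge_det u v w : tour_edge u v -> tour_edge u w -> v = w.
Proof.
case: u v w => [c a] [c1 a1] [c2 a2]; rewrite /tour_edge /=.
case/or3P=> [/and3P[r /eqP-> n]|/and3P[r /eqP-> /eqP->]|/and3P[/eqP Ea r n]].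
- rewrite (negbTE r) /= => /orP[/andP[/eqP-> /(nx_det n)->] //|/and3P[/eqP Ea _ _]].
  by move: n; rewrite Ea (negbTE (nx_mx _)).
- rewrite r /= => /orP[/andP[/eqP-> /eqP->] //|/and3P[/eqP Ea _ _]].
  by move: r; rewrite Ea (negbTE (R_mx _)).
- rewrite Ea (negbTE (R_mx _)) (negbTE (nx_mx _)) /= andbF eqxx /=.
  by case/andP=> /(R_det r)-> /(nx_det n)->.
Qed.

Lemma tour_sink c : (forall c', ~~ R c c') -> sink tour_edge (c, mx).
Proof.
move=> Rc v; rewrite /tour_edge /= (negbTE (nx_mx _)) (negbTE (R_mx _)) (negbTE (Rc _)).
by rewrite !andbF.
Qed.

(** The recursion descends to children, whose rank is smaller, so [(rk c).+1] is enough fuel. *)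
Fixpoint tour_fuel (k : nat) (c : X) : seq (X * X) :=
  if k is k'.+1 then
    flatten [seq (c, a) :: (if R a c then tour_fuel k' a else [::]) | a <- z :: en]
  else [::].

Lemma tour_fuel_eq k k' c : rk c < k -> rk c < k' -> tour_fuel k c = tour_fuel k' c.
Proof.
elim: k k' c => [|k IH] [|k'] c // lk lk'; rewrite /tour_fuel -/tour_fuel.
congr flatten; apply: eq_map => a; case: ifP => // Rac; congr cons.
by apply: IH; apply: leq_trans (R_rk Rac) _.
Qed.

Definition tour c := tour_fuel (rk c).+1 c.

Lemma tourE c : tour c =
  flatten [seq (c, a) :: (if R a c then tour a else [::]) | a <- z :: en].
Proof.
rewrite {1}/tour /tour_fuel -/tour_fuel; congr flatten; apply: eq_map => a.
by case: ifP => // Rac; congr cons; apply: tour_fuel_eq => //; exact: R_rk.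
Qed.

(** Induction on the rank. The segment of a candidate [a] is a path whose last vertex has an edge to
    the next candidate of [c]: directly if [a] is no child of [c], and by the return edge from
    [(a, mx)] if it is. *)
Lemma tour_path c : exists p,
  [/\ tour c = (c, z) :: p, path tour_edge (c, z) p & last (c, z) p = (c, mx)].
Proof.
have [k le] : exists k, rk c < k by exists (rk c).+1.
elim: k c le => // k IH c le.
have B a : exists p, [/\ (c, a) :: (if R a c then tour a else [::]) = (c, a) :: p,
    path tour_edge (c, a) p & forall a', nx a a' -> tour_edge (last (c, a) p) (c, a')].
  case: ifP => Rac; last first.
    by exists [::]; split=> // a' n; rewrite /tour_edge /= Rac eqxx n.
  have [|p [-> pp lp]] := IH a; first exact: leq_trans (R_rk Rac) _.
  exists ((a, z) :: p); split=> //=.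
    by rewrite pp /tour_edge /= Rac !eqxx orbT.
  by move=> a' n; rewrite lp /tour_edge /= eqxx Rac n !orbT.
rewrite tourE.
suff G s a : path nx a s -> exists p,
    [/\ flatten [seq (c, a) :: (if R a c then tour a else [::]) | a <- a :: s] = (c, a) :: p,
     path tour_edge (c, a) p & last a s = mx -> last (c, a) p = (c, mx)].
  by have [p [E pp lp]] := G en z en_path; exists p; split=> //; exact: lp.
elim: s a => [|b s IHs] a /=.
  move=> _; have [p [E pp _]] := B a; exists p; split=> //; first by rewrite cats0 E.
  move=> Ea; move: E pp; rewrite Ea (negbTE (R_mx _)) => -[<-] //.
case/andP=> nab /IHs[p' [E' pp' lp']]; have [p [E pp Hp]] := B a.
exists (p ++ (c, b) :: p'); split.
- by case: E => ->; rewrite -E'.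
- by rewrite cat_path pp /= Hp.
- by rewrite last_cat.
Qed.

Lemma tour_own c b : (c, b) \in tour c.
Proof.
rewrite tourE; apply/flattenP; exists ((c, b) :: (if R b c then tour b else [::])).
  by apply/mapP; exists b.
by rewrite mem_head.
Qed.

Lemma tour_child a c : R a c -> {subset tour a <= tour c}.
Proof.
move=> Rac v vin; rewrite [tour c]tourE; apply/flattenP.
exists ((c, a) :: (if R a c then tour a else [::])).
  by apply/mapP; exists a.
by rewrite Rac inE vin orbT.
Qed.

(** Since roots have no parent, this keeps the pairs of one root out of the tour of the other. *)
Lemma tour_mem c v : v \in tour c -> v.1 = c \/ exists c', R v.1 c'.
Proof.
have [k le] : exists k, rk c < k by exists (rk c).+1.
elim: k c le => // k IH c le; rewrite tourE => /flattenP[l /mapP[a _ ->]].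
rewrite inE => /predU1P[-> |]; first by left.
case: ifP => // Rac vin; right.
have [|E|//] := IH a _ vin; first exact: leq_trans (R_rk Rac) _.
by exists c; rewrite E.
Qed.

Lemma tour_ancestor p x : path R x p -> {subset tour x <= tour (last x p)}.
Proof.
elim: p x => [|y p IH] x /=; first by move=> _ v.
case/andP=> Rxy /IH H v vin.
by apply: H; apply: tour_child Rxy _ vin.
Qed.

(** Climbing along parents raises the bounded rank and can stop only at a root, whose tour contains
    the tour of [x]. *)
Lemma tour_cover x b : (x, b) \in tour z \/ (x, b) \in tour mx.
Proof.
have bnd y : rk y <= \max_(x : X) rk x by exact: leq_bigmax.
move E: (\max_(x : X) rk x - rk x) => d.
suff H : {subset tour x <= tour z} \/ {subset tour x <= tour mx}.
  by case: H => H; [left|right]; apply: H; exact: tour_own.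
elim/ltn_ind: d x E => d IH x E.
case: (x =P z) => [->|/eqP nz]; first by left.
case: (x =P mx) => [->|/eqP nm]; first by right.
have [c Rxc] := R_total nz nm.
have := R_rk Rxc; have := bnd c => l1 l2.
have [|H|H] := IH (\max_(x : X) rk x - rk c) _ c erefl; first by lia.
  by left=> v /(tour_child Rxc) /H.
by right=> v /(tour_child Rxc) /H.
Qed.

(** A repeated vertex would have two paths of different lengths to the same sink, against
    determinism. *)
Lemma path_sink_uniq (x : X * X) p : path tour_edge x p -> sink tour_edge (last x p) ->
  uniq (x :: p).
Proof.
elim: p x => [|y p IH] x //= /andP[xy pp] s.
have := IH y pp s; rewrite /= => -> /=; rewrite andbT.
apply/negP => xin; have pa : path tour_edge x (y :: p) by rewrite /= xy.
move: xin; case/(nthP x) => j lj Ej.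
have D : y :: p = take j.+1 (y :: p) ++ drop j.+1 (y :: p) by rewrite cat_take_drop.
have lt : last x (take j.+1 (y :: p)) = x.
  by rewrite (take_nth x lj) last_rcons.
have := pa; rewrite D cat_path lt => /andP[_ p2].
have := @path_to_sink_unique _ _ tour_edge_det x (y :: p) (drop j.+1 (y :: p)) pa p2 s.
have -> : last x (drop j.+1 (y :: p)) = last y p.
  by rewrite -[RHS]/(last x (y :: p)) [in RHS]D last_cat lt.
move/(_ s)/(congr1 size); rewrite size_drop /=; move: lj => /=; lia.
Qed.

Lemma tour_uniq c : (forall c', ~~ R c c') -> uniq (tour c).
Proof.
move=> Rc; have [p [-> pp lp]] := tour_path c; apply: path_sink_uniq => //.
by rewrite lp; exact: tour_sink.
Qed.

(** The unique path from a common vertex to a sink would have to end both in [(z, mx)] and in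
    [(mx, mx)]. *)
Lemma tour_disjoint v : v \in tour z -> v \notin tour mx.
Proof.
have H c : v \in tour c -> exists2 p, path tour_edge v p & last v p = (c, mx).
  have [p [-> pp lp]] := tour_path c => vin.
  case/splitPl: vin pp lp => p1 p2 lv; rewrite cat_path last_cat lv.
  by case/andP=> _ p2v l2; exists p2.
move=> /H[p pp lp]; apply/negP => /H[p' pp' lp'].
have E : p = p'.
  apply: (path_to_sink_unique tour_edge_det pp pp').
    by rewrite lp; exact: tour_sink R_z.
  by rewrite lp'; exact: tour_sink R_mx.
by move: lp'; rewrite -E lp => -[E']; move: z_mx; rewrite E' eqxx.
Qed.

(** * Two strands *)

Variable i0 : X.
Hypothesis i0_z : i0 != z.
Hypothesis i0_mx : i0 != mx.

Let w := (i0, mx).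
Let vS := (mx, z).
Let vE := (mx, mx).

(* The strands are exchanged at w.  The first and the last vertex of the tour of
   mx are cut off on strand false. *)
Definition strand_edge (x y : bool * (X * X)) : bool :=
  [&& tour_edge x.2 y.2, y.1 == x.1 (+) (x.2 == w), x != (false, vS) & y != (false, vE)].

Lemma strand_edge_det x y y' : strand_edge x y -> strand_edge x y' -> y = y'.
Proof.
case: y y' => [s v] [s' v'] /and4P[/= e1 /eqP-> _ _] /and4P[/= e2 /eqP-> _ _].
by rewrite (tour_edge_det e1 e2).
Qed.

Fixpoint strand (s : bool) (l : seq (X * X)) : seq (bool * (X * X)) :=
  if l is v :: l' then (s, v) :: strand (s (+) (v == w)) l' else [::].

(** The strand on which a vertex following [l] lies; only the parity of the visits to [w]
    matters. *)
Definition fin s (l : seq (X * X)) := s (+) odd (count_mem w l).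

Lemma size_strand s l : size (strand s l) = size l.
Proof. by elim: l s => //= v l IH s; rewrite IH. Qed.

Lemma strand_cat s l1 l2 : strand s (l1 ++ l2) = strand s l1 ++ strand (fin s l1) l2.
Proof.
elim: l1 s => [|v l1 IH] s /=; first by rewrite /fin addbF.
by rewrite IH /fin /= oddD oddb addbA.
Qed.

Lemma strand_mem s l x : x \in strand s l -> x.2 \in l.
Proof.
elim: l s => //= v l IH s; rewrite !inE => /predU1P[-> |/IH->]; rewrite ?eqxx ?orbT //.
Qed.

(** Wherever the exchanges happen, the two lifts of a list run on opposite strands, so together they
    meet both copies of every vertex. *)
Lemma strand_cover s l v : v \in l -> (s, v) \in strand false l \/ (s, v) \in strand true l.
Proof.
have : forall a, v \in l -> (s, v) \in strand a l \/ (s, v) \in strand (~~ a) l.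
  elim: l => //= u l IH a; rewrite !inE => /predU1P[->|vin].
    by rewrite !xpair_eqE eqxx !andbT; case: (s) a => -[]; rewrite ?eqxx /=; auto.
  by rewrite addNb; have [->|->] := IH (a (+) (u == w)) vin; rewrite !orbT; auto.
by move=> H /(H false).
Qed.

Lemma strand_sorted s l : sorted tour_edge l ->
  (false, vS) \notin strand s l -> (false, vE) \notin strand s l ->
  sorted strand_edge (strand s l).
Proof.
case: l => //= v l; elim: l v s => //= u l IH v s /andP[vu pl].
rewrite !inE !negb_or => /and3P[n1 n2 n3] /and3P[n4 n5 n6].
rewrite IH ?inE ?negb_or ?n2 ?n5 // andbT /strand_edge /= vu eqxx /=.
by rewrite eq_sym n1 eq_sym n5.
Qed.

(** An exchange at the last vertex takes effect only behind it, hence the count over [belast]. *)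
Lemma strand_last s l x y : l != [::] -> last x (strand s l) =
  (s (+) odd (count_mem w (belast (head y l) (behead l))), last y l).
Proof.
case: l => //= v l _; elim: l v s x => [|u l IH] v s x /=; first by rewrite addbF.
by rewrite oddD oddb addbA; exact: IH.
Qed.

Lemma strand_last2 s l x y : l != [::] -> (last x (strand s l)).2 = last y l.
Proof. by move=> ne; rewrite (strand_last _ _ y). Qed.

Lemma strand_next s l x y v : l != [::] -> strand_edge (last x (strand s l)) y ->
  tour_edge (last v l) y.2 /\ y.1 = fin s l.
Proof.
move=> ne; rewrite (strand_last _ _ v) // => /and4P[/= e1 /eqP E _ _]; split=> //.
rewrite E; case: l ne {e1 E} => //= u l _.
by rewrite /fin lastI -cats1 count_cat oddD /= addn0 oddb addbA.
Qed.


Definition pairswap (i : nat) : nat := if odd i then i.-1 else i.+1.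

Lemma pairswapK i : pairswap (pairswap i) = i.
Proof. by rewrite /pairswap; case: i => //= i; case E: (odd i); rewrite /= ?E. Qed.

Lemma pairswap_ne i : pairswap i != i.
Proof. by rewrite /pairswap; case: i => //= i; case: (odd i) => /=; lia. Qed.

Variables (T : finType) (vert : bool * (X * X) -> T) (vert' : T -> bool * (X * X)).
Hypothesis vertK : cancel vert vert'.
Hypothesis vertK' : cancel vert' vert.
Variable e : rel T.
Hypothesis e_strand : forall x y, e (vert x) (vert y) = strand_edge x y.

(** Let [mid] be the tour of [mx] without its two ends. If [w] is on this tour, the lift [U], which
    starts uncut on strand true, arrives on strand false and lacks [vE], while [V] lacks [vS]: both
    have one vertex more than [mid]. Otherwise [U] keeps both ends and [V] neither. The chains are
    listed so that [pairswap] exchanges chains meant to have equal length. *)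
Theorem tour_game :
  [/\ acyclic e, parallel_chains 6 [set: T] (connect e) &
      exists_game (connect e) [set: T] = (w \notin tour mx)].
Proof.
have [p [Ep pp lp]] := tour_path mx.
have Up : uniq (vS :: p) by rewrite -Ep; exact: tour_uniq.
case/lastP: p Ep pp lp Up => [_ _ [E]|mid v Ep pp lp Up]; first by move: z_mx; rewrite E eqxx.
move: lp; rewrite last_rcons => Ev; rewrite {v}Ev -/vE in Ep pp Up.
have [nSm nSE nEm] : [/\ vS \notin mid, vS != vE & vE \notin mid].
  move: Up; rewrite /= mem_rcons inE negb_or rcons_uniq.
  by case/andP=> /andP[-> ->] /andP[-> _].
have wS : (w == vS) = false by rewrite xpair_eqE (negbTE i0_mx).
have wE : (w == vE) = false by rewrite xpair_eqE (negbTE i0_mx).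
have Ew : (w \in tour mx) = (w \in mid).
  by rewrite Ep inE wS mem_rcons inE wE.
(* The tour has no repetitions, so the parity of the visits to [w] tells whether [w] occurs. *)
have cw : odd (count_mem w mid) = (w \in tour mx).
  rewrite Ew count_uniq_mem ?oddb //.
  by move: Up; rewrite /= rcons_uniq => /andP[_ /andP[]].
(* The pair [(mx, i0)] is on the tour and differs from both ends, as [i0] is not a root. *)
have mid_ne : mid != [::].
  have := tour_own mx i0; rewrite Ep inE mem_rcons inE !xpair_eqE eqxx /=.
  by rewrite (negbTE i0_z) (negbTE i0_mx); case: (mid).
have [lz Elz] : exists lz, lz = tour z by exists (tour z).
have [pz [Ez pz1 lz1]] := tour_path z.
have lz_ne : lz != [::] by rewrite Elz Ez.
have lz_last y : last y lz = (z, mx) by rewrite Elz Ez.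
have lz_sorted : sorted tour_edge lz by rewrite Elz Ez.
have nmz b : (mx, b) \notin lz.
  rewrite Elz; apply/negP => /tour_mem[/= E|[c']]; first by move: z_mx; rewrite E eqxx.
  by rewrite /= (negbTE (R_mx _)).
have nzm : (z, mx) \notin tour mx.
  apply/negP => /tour_mem[/= E|[c']]; first by move: z_mx; rewrite E eqxx.
  by rewrite /= (negbTE (R_z _)).
have := pp; rewrite rcons_path => /andP[pm mE].
pose b := w \in tour mx.
pose U := strand true (vS :: if b then mid else rcons mid vE).
pose V := strand false (if b then rcons mid vE else mid).
pose chs' := [:: strand false lz; strand true lz; [:: (false, vS)]; [:: (false, vE)]; U; V].
pose chs := map (map vert) chs'.
have nthE i : nth [::] chs i = map vert (nth [::] chs' i).
  case: (ltnP i 6) => li; first by rewrite (nth_map [::]).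
  by rewrite !nth_default.
pose y0 := (false, vS).
have lastE i : last (vert y0) (nth [::] chs i) = vert (last y0 (nth [::] chs' i)).
  by rewrite nthE last_map.
have strand_vS s l : strand s (vS :: l) = (s, vS) :: strand s l.
  by rewrite -[LHS]/((s, vS) :: strand (s (+) (vS == w)) l) [vS == w]eq_sym wS addbF.
have fin_vS s l : fin s (vS :: l) = fin s l.
  by rewrite /fin -[count_mem w (vS :: l)]/((vS == w) + count_mem w l) [vS == w]eq_sym wS.
have finm s : fin s mid = s (+) b by rewrite /fin cw.
have lastmid : last vS mid \in mid.
  by case: (mid) mid_ne => //= u l _; rewrite mem_last.
have ev u v : e u v = strand_edge (vert' u) (vert' v) by rewrite -e_strand !vertK'.
have strand_rcons s l v : strand s (rcons l v) = rcons (strand s l) (fin s l, v).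
  by rewrite -cats1 strand_cat -cats1.
have e_det : forall x y y', e x y -> e x y' -> y = y'.
  by move=> x y y'; rewrite !ev => /strand_edge_det H /H /(can_inj vertK').
have strand_ne s l : l != [::] -> strand s l != [::] by case: l.
have nst s' s l v : v \notin l -> (s', v) \notin strand s l.
  by apply: contra => /strand_mem.
have ch_sorted i : i < size chs -> sorted e (nth [::] chs i).
  move=> li; rewrite nthE sorted_map (eq_sorted (e' := strand_edge)); last first.
    by move=> x y; rewrite /= e_strand.
  move: i li => [|[|[|[|[|[|]]]]]] // _; rewrite [nth _ _ _]/=.
  - by apply: (strand_sorted lz_sorted); apply: nst; exact: nmz.
  - by apply: (strand_sorted lz_sorted); apply: nst; exact: nmz.
  - rewrite /U; apply: strand_sorted.
    + by rewrite /=; case: ifP => _ //; rewrite rcons_path pm mE.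
    + rewrite strand_vS inE xpair_eqE /=; apply: nst.
      by case: ifP => // _; rewrite mem_rcons inE negb_or nSE.
    + rewrite strand_vS inE xpair_eqE /=.
      case: ifP => Eb; first exact: nst.
      rewrite strand_rcons mem_rcons inE xpair_eqE finm Eb /=.
      exact: nst.
  - rewrite /V; case: ifP => Eb; apply: strand_sorted.
    + exact: path_sorted pp.
    + by apply: nst; rewrite mem_rcons inE negb_or nSE.
    + rewrite strand_rcons mem_rcons inE xpair_eqE finm Eb /=; exact: nst.
    + exact: path_sorted pm.
    + exact: nst.
    + exact: nst.
(* Behind [mid] the tour can only go on to [vE], and on strand false this vertex has no incoming
   edge. *)
have cut_end l s y : l != [::] -> last vS l = last vS mid -> fin s l = false ->
    ~~ strand_edge (last y0 (strand s l)) y.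
  move=> ne El Ef; apply/negP => H; have [e1 y1] := strand_next vS ne H.
  rewrite El in e1; have y2 := tour_edge_det e1 mE.
  case/and4P: H => _ _ _; case: (y) y1 y2 => /= y1 y2 -> ->.
  by rewrite Ef eqxx.
have end_sink c l s y : last vS l = (c, mx) -> l != [::] -> (forall c', ~~ R c c') ->
    ~~ strand_edge (last y0 (strand s l)) y.
  move=> El ne Rc; apply/negP => H; have [e1 _] := strand_next vS ne H.
  by move: e1; rewrite El (negbTE (tour_sink Rc _)).
have ch_sink i : i < size chs -> sink e (last (vert y0) (nth [::] chs i)).
  move=> li v; rewrite lastE ev vertK.
  move: i li => [|[|[|[|[|[|]]]]]] // _; rewrite [nth _ _ _]/=.
  - by apply: (@end_sink z).
  - by apply: (@end_sink z).
  - by rewrite /strand_edge /= eqxx !andbF.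
  - by apply: (@end_sink mx [:: vE] false).
  - rewrite /U; case: ifP => Eb.
      by apply: cut_end => //; rewrite fin_vS finm Eb.
    by apply: (@end_sink mx) => //=; rewrite last_rcons.
  - rewrite /V; case: ifP => Eb.
      by apply: (@end_sink mx) => //; [rewrite last_rcons|case: (mid)].
    by apply: cut_end => //; rewrite finm Eb.
(* The six ends are the two copies of [(z, mx)], the two single vertices, [(true, vE)], and a copy
   of the last vertex of [mid]. *)
have chs_uniq : uniq (map (last y0) chs').
  have neq : [/\ (z, mx) == vS = false, (z, mx) == vE = false,
      (z, mx) == last vS mid = false, vS == last vS mid = false & vE == last vS mid = false].
    split.
    - by rewrite xpair_eqE (negbTE z_mx).
    - by rewrite xpair_eqE (negbTE z_mx).
    - by apply/eqP => E; case/negP: nzm; rewrite E Ep inE mem_rcons inE lastmid !orbT.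
    - by apply/eqP => E; case/negP: nSm; rewrite E.
    - by apply/eqP => E; case/negP: nEm; rewrite E.
  case: neq => n1 n2 n3 n4 n5.
  rewrite -[map _ _]/[:: last y0 (strand false lz); last y0 (strand true lz);
    (false, vS); (false, vE); last y0 U; last y0 V].
  have lzE s : last y0 (strand s lz) =
      (s (+) odd (count_mem w (belast (head vS lz) (behead lz))), (z, mx)).
    by rewrite (strand_last _ _ vS) // lz_last.
  have tl u : (last y0 u).2 = last vS mid -> last y0 u = ((last y0 u).1, last vS mid).
    by case: (last y0 u) => ? ? /= ->.
  have PE (s t : bool) (u v : X * X) : ((s, u) == (t, v)) = (s == t) && (u == v).
    exact: xpair_eqE.
  rewrite !lzE /U /V; case: ifP => Eb.
    have lV : last y0 (strand false (rcons mid vE)) = (true, vE).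
      by rewrite strand_rcons last_rcons finm Eb.
    have /tl -> : (last y0 (strand true (vS :: mid))).2 = last vS mid.
      by rewrite (strand_last2 _ _ vS).
    rewrite lV !cons_uniq !inE !PE n1 n2 n3 n4 n5 !(eq_sym (last vS mid)) n5.
    rewrite (negbTE nSE) !andbF andbT.
    by case: (odd _).
  have lU : last y0 (strand true (vS :: rcons mid vE)) = (true, vE).
    by rewrite strand_vS strand_rcons last_cons last_rcons finm Eb.
  have /tl -> : (last y0 (strand false mid)).2 = last vS mid.
    by rewrite (strand_last2 _ _ vS).
  rewrite lU !cons_uniq !inE !PE n1 n2 n3 n4 n5.
  rewrite (negbTE nSE) !andbF andbT.
  by case: (odd _).
have ch_last i j : i < size chs -> j < size chs ->
    last (vert y0) (nth [::] chs i) = last (vert y0) (nth [::] chs j) -> i = j.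
  move=> li lj; rewrite !lastE => /(can_inj vertK) E; apply/eqP.
  rewrite -(nth_uniq y0 _ _ chs_uniq) ?size_map //.
  by rewrite !(nth_map [::]) // E.
have ch_cover x : exists2 i, i < size chs & x \in nth [::] chs i.
  suff [i li xi] : exists2 i, i < 6 & vert' x \in nth [::] chs' i.
    by exists i => //; rewrite nthE -(vertK' x) map_f.
  case: (vert' x) => s [c a]; case: (tour_cover c a) => vin.
    rewrite -Elz in vin; have [H|H] := strand_cover s vin; first by exists 0.
    by exists 1.
  have vin' := vin; rewrite Ep inE mem_rcons inE in vin'.
  case/predU1P: vin' => [->|/predU1P[->|vm]].
  - case: s; last by exists 2; rewrite // inE.
    by exists 4; rewrite // [nth _ _ _]/= /U strand_vS mem_head.
  - case: s; last by exists 3; rewrite // inE.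
    case Eb: b; [exists 5|exists 4] => //; rewrite [nth _ _ _]/= /U /V Eb ?strand_vS.
      by rewrite strand_rcons mem_rcons inE finm Eb eqxx.
    by rewrite inE strand_rcons mem_rcons inE finm Eb eqxx orbT.
  - have [H|H] := strand_cover s vm; [exists 5|exists 4] => //; rewrite [nth _ _ _]/= /V /U.
      by case: ifP => // _; rewrite strand_rcons mem_rcons inE H orbT.
    rewrite strand_vS inE.
    by case: ifP => // _; rewrite ?strand_rcons ?mem_rcons ?inE H !orbT.
have swap_lt i : i < size chs -> pairswap i < size chs.
  by move: i => [|[|[|[|[|[|]]]]]].
split.
- exact: (chains_acyclic e_det ch_sorted ch_sink ch_last ch_cover).
- exact: (chains_parallel e_det ch_sorted ch_sink ch_last ch_cover).
- case Eb: (w \in tour mx) => /=; rewrite -/b in Eb.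
    apply/negbTE; apply: (chains_lose e_det ch_sorted ch_sink ch_last ch_cover
      pairswapK pairswap_ne swap_lt) => i.
    rewrite !nthE !size_map.
    by move: i => [|[|[|[|[|[|]]]]]] // _; rewrite /= ?size_strand // Eb ?size_rcons.
  (* Chain 4 is [U], here longer by two than its partner [V]. *)
  apply: (chains_win e_det ch_sorted ch_sink ch_last ch_cover
      pairswapK pairswap_ne swap_lt (i0 := 4)) => //.
    by rewrite !nthE !size_map /= /U /V Eb !size_strand /= size_rcons.
  move=> i; rewrite !nthE !size_map.
  by move: i => [|[|[|[|[|[|]]]]]] // _ _ _; rewrite /= ?size_strand.
Qed.

End Tour.

(** * Binary counters, least significant bit first *)

Fixpoint bsucc (a b : seq bool) : bool :=
  match a, b with
  | x :: a', y :: b' => if x then ~~ y && bsucc a' b' else y && (a' == b')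
  | _, _ => false
  end.

Fixpoint bval (a : seq bool) : nat := if a is x :: a' then x + 2 * bval a' else 0.

Lemma bsucc_val a b : bsucc a b -> bval b = (bval a).+1.
Proof.
elim: a b => [|x a IH] [|y b] //=; case: x => /andP[].
  by case: y => // _ /IH->; lia.
by case: y => // _ /eqP->; lia.
Qed.

Lemma bval_lt a : bval a < 2 ^ size a.
Proof. by elim: a => //= x a IH; rewrite expnS; case: x; lia. Qed.

Lemma bsucc_size a b : bsucc a b -> size a = size b.
Proof.
elim: a b => [|x a IH] [|y b] //=; case: x => /andP[_].
  by move/IH->.
by move/eqP->.
Qed.

Lemma bsucc_det a b b' : bsucc a b -> bsucc a b' -> b = b'.
Proof.
elim: a b b' => [|x a IH] [|y b] [|y' b'] //=; case: x; case: y => //; case: y' => //=.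
  by move=> /IH H /H ->.
by move=> /eqP-> /eqP->.
Qed.

Lemma bsucc_max a b : all id a -> bsucc a b = false.
Proof. by elim: a b => [|x a IH] [|y b] //= /andP[-> /IH->]; rewrite andbF. Qed.

Lemma all_id_nseq a : all id a -> a = nseq (size a) true.
Proof. by elim: a => //= x a IH /andP[-> /IH {1}->]. Qed.

Lemma all_neg_nseq a : all negb a -> a = nseq (size a) false.
Proof. by elim: a => //= x a IH /andP[/negbTE-> /IH {1}->]. Qed.

Lemma bsucc_ex a : ~~ all id a -> exists b, bsucc a b.
Proof.
elim: a => //= -[] a IH /=; last by exists (true :: a); rewrite eqxx.
by case/IH=> b H; exists (false :: b).
Qed.

Lemma bsucc_path s a (s' := flatten [seq [:: false :: b; true :: b] | b <- s]) :
  path bsucc a s -> path bsucc (false :: a) ((true :: a) :: s').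
Proof.
rewrite {}/s'; elim: s a => [|b s IH] a /=; first by rewrite eqxx.
by case/andP=> -> /IH /= ->; rewrite eqxx.
Qed.

(** The counting sequence without its initial zero string, as [path] wants it. With the lowest bit
    in front, each entry of the shorter counter yields two consecutive entries. *)
Fixpoint counter_tail (m : nat) : seq (seq bool) :=
  if m is m'.+1 then
    (true :: nseq m' false) :: flatten [seq [:: false :: b; true :: b] | b <- counter_tail m']
  else [::].

Lemma counter_path m : path bsucc (nseq m false) (counter_tail m).
Proof. by elim: m => //= m IH; exact: bsucc_path IH. Qed.

Lemma counter_last m : last (nseq m false) (counter_tail m) = nseq m true.
Proof.
elim: m => //= m; elim/last_ind: (counter_tail m) => [|s b _] /=; first by move=> ->.
by rewrite last_rcons map_rcons flatten_rcons last_cat /= => ->.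
Qed.

Lemma counter_all b m : size b = m -> b \in nseq m false :: counter_tail m.
Proof.
elim: b m => [|x b IH] [|m] //= [/IH]; rewrite !inE.
case/predU1P=> [->|bin]; first by case: x; rewrite eqxx ?orbT.
rewrite -[_ == _]/((x :: b) == false :: nseq m false).
suff -> : (x :: b) \in flatten [seq [:: false :: b; true :: b] | b <- counter_tail m].
  by rewrite !orbT.
apply/flattenP; exists [:: false :: b; true :: b]; first by apply/mapP; exists b.
by case: x; rewrite !inE eqxx ?orbT.
Qed.

Lemma size_counter m : size (counter_tail m) = (2 ^ m).-1.
Proof.
elim: m => //= m IH.
have -> : size (flatten [seq [:: false :: b; true :: b] | b <- counter_tail m]) =
   2 * size (counter_tail m).
  by elim: (counter_tail m) => //= b s ->; lia.
have : 0 < 2 ^ m by rewrite expn_gt0.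
by rewrite IH expnS; lia.
Qed.

Lemma counter_sizes m b : b \in counter_tail m -> size b = m.
Proof.
elim: m b => //= m IH b; rewrite inE => /predU1P[->|]; first by rewrite /= size_nseq.
case/flattenP=> l /mapP[c /IH sc ->]; rewrite !inE.
by case/orP=> /eqP->; rewrite /= sc.
Qed.

(* A one-way automaton for bsucc: Some true while the carry propagates, Some false
   once it has been absorbed. *)
Definition carry_step (st : option bool) (xy : bool * bool) : option bool :=
  match st with
  | Some true => if xy.1 then (if xy.2 then None else Some true)
                 else (if xy.2 then Some false else None)
  | Some false => if xy.1 == xy.2 then st else None
  | None => None
  end.

Lemma carry_None s : foldl carry_step None s = None. Proof. by elim: s. Qed.

Lemma carry_eq a b : size a = size b ->
  (foldl carry_step (Some false) (zip a b) == Some false) = (a == b).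
Proof.
elim: a b => [|x a IH] [|y b] //= [/IH E]; rewrite eqseq_cons.
by case: (x == y) => //=; rewrite carry_None.
Qed.

Lemma carry_succ a b : size a = size b ->
  (foldl carry_step (Some true) (zip a b) == Some false) = bsucc a b.
Proof.
elim: a b => [|x a IH] [|y b] //= [E]; have := carry_eq E; have := IH _ E.
by case: x; case: y => //= E1 E2; rewrite ?carry_None.
Qed.

Lemma carry_blocks (T : Type) (f g : T -> seq bool) cs :
  all (fun c => size (f c) == size (g c)) cs ->
  (foldl (fun st c => foldl carry_step st (zip (f c) (g c))) (Some true) cs == Some false) =
  bsucc (flatten (map f cs)) (flatten (map g cs)).
Proof.
move=> al; have [E sz] : (forall st,
    foldl (fun st c => foldl carry_step st (zip (f c) (g c))) st cs =
    foldl carry_step st (zip (flatten (map f cs)) (flatten (map g cs)))) /\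
    size (flatten (map f cs)) = size (flatten (map g cs)).
  elim: cs al => //= c cs IH /andP[/eqP s /IH[E sz]].
  by split=> [st|]; rewrite ?zip_cat ?foldl_cat ?E // !size_cat s sz.
by rewrite E carry_succ.
Qed.

(** * Blocks *)

Fixpoint blocks (q S : nat) (c : seq bool) : seq (seq bool) :=
  if S is S'.+1 then take q c :: blocks q S' (drop q c) else [::].

Lemma size_blocks q S c : size (blocks q S c) = S.
Proof. by elim: S c => //= S IH c; rewrite IH. Qed.

Lemma blocks_sizes q S c : size c = q * S -> all (fun b => size b == q) (blocks q S c).
Proof.
elim: S c => //= S IH c; rewrite mulnS => E; rewrite IH ?size_drop ?E ?addKn // andbT.
by rewrite size_take E; case: ltnP => //; lia.
Qed.

Lemma flatten_blocks q S c : size c = q * S -> flatten (blocks q S c) = c.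
Proof.
elim: S c => [|S IH] c; first by rewrite muln0 => /size0nil.
by rewrite mulnS /= => E; rewrite IH ?cat_take_drop // size_drop E addKn.
Qed.

Lemma blocks_flatten q bs : all (fun b => size b == q) bs ->
  blocks q (size bs) (flatten bs) = bs.
Proof.
elim: bs => //= b bs IH /andP[/eqP E al].
by rewrite take_size_cat // drop_size_cat // IH.
Qed.

(** The hypothesis pairs each of the four projections with its track, so that one induction serves
    all of them. *)
Lemma map_cols (f : col -> seq bool) q gs C A C' A' c :
  (forall g x1 x2 x3 x4, f (Col g x1 x2 x3 x4) = x1) /\ c = C \/
  (forall g x1 x2 x3 x4, f (Col g x1 x2 x3 x4) = x2) /\ c = A \/
  (forall g x1 x2 x3 x4, f (Col g x1 x2 x3 x4) = x3) /\ c = C' \/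
  (forall g x1 x2 x3 x4, f (Col g x1 x2 x3 x4) = x4) /\ c = A' ->
  map f (cols q gs C A C' A') = blocks q (size gs) c.
Proof.
by case=> [|[|[]]] [E ->]; elim: gs C A C' A' => //= g gs IH C A C' A'; rewrite E IH.
Qed.

(** * Turing machines as cellular automata *)

Section Automaton.

Variable M : TM.

(* Some (None, a) is a plain cell, Some (Some q, a) the scanned cell and None the
   marker that wakes up the head on its right in the first step. *)
Definition cell : finType := option (option (tm_state M) * option bool)%type.

Definition plain (a : option bool) : cell := Some (None, a).
Definition head_at (q : tm_state M) (a : option bool) : cell := Some (Some q, a).
Definition blank : cell := plain None.

(** The rule is total: arrays with several heads, which occur among arbitrary bit strings, also get
    a definite successor, the left neighbour taking precedence. A halted head stays, so that halted
    configurations are fixed points. *)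
Definition ca_rule (l c r : cell) : cell :=
  match c with
  | None => blank
  | Some (Some q, a) =>
      if tm_halt M q then c
      else let: (q', b, m) := tm_delta M q a in
        if m is MStay then head_at q' b else plain b
  | Some (None, a) =>
      match l, r with
      | None, _ => head_at ord0 a
      | Some (Some q, a'), _ =>
          if tm_halt M q then c
          else let: (q', _, m) := tm_delta M q a' in
            if m is MRight then head_at q' a else c
      | _, Some (Some q, a') =>
          if tm_halt M q then c
          else let: (q', _, m) := tm_delta M q a' in
            if m is MLeft then head_at q' a else c
      | _, _ => c
      end
  end.

Fixpoint ca_step_from (p : cell) (s : seq cell) : seq cell :=
  if s is x :: s' then ca_rule p x (head blank s') :: ca_step_from x s' else [::].

Definition ca_step := ca_step_from blank.

Lemma size_ca_step p s : size (ca_step_from p s) = size s.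
Proof. by elim: s p => //= x s IH p; rewrite IH. Qed.

Lemma ca_step_cat p s x t :
  ca_step_from p (s ++ x :: t) =
  take (size s) (ca_step_from p (rcons s x)) ++
  ca_step_from (last p s) (x :: t).
Proof.
elim: s p => [|y s IH] p //=.
by rewrite IH; case: s {IH} => [|z s] //=.
Qed.

Lemma ca_step_plain p l : ca_step_from (plain p) (map plain l) = map plain l.
Proof. by elim: l p => [|b l IH] p //=; rewrite IH; case: (l). Qed.

Definition cs (c : config (tm_state M)) : seq cell :=
  rev (map plain (c_left c)) ++ head_at (c_state c) (c_cur c) :: map plain (c_right c).

Lemma ca_step_left p l a h t : ca_step_from (plain p) (rev (map plain (a :: l)) ++ h :: t) =
  rev (map plain l) ++ ca_step_from (last (plain p) (rev (map plain l))) (plain a :: h :: t).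
Proof.
rewrite map_cons rev_cons cat_rcons -map_rev ca_step_cat; congr (_ ++ _).
by rewrite -map_rcons ca_step_plain map_rcons -cats1 take_size_cat // size_map.
Qed.

(** The array cannot grow; nonempty sides guarantee a cell to move to. *)
Lemma ca_step_config c : c_left c != [::] -> c_right c != [::] ->
  ca_step (cs c) = cs (step M c).
Proof.
case: c => q [|l0 l] a [|r0 r] // _ _; rewrite /ca_step /cs [c_left _]/= [c_state _]/=
  [c_cur _]/= [c_right _]/= ca_step_left.
have [p ->] : exists p, last blank (rev (map plain l)) = plain p.
  rewrite -map_rev; case/lastP: (rev l) => [|s x]; first by exists None.
  by exists x; rewrite map_rcons last_rcons.
rewrite [ca_step_from _ _]/= ca_step_plain; rewrite {2}/step; case Eh: (tm_halt M q).
  by rewrite /= /ca_rule /= Eh rev_cons cat_rcons.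
case Ed: (tm_delta M q a) => [[q' b] m].
case: m Ed => Ed; rewrite /ca_rule /= Eh Ed /= ?rev_cons ?cat_rcons //.
Qed.

Definition is_acc (x : cell) : bool := if x is Some (Some q, _) then tm_accept M q else false.

Lemma has_acc_cs c : has is_acc (cs c) = tm_accept M (c_state c).
Proof.
have N s : has is_acc (map plain s) = false by rewrite has_map; elim: s.
by rewrite has_cat has_rev N /= N orbF.
Qed.

Definition padc d e (c : config (tm_state M)) :=
  Cfg (c_state c) (c_left c ++ nseq d None) (c_cur c) (c_right c ++ nseq e None).

(** A move into a fresh cell consumes one padding blank while [space_of] grows by one. The sums
    therefore never decrease, and a space bound keeps both paddings positive. *)
Lemma step_padc d e c : 0 < d -> 0 < e -> exists d' e',
  [/\ step M (padc d e c) = padc d' e' (step M c),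
      d + space_of c <= d' + space_of (step M c) &
      e + space_of c <= e' + space_of (step M c)].
Proof.
case: c d e => q l a r [|d] [|e] // _ _; rewrite /step /padc /space_of /=.
case: (tm_halt M q); first by exists d.+1, e.+1.
case: (tm_delta M q a) => [[q' b] []].
- by case: l => [|h l] /=; [exists d, e.+1|exists d.+1, e.+1]; split=> //=; lia.
- by case: r => [|h r] /=; [exists d.+1, e|exists d.+1, e.+1]; split=> //=; lia.
- by exists d.+1, e.+1.
Qed.

Variable B : nat.

(** Thanks to the marker each initial cell depends on a single letter of the padded input; the first
    scanned cell is not singled out, and the empty word is no exception. *)
Definition start_conf (x : seq bool) : seq cell :=
  nseq B blank ++ None :: map (fun b => plain (Some b)) x ++ nseq B blank.

Lemma ca_step_start x : 0 < B -> exists e,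
  [/\ ca_step (start_conf x) = cs (padc B.+1 e (init M x)) &
      B <= e + space_of (init M x)].
Proof.
rewrite /start_conf; case: B => // B' _.
pose s := map Some x ++ nseq B'.+1 None.
have Es : map (fun b => plain (Some b)) x ++ nseq B'.+1 blank = map plain s.
  by rewrite map_cat -map_comp map_nseq.
have Er : rev (map plain (nseq B'.+1 None)) = nseq B'.+1 blank.
  by rewrite map_nseq rev_nseq.
have step a r : s = a :: r -> ca_step (nseq B'.+1 blank ++ None :: map plain s) =
    cs (Cfg (ord0 : tm_state M) (nseq B'.+2 None) a r).
  move=> ->; rewrite -Er /ca_step ca_step_left -map_rev rev_nseq map_nseq.
  have -> : last (plain None) (nseq B' (plain None)) = plain None by elim: (B').
  rewrite /= ca_step_plain /cs /= !map_nseq !rev_cons rev_nseq !cat_rcons.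
  by [].
rewrite Es; case: x @s Es step => [|b x] s Es step.
  exists B'; rewrite (step None (nseq B' None)) //; split=> //.
  by rewrite /space_of /=; lia.
exists B'.+1; rewrite (step (Some b) (map Some x ++ nseq B'.+1 None)) //; split=> //.
by rewrite /space_of /=; lia.
Qed.

Lemma size_start_conf x : size (start_conf x) = size x + (1 + 2 * B).
Proof. by rewrite size_cat /= size_cat size_map !size_nseq; lia. Qed.

(** The automaton needs one step more than the machine because its first step only replaces the
    marker by a head on its right. *)
Lemma run_sim x t : (forall t, space_of (run M x t) + 2 <= B) -> exists d e,
  iter t.+1 ca_step (start_conf x) = cs (padc d e (run M x t)) /\
  (B < d + space_of (run M x t)) /\ (B <= e + space_of (run M x t)).
Proof.
move=> sp; elim: t => [|t [d [e [E [ld le]]]]].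
  have [|e [E le]] := @ca_step_start x; first by have := sp 0; lia.
  by exists B.+1, e; split=> //; split=> //; rewrite /run /= /space_of; lia.
have s1 := sp t; have [d' [e' [Es l1 l2]]] := @step_padc d e (run M x t) ltac:(lia) ltac:(lia).
exists d', e'; split; last by rewrite /run iterS -/(run M x t); lia.
rewrite iterS E ca_step_config.
- by rewrite Es.
- by rewrite /padc /=; case: (c_left _) => //=; case: (d) ld s1 => //=; lia.
- by rewrite /padc /=; case: (c_right _) => //=; case: (e) le s1 => //=; lia.
Qed.

Lemma size_iter_ca t s : size (iter t ca_step s) = size s.
Proof. by elim: t => //= t IH; rewrite size_ca_step. Qed.

(* By the pigeonhole principle a run that halts at all does so within
   #|cell| ^ size steps, and a halted configuration is a fixed point. *)
Lemma ca_decides x t N : (forall t, space_of (run M x t) + 2 <= B) ->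
  halted (run M x t) -> #|cell| ^ size (start_conf x) <= N ->
  has is_acc (iter N.-1 ca_step (start_conf x)) = tm_accept M (c_state (run M x t)).
Proof.
move=> sp Ht leN.
have [d [e [E [ld le]]]] := run_sim t sp.
set y := cs _ in E.
have fixy : ca_step y = y.
  have s1 := sp t; rewrite /y ca_step_config.
  - congr cs; rewrite /step /padc; move: Ht; rewrite /halted.
    by case: (run M x t) => q l a r /= ->.
  - by rewrite /padc /=; case: (c_left _) => //=; case: (d) ld s1 => //=; lia.
  - by rewrite /padc /=; case: (c_right _) => //=; case: (e) le s1 => //=; lia.
pose n := size (start_conf x).
pose G (s : n.-tuple cell) : n.-tuple cell :=
  Tuple (introT eqP (etrans (size_ca_step blank s) (size_tuple s))).
pose s0 : n.-tuple cell := in_tuple (start_conf x).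
have iterG j : val (iter j G s0) = iter j ca_step (start_conf x).
  by elim: j => //= j ->.
have fc := fconnect_iter G t.+1 s0.
have lt := findex_max fc.
have Ej := iter_findex fc.
set j := findex _ _ _ in lt Ej.
have Ej' : iter j ca_step (start_conf x) = y by rewrite -iterG Ej iterG E.
have lej : j <= N.-1.
  have : order G s0 <= #|cell| ^ n by rewrite -card_tuple max_card.
  by move: lt leN; rewrite /n; lia.
have -> : iter N.-1 ca_step (start_conf x) = y.
  rewrite -(subnK lej) iterD Ej'; elim: (_ - _) => //= i ->; exact: fixy.
by rewrite has_acc_cs.
Qed.

End Automaton.

(** * The forest of clocked configurations *)

Section Parent.

Variable M : TM.
Local Notation cell := (cell M).

Definition kk := #|cell|.
Definition code_cell (g : cell) : seq bool := onehot g.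
(** Total, with default [blank M]: every bit string has a configuration, so every string other than
    the roots has a parent. *)
Definition cell_of (b : seq bool) : cell := unhot (blank M) (take kk b).

Lemma size_code_cell g : size (code_cell g) = kk.
Proof. exact: size_onehot. Qed.

Lemma code_cellK g t : cell_of (code_cell g ++ t) = g.
Proof. by rewrite /cell_of take_size_cat ?size_code_cell // onehotK. Qed.

Lemma code_not_false g : ~~ all negb (code_cell g).
Proof.
rewrite -has_predC; apply/hasP; exists (g == g); last by rewrite /= eqxx.
by apply/mapP; exists g; rewrite ?mem_enum.
Qed.

Lemma code_not_true g : ~~ all id (code_cell g).
Proof.
have [h ne] : exists h : cell, h != g.
  by case: g => [g|]; [exists None|exists (blank M)].
rewrite -has_predC; apply/hasP; exists (h == g); last by rewrite /= ne.
by apply/mapP; exists h; rewrite ?mem_enum.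
Qed.

(* Checks a block of the successor against the rule one cell late: the state
   remembers two cells and the value announced for the second one. *)
Definition check_state := option (option (cell * cell * cell)).

Definition check_step (st : check_state) (p : seq bool * seq bool) : check_state :=
  if code_cell (cell_of p.2) != take kk p.2 then None
  else match st with
  | None => None
  | Some None => Some (Some (blank M, cell_of p.1, cell_of p.2))
  | Some (Some (l, c, h)) =>
      if ca_rule l c (cell_of p.1) == h then Some (Some (c, cell_of p.1, cell_of p.2))
      else None
  end.

Definition check_end (st : check_state) : bool :=
  match st with
  | None => false
  | Some None => true
  | Some (Some (l, c, h)) => ca_rule l c (blank M) == h
  end.

Definition ca_check (ps : seq (seq bool * seq bool)) : bool :=
  check_end (foldl check_step (Some None) ps).

Lemma check_None ps : foldl check_step None ps = None.
Proof. by elim: ps => //= p ps IH; rewrite {2}/check_step if_same. Qed.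

Lemma code_cell_inj : injective code_cell.
Proof. by move=> g h E; rewrite -(code_cellK g [::]) E code_cellK. Qed.

(** On the side of the successor the codes themselves are compared, not the decoded cells; otherwise
    several strings could be parents of the same one. *)
Lemma ca_checkP ps : ca_check ps =
  ([seq take kk p.2 | p <- ps] == map code_cell (ca_step [seq cell_of p.1 | p <- ps])).
Proof.
rewrite /ca_check /ca_step.
have G qs l c h : check_end (foldl check_step (Some (Some (l, c, h))) qs) =
  (code_cell h :: [seq take kk p.2 | p <- qs] ==
     map code_cell (ca_step_from l (c :: [seq cell_of p.1 | p <- qs]))).
  elim: qs l c h => [|p qs IH] l c h /=.
    by rewrite eqseq_cons andbT (inj_eq code_cell_inj) eq_sym.
  rewrite /check_step -/check_step eqseq_cons (inj_eq code_cell_inj) [h == _]eq_sym.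
  case: (code_cell (cell_of p.2) =P take kk p.2) => [E|ne] /=.
    case: eqP => [_|_] /=; last by rewrite check_None.
    by rewrite IH E.
  rewrite check_None; apply/esym/andP => -[_ /eqP[E _]]; apply: ne.
  by rewrite E /cell_of E onehotK.
case: ps => [|p ps] //; rewrite [foldl _ _ _]/= /check_step.
case: (code_cell (cell_of p.2) =P take kk p.2) => [E|ne] /=.
  by rewrite G E.
rewrite -/check_step check_None; apply/esym/eqP => -[E _]; apply: ne.
by rewrite E /cell_of E onehotK.
Qed.

Definition time_check (ps : seq (seq bool * seq bool)) : bool :=
  foldl (fun st p => foldl carry_step st (zip (drop kk p.1) (drop kk p.2))) (Some true) ps
  == Some false.

Definition parent_check (ps : seq (seq bool * seq bool)) : bool :=
  [&& ~~ all (fun p => all id p.1) ps, ~~ all (fun p => all negb p.1) ps &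
   ca_check ps && time_check ps ||
   all (fun p => all id (drop kk p.1)) ps &&
   (if has (fun p => is_acc (cell_of p.1)) ps then all (fun p => all negb p.2) ps
    else all (fun p => all id p.2) ps)].

Variable S : nat.
Local Notation q := (2 * kk).

Definition conf (c : seq bool) : seq cell := map cell_of (blocks q S c).
(** Each block carries [kk] clock bits besides the code of its cell. The clock thus takes
    [2 ^ (kk * S)] values, at least as many as the [kk ^ S] cell arrays, and it lies spread over the
    blocks, where a one-way automaton can compare it. *)
Definition time (c : seq bool) : seq bool := flatten (map (drop kk) (blocks q S c)).
Definition parent (a c : seq bool) := parent_check (zip (blocks q S a) (blocks q S c)).

Lemma all_flat (p : pred bool) bs : all (all p) bs = all p (flatten bs).
Proof. by elim: bs => //= b bs ->; rewrite all_cat. Qed.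

Lemma zip_fst (T : Type) (f : seq bool -> T) (bs cs : seq (seq bool)) :
  size bs = size cs -> [seq f p.1 | p <- zip bs cs] = map f bs.
Proof. by elim: bs cs => [|b bs IH] [|c cs] //= [/IH->]. Qed.

Lemma zip_snd (T : Type) (f : seq bool -> T) (bs cs : seq (seq bool)) :
  size bs = size cs -> [seq f p.2 | p <- zip bs cs] = map f cs.
Proof. by elim: bs cs => [|b bs IH] [|c cs] //= [/IH->]. Qed.

Lemma parentE a c : size a = q * S -> size c = q * S -> parent a c =
  [&& ~~ all id a, ~~ all negb a &
    ([seq take kk b | b <- blocks q S c] == map code_cell (ca_step (conf a))) &&
      bsucc (time a) (time c) ||
    all id (time a) && (if has (@is_acc M) (conf a) then all negb c else all id c)].
Proof.
move=> sa sc; rewrite /parent /parent_check ca_checkP.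
have sz : size (blocks q S a) = size (blocks q S c) by rewrite !size_blocks.
have A1 (p : pred (seq bool)) : all (fun x => p x.1) (zip (blocks q S a) (blocks q S c)) =
    all p (blocks q S a).
  by rewrite -[LHS]/(all (preim (fun x => p x.1) id) _) -all_map (zip_fst p sz) all_map.
have A2 (p : pred (seq bool)) : all (fun x => p x.2) (zip (blocks q S a) (blocks q S c)) =
    all p (blocks q S c).
  by rewrite -[LHS]/(all (preim (fun x => p x.2) id) _) -all_map (zip_snd p sz) all_map.
rewrite (A1 (all id)) (A1 (all negb)) (A1 (fun b => all id (drop kk b))).
rewrite (A2 (all id)) (A2 (all negb)) !all_flat !flatten_blocks //.
rewrite (zip_fst cell_of sz) (zip_snd (take kk) sz).
have -> : has (fun p => is_acc (cell_of p.1)) (zip (blocks q S a) (blocks q S c)) =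
    has (@is_acc M) (conf a).
  by rewrite /conf -(zip_fst cell_of sz) has_map.
have -> : all (fun b => all id (drop kk b)) (blocks q S a) = all id (time a).
  by rewrite /time -all_flat all_map.
suff -> : time_check (zip (blocks q S a) (blocks q S c)) = bsucc (time a) (time c) by [].
have sb := blocks_sizes sa; have sd := blocks_sizes sc.
rewrite /time_check carry_blocks.
  by rewrite (zip_fst (drop kk) sz) (zip_snd (drop kk) sz).
elim: (blocks q S a) (blocks q S c) sz sb sd => [|b bs IH] [|d ds] //=.
case=> /IH{}IH /andP[/eqP sb /IH{}IH] /andP[/eqP sd /IH ->].
by rewrite !size_drop sb sd eqxx.
Qed.

Fixpoint node_blocks (gs : seq cell) (t : seq bool) : seq (seq bool) :=
  if gs is g :: gs' then (code_cell g ++ take kk t) :: node_blocks gs' (drop kk t) else [::].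

Definition node gs t := flatten (node_blocks gs t).

Lemma node_blocks_ok gs t : size t = kk * size gs ->
  [/\ all (fun b => size b == q) (node_blocks gs t), size (node_blocks gs t) = size gs,
     map (take kk) (node_blocks gs t) = map code_cell gs,
     map cell_of (node_blocks gs t) = gs &
     flatten (map (drop kk) (node_blocks gs t)) = t].
Proof.
elim: gs t => [|g gs IH] t /=; first by rewrite muln0 => /size0nil->.
rewrite mulnS => E; have sd : size (drop kk t) = kk * size gs by rewrite size_drop E addKn.
have [-> -> -> -> ->] := IH _ sd.
have st : size (take kk t) = kk by rewrite size_take E; case: ltnP => //; lia.
rewrite take_size_cat ?size_code_cell // drop_size_cat ?size_code_cell // code_cellK cat_take_drop.
by rewrite size_cat size_code_cell st mul2n addnn eqxx.
Qed.

Lemma blocks_node gs t : size gs = S -> size t = kk * S ->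
  blocks q S (node gs t) = node_blocks gs t.
Proof.
by move=> sg st; have [|al sz _ _ _] := @node_blocks_ok gs t;
  rewrite ?sg // -[in LHS]sg -sz blocks_flatten.
Qed.

Lemma size_flat_blocks n (bs : seq (seq bool)) : all (fun b => size b == n) bs ->
  size (flatten bs) = n * size bs.
Proof.
elim: bs => [|b bs IH] /=; first by rewrite muln0.
by case/andP=> /eqP E /IH; rewrite size_cat E mulnS => ->.
Qed.

Lemma size_node gs t : size gs = S -> size t = kk * S -> size (node gs t) = q * S.
Proof.
move=> sg st; have [|al sz _ _ _] := @node_blocks_ok gs t; first by rewrite sg.
by rewrite (size_flat_blocks al) sz sg.
Qed.

Lemma conf_node gs t : size gs = S -> size t = kk * S -> conf (node gs t) = gs.
Proof.
move=> sg st; rewrite /conf blocks_node //.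
by have [|_ _ _ -> _] := @node_blocks_ok gs t; rewrite ?sg.
Qed.

Lemma time_node gs t : size gs = S -> size t = kk * S -> time (node gs t) = t.
Proof.
move=> sg st; rewrite /time blocks_node //.
by have [|_ _ _ _ ->] := @node_blocks_ok gs t; rewrite ?sg.
Qed.

Hypothesis S_gt0 : 0 < S.

Lemma node_not_root gs t : size gs = S -> ~~ all id (node gs t) /\ ~~ all negb (node gs t).
Proof.
case: gs => [|g gs] sg; first by move: S_gt0; rewrite -sg.
rewrite /node /= !all_cat !negb_and.
by rewrite code_not_true code_not_false.
Qed.

Lemma size_conf c : size (conf c) = S.
Proof. by rewrite size_map size_blocks. Qed.

Lemma drop_sizes c : size c = q * S ->
  all (fun b => size b == kk) (map (drop kk) (blocks q S c)).
Proof.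
move=> sc; rewrite all_map; apply: sub_all (blocks_sizes sc) => b /eqP E /=.
by rewrite size_drop E mul2n -addnn addnK.
Qed.

Lemma size_time c : size c = q * S -> size (time c) = kk * S.
Proof.
by move=> sc; rewrite (size_flat_blocks (drop_sizes sc)) size_map size_blocks.
Qed.

(** A full clock has no successor, so the clock of [a] decides which case applies. Either both
    halves of every block of the parent are determined, or the parent is the root selected by
    acceptance. *)
Lemma parent_det a c c' : size a = q * S -> size c = q * S -> size c' = q * S ->
  parent a c -> parent a c' -> c = c'.
Proof.
move=> sa sc sc'; rewrite !parentE // => /and3P[_ _ H] /and3P[_ _ H'].
case/orP: H => /andP[].
  move=> /eqP E1 E2; case/orP: H' => /andP[]; last by move=> al; rewrite bsucc_max in E2.
  move=> /eqP E1' E2'; have Et := bsucc_det E2 E2'.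
  rewrite -(flatten_blocks sc) -(flatten_blocks sc').
  have Ed : map (drop kk) (blocks q S c) = map (drop kk) (blocks q S c').
    rewrite -(blocks_flatten (drop_sizes sc)) -(blocks_flatten (drop_sizes sc')).
    by rewrite !size_map !size_blocks -/(time c) -/(time c') Et.
  have Ek : map (take kk) (blocks q S c) = map (take kk) (blocks q S c') by rewrite E1 E1'.
  congr flatten.
  elim: (blocks q S c) (blocks q S c') Ed Ek => [|b bs IH] [|b' bs'] //=.
  by case=> Ed /IH H [Et' /H ->]; rewrite -(cat_take_drop kk b) Ed Et' cat_take_drop.
move=> al; case/orP: H' => /andP[].
  by move=> _; rewrite bsucc_max.
move=> _; case: ifP => _.
  by move=> /all_neg_nseq-> /all_neg_nseq->; rewrite sc sc'.
by move=> /all_id_nseq-> /all_id_nseq->; rewrite sc sc'.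
Qed.

Lemma parent_next gs t t' : size gs = S -> size t = kk * S -> bsucc t t' ->
  parent (node gs t) (node (ca_step gs) t').
Proof.
move=> sg st tt'; have st' : size t' = kk * S by rewrite -(bsucc_size tt').
have sg' : size (ca_step gs) = S by rewrite size_ca_step.
have [n1 n2] := node_not_root t sg.
rewrite parentE ?size_node // n1 n2 /= conf_node // !time_node // tt' andbT.
rewrite blocks_node //; have [|_ _ -> _ _] := @node_blocks_ok (ca_step gs) t'.
  by rewrite sg'.
by rewrite eqxx.
Qed.

Lemma parent_last gs t c : size gs = S -> size t = kk * S -> all id t -> size c = q * S ->
  parent (node gs t) c = if has (@is_acc M) gs then all negb c else all id c.
Proof.
move=> sg st al sc; have [n1 n2] := node_not_root t sg.
by rewrite parentE ?size_node // n1 n2 /= conf_node // !time_node // bsucc_max // andbF al.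
Qed.

Lemma parent_root a c : all id a || all negb a -> size a = q * S -> size c = q * S ->
  parent a c = false.
Proof. by move=> H sa sc; rewrite parentE //; case/orP: H => ->; rewrite ?andbF. Qed.

Lemma parent_total a : size a = q * S -> ~~ all id a -> ~~ all negb a ->
  exists2 c, size c = q * S & parent a c.
Proof.
move=> sa n1 n2; case Et: (all id (time a)).
  pose v := if has (@is_acc M) (conf a) then false else true.
  exists (nseq (q * S) v); first by rewrite size_nseq.
  rewrite parentE ?size_nseq // n1 n2 /= Et; apply/orP; right.
  by rewrite /v; case: ifP => E; rewrite /= all_nseq E /= orbT.
have [t' tt'] := bsucc_ex (negbT Et).
have st' : size t' = kk * S by rewrite -(bsucc_size tt') size_time.
have sg : size (ca_step (conf a)) = S by rewrite size_ca_step size_conf.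
exists (node (ca_step (conf a)) t'); first exact: size_node.
rewrite parentE ?size_node // n1 n2 /= time_node // tt' andbT.
rewrite blocks_node //; have [|_ _ -> _ _] := @node_blocks_ok (ca_step (conf a)) t'.
  by rewrite sg.
by rewrite eqxx.
Qed.

(** The clock increases along parents, and the roots are placed above all its values. *)
Definition parent_rank c := if all id c || all negb c then 2 ^ (kk * S) else bval (time c).

Lemma parent_rank_lt a c : size a = q * S -> size c = q * S -> parent a c ->
  parent_rank a < parent_rank c.
Proof.
move=> sa sc; rewrite parentE // /parent_rank => /and3P[/negbTE-> /negbTE-> /=].
have lt : bval (time a) < 2 ^ (kk * S) by rewrite -(size_time sa) bval_lt.
case/orP=> /andP[_]; last by case: ifP => _ ->; rewrite ?orbT.
by move/bsucc_val => ->; case: ifP.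
Qed.

Fixpoint history (gs : seq cell) (ts : seq (seq bool)) : seq (seq bool) :=
  if ts is t :: ts' then node (ca_step gs) t :: history (ca_step gs) ts' else [::].

Lemma history_path gs t ts : size gs = S -> size t = kk * S -> path bsucc t ts ->
  path parent (node gs t) (history gs ts) /\
  last (node gs t) (history gs ts) = node (iter (size ts) (@ca_step M) gs) (last t ts).
Proof.
elim: ts gs t => [|t' ts IH] gs t //= sg st /andP[tt' pt].
have sg' : size (ca_step gs) = S by rewrite size_ca_step.
have st' : size t' = kk * S by rewrite -(bsucc_size tt').
have [p1 l1] := IH _ _ sg' st' pt.
by rewrite parent_next // p1 l1 -iterS iterSr.
Qed.

End Parent.

(** * The reduction *)

Lemma Reg_map_fold (A : finType) (T : Type) (h : col -> T) (a0 : A) d (acc : A -> bool) :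
  Reg (fun cs _ _ => acc (foldl d a0 (map h cs))).
Proof.
apply: Reg_eq (Reg_fold a0 (fun a c => d a (h c)) acc) => cs _ _.
by congr acc; elim: cs a0 => //= c cs IH a0; exact: IH.
Qed.

Lemma Reg_has (p : col -> bool) : Reg (fun cs _ _ => has p cs).
Proof.
apply: Reg_eq (Reg_not (Reg_all (predC p))) => cs _ _.
by rewrite -has_predC; apply: eq_has => c /=; rewrite negbK.
Qed.

Definition succ_check (f g : col -> seq bool) (cs : seq col) : bool :=
  foldl (fun st c => foldl carry_step st (zip (f c) (g c))) (Some true) cs == Some false.

Lemma Reg_succ f g : Reg (fun cs _ _ => succ_check f g cs).
Proof.
exact: (Reg_fold (Some true) (fun st c => foldl carry_step st (zip (f c) (g c)))
  (fun st => st == Some false)).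
Qed.

Lemma succ_checkE f g cs : all (fun c => size (f c) == size (g c)) cs ->
  succ_check f g cs = bsucc (flatten (map f cs)) (flatten (map g cs)).
Proof. exact: carry_blocks. Qed.

Section Reduction.

Variable M : TM.
Local Notation kk := (kk M).
Local Notation q := (2 * kk).

Lemma Reg_parent f g :
  Reg (fun cs _ _ => parent_check M (map (fun c => (f c, g c)) cs)).
Proof.
pose h c : seq bool * seq bool := (f c, g c).
apply: (Reg_eq (P := fun cs s s' => [&& ~~ all (fun c => all id (f c)) cs,
   ~~ all (fun c => all negb (f c)) cs &
   ca_check M (map h cs) && time_check M (map h cs) ||
   all (fun c => all id (drop kk (f c))) cs &&
   (if has (fun c => is_acc (cell_of M (f c))) cs then all (fun c => all negb (g c)) cs
    else all (fun c => all id (g c)) cs)])).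
  by move=> cs _ _; rewrite /parent_check !all_map has_map.
apply: Reg_and; first exact: Reg_not (Reg_all _).
apply: Reg_and; first exact: Reg_not (Reg_all _).
apply: Reg_or.
  apply: Reg_and; first exact: (Reg_map_fold h (Some None) (@check_step M) (@check_end M)).
  exact: (Reg_map_fold h (Some true) (fun st p => foldl carry_step st
    (zip (drop kk p.1) (drop kk p.2))) (fun st => st == Some false)).
apply: Reg_and; first exact: Reg_all.
pose hs cs := has (fun c => is_acc (cell_of M (f c))) cs.
apply: (Reg_eq (P := fun cs s s' => hs cs && all (fun c => all negb (g c)) cs ||
   ~~ hs cs && all (fun c => all id (g c)) cs)).
  by move=> cs _ _; rewrite -/(hs cs); case: (hs cs); rewrite /= ?orbF.
apply: Reg_or; apply: Reg_and; try exact: Reg_all; first exact: Reg_has.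
exact: Reg_not (Reg_has _).
Qed.

Definition letter_cell (g : letter) : cell M :=
  if g is Some a then plain M a else None.

Definition init_block (g : letter) : seq bool := code_cell (letter_cell g) ++ nseq kk false.

(** This is [strand_edge] read on columns: [AC] says that C is the parent of A, [CC] that C' is the
    parent of C. The letters of the input serve only to recognize the vertex of the exchange. *)
Definition edge_check (cs : seq col) (s s' : bool) : bool :=
  let AC := parent_check M (map (fun c => (c_A c, c_C c)) cs) in
  let CC := parent_check M (map (fun c => (c_C c, c_C' c)) cs) in
  [&& [|| [&& ~~ AC, all (fun c => c_C' c == c_C c) cs & succ_check c_A c_A' cs],
          [&& AC, all (fun c => c_C' c == c_A c) cs & all (fun c => all negb (c_A' c)) cs] |
          [&& all (fun c => all id (c_A c)) cs, CC & succ_check c_C c_A' cs]],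
      s' == s (+) (all (fun c => c_C c == init_block (c_letter c)) cs &&
                   all (fun c => all id (c_A c)) cs),
      ~~ (~~ s && (all (fun c => all id (c_C c)) cs && all (fun c => all negb (c_A c)) cs)) &
      ~~ (~~ s' && (all (fun c => all id (c_C' c)) cs && all (fun c => all id (c_A' c)) cs))].

Lemma Reg_edge : Reg edge_check.
Proof.
have Ra p : Reg (fun cs _ _ => all p cs) by exact: Reg_all.
apply: Reg_and.
  apply: Reg_or.
    apply: Reg_and; first by apply: Reg_not; exact: Reg_parent.
    by apply: Reg_and => //; exact: Reg_succ.
  apply: Reg_or; first by apply: Reg_and; [exact: Reg_parent|exact: Reg_and].
  by apply: Reg_and => //; apply: Reg_and; [exact: Reg_parent|exact: Reg_succ].
apply: Reg_and.
  apply: (Reg_op (fun a b => a == b) (P := fun _ _ s' => s')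
    (Q := fun cs s _ => s (+) _)); first exact: (Reg_bits (fun _ s' => s')).
  by apply: (Reg_op addb (P := fun _ s _ => s));
    [exact: (Reg_bits (fun s _ => s))|exact: Reg_and].
apply: Reg_and; apply: Reg_not; apply: Reg_and; try exact: Reg_and.
  exact: (Reg_bits (fun s _ => ~~ s)).
exact: (Reg_bits (fun _ s => ~~ s)).
Qed.

(** * The graph of one input word *)

Section Input.

Variables (k : nat) (x : seq bool).
Local Notation S := (ncols k (size x)).
Local Notation m := (q * S).
Local Notation gs := (letters k x).

Lemma letters_cells : map letter_cell gs = start_conf M (pad k (size x)) x.
Proof.
by rewrite /letters /start_conf map_cat /= map_cat -map_comp !map_nseq.
Qed.

Definition init_node : seq bool := node (map letter_cell gs) (nseq (kk * S) false).

Lemma size_lc : size (map letter_cell gs) = S.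
Proof. by rewrite size_map size_letters. Qed.

Lemma init_blocks : blocks q S init_node = map init_block gs.
Proof.
rewrite blocks_node ?size_lc ?size_nseq // -size_lc size_map.
elim: gs => //= g l IH; rewrite mulnS nseqD take_size_cat ?size_nseq //.
by rewrite drop_size_cat ?size_nseq // IH.
Qed.

Lemma size_init : size init_node = m.
Proof. exact: size_node size_lc (size_nseq _ _). Qed.

Lemma blocks_inj c c' : size c = m -> size c' = m -> (blocks q S c == blocks q S c') = (c == c').
Proof.
move=> sc sc'; apply/eqP/eqP => [E|-> //].
by rewrite -(flatten_blocks sc) E flatten_blocks.
Qed.

Lemma S_gt0 : 0 < S. Proof. by rewrite /ncols; lia. Qed.

Lemma all_blocks (p : pred bool) c : size c = m -> all (all p) (blocks q S c) = all p c.
Proof. by move=> sc; rewrite all_flat flatten_blocks. Qed.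

Lemma all_id_eq c : size c = m -> all id c = (c == nseq m true).
Proof.
move=> sc; apply/idP/eqP => [/all_id_nseq->|->]; first by rewrite sc.
by rewrite all_nseq orbT.
Qed.

Lemma all_neg_eq c : size c = m -> all negb c = (c == nseq m false).
Proof.
move=> sc; apply/idP/eqP => [/all_neg_nseq->|->]; first by rewrite sc.
by rewrite all_nseq orbT.
Qed.

Lemma edge_checkE C A C' A' s s' : size C = m -> size A = m -> size C' = m -> size A' = m ->
  edge_check (cols q gs C A C' A') s s' =
  [&& [|| [&& ~~ parent M S A C, C' == C & bsucc A A'],
          [&& parent M S A C, C' == A & A' == nseq m false] |
          [&& A == nseq m true, parent M S C C' & bsucc C A']],
      s' == s (+) ((C == init_node) && (A == nseq m true)),
      ~~ (~~ s && ((C == nseq m true) && (A == nseq m false))) &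
      ~~ (~~ s' && ((C' == nseq m true) && (A' == nseq m true)))].
Proof.
move=> sC sA sC' sA'; set cs := cols _ _ _ _ _ _.
have sg := size_letters k x.
have [mC mA mC' mA'] : [/\ map c_C cs = blocks q S C, map c_A cs = blocks q S A,
    map c_C' cs = blocks q S C' & map c_A' cs = blocks q S A'].
  by rewrite -sg; split; apply: map_cols; auto.
have mL : map c_letter cs = gs.
  by rewrite /cs; elim: (gs) (C) (A) (C') (A') => //= g l IH *; rewrite IH.
have Zip f g c d : map f cs = blocks q S c -> map g cs = blocks q S d ->
    map (fun c => (f c, g c)) cs = zip (blocks q S c) (blocks q S d).
  by move=> <- <-; elim: (cs) => //= ? ? ->.
have Eq f g c d : map f cs = blocks q S c -> map g cs = blocks q S d ->
    size c = m -> size d = m -> all (fun a => f a == g a) cs = (c == d).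
  move=> Ef Eg sc sd; rewrite -(blocks_inj sc sd) -Ef -Eg.
  by elim: (cs) => //= a l ->; rewrite eqseq_cons.
have Su f g c d : map f cs = blocks q S c -> map g cs = blocks q S d ->
    size c = m -> size d = m -> succ_check f g cs = bsucc c d.
  move=> Ef Eg sc sd; rewrite succ_checkE; last first.
    have := blocks_sizes sc; have := blocks_sizes sd; rewrite -Ef -Eg !all_map.
    by elim: (cs) => //= a l IH /andP[/eqP-> /IH H] /andP[/eqP-> /H ->]; rewrite eqxx.
  by rewrite Ef Eg !flatten_blocks.
have Al (p : pred bool) f c : map f cs = blocks q S c -> size c = m ->
    all (fun a => all p (f a)) cs = all p c.
  by move=> Ef sc; rewrite -(all_blocks p sc) -Ef all_map.
have In : all (fun c => c_C c == init_block (c_letter c)) cs = (C == init_node).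
  rewrite -(blocks_inj sC size_init) init_blocks -mC -mL -map_comp.
  by elim: (cs) => //= a l ->; rewrite eqseq_cons.
rewrite /edge_check (Zip _ _ _ _ mA mC) (Zip _ _ _ _ mC mC') In.
rewrite (Eq _ _ _ _ mC' mC sC' sC) (Eq _ _ _ _ mC' mA sC' sA).
rewrite (Su _ _ _ _ mA mA' sA sA') (Su _ _ _ _ mC mA' sC sA').
rewrite !(Al _ _ _ mA sA) !(Al _ _ _ mC sC) !(Al _ _ _ mC' sC') !(Al _ _ _ mA' sA').
by rewrite !all_id_eq // !all_neg_eq.
Qed.

Local Notation X := (m.-tuple bool).

Lemma lift_tuples l : (forall b, b \in l -> size b = m) -> exists l' : seq X, map val l' = l.
Proof.
elim: l => [|b l IH] H; first by exists [::].
have [|l' El] := IH; first by move=> c cl; apply: H; rewrite inE cl orbT.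
have sb : size b == m by apply/eqP/H; rewrite mem_head.
by exists (Tuple sb :: l'); rewrite /= El.
Qed.

Definition parentX : rel X := fun a c => parent M S a c.
Definition zeroX : X := nseq_tuple m false.
Definition maxX : X := nseq_tuple m true.
Definition initX : X := Tuple (introT eqP size_init).

Local Notation n := (nbits q k (size x)).

Lemma vert_size (v : bool * (X * X)) : size (v.1 :: val v.2.1 ++ val v.2.2) == n.
Proof. by rewrite /= size_cat !size_tuple /nbits; apply/eqP; lia. Qed.

(** A bijection with all bit strings of this length, which is why the instance can take [None] for
    the membership circuit. *)
Definition vert (v : bool * (X * X)) : n.-tuple bool := Tuple (vert_size v).

Definition unvert (t : n.-tuple bool) : bool * (X * X) :=
  (head false t, (insubd zeroX (take m (behead t)), insubd zeroX (drop m (behead t)))).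

Lemma vertK : cancel vert unvert.
Proof.
case=> s [c a]; rewrite /unvert /=.
by rewrite take_size_cat ?size_tuple // drop_size_cat ?size_tuple // !valKd.
Qed.

Lemma unvertK : cancel unvert vert.
Proof.
move=> t; apply: val_inj; rewrite /= !val_insubd.
have := size_tuple t; case: (val t) => [|b s] //= [sz].
rewrite size_take size_drop sz.
have -> : (if m < 2 * q * S then m else 2 * q * S) == m by case: ltnP; lia.
have -> : 2 * q * S - m == m by lia.
by rewrite cat_take_drop.
Qed.

Variable C : circuit.
Hypothesis C_ok : forall s1 C1 A1 s2 C2 A2,
  [/\ size C1 = m, size A1 = m, size C2 = m & size A2 = m] ->
  circuit_out C ((s1 :: C1 ++ A1) ++ (s2 :: C2 ++ A2)) =
  edge_check (cols q gs C1 A1 C2 A2) s1 s2.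

Definition nxX : rel X := fun a b => bsucc a b.

Lemma edge_strand (u v : bool * (X * X)) : @edge n C None (vert u) (vert v) =
  strand_edge zeroX maxX nxX parentX initX u v.
Proof.
case: u v => [s [c a]] [s' [c' a']]; rewrite /edge /= C_ok ?size_tuple //.
rewrite edge_checkE ?size_tuple // /strand_edge /tour_edge /=.
by rewrite !xpair_eqE -!val_eqE /= !eqbF_neg.
Qed.

Hypothesis space_ok : forall t, space_of (run M x t) <= polybnd k (size x).
Variable t : nat.
Hypothesis halts : halted (run M x t).

(** The run is a path of parents from the initial node to the root that tells acceptance. The
    exchange vertex [(initX, maxX)] lies in the tour of [initX], hence in the tour of that root, and
    [tour_game] reads off which root it is. *)
Lemma game_decides :
  [/\ acyclic (@edge n C None), parallel_chains 6 (Vset n None) (@reach n C None) &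
      exists_game (@reach n C None) (Vset n None) = tm_accept M (c_state (run M x t))].
Proof.
have -> : Vset n None = [set: n.-tuple bool] by apply/setP => v; rewrite !inE.
have [en Een] : exists en : seq X, map val en = counter_tail m.
  by apply: lift_tuples => b; exact: counter_sizes.
have en_path : path nxX zeroX en.
  have := counter_path m; rewrite -Een; by rewrite -[nseq m false]/(val zeroX) path_map.
have en_last : last zeroX en = maxX.
  by apply: val_inj; rewrite /= -(last_map val) Een /= counter_last.
have en_all y : y \in zeroX :: en.
  by rewrite -(mem_map val_inj) /= Een counter_all // size_tuple.
have nx_det : forall a b b' : X, nxX a b -> nxX a b' -> b = b'.
  by move=> a b b' H H'; apply: val_inj; exact: bsucc_det H H'.
have nx_max : forall b, ~~ nxX maxX b.
  by move=> b; rewrite /nxX bsucc_max //= all_nseq orbT.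
have m_gt0 : 0 < m.
  rewrite muln_gt0 S_gt0 andbT muln_gt0 /=; apply/card_gt0P; by exists None.
have zm : zeroX != maxX.
  by rewrite -val_eqE /=; case: (m) m_gt0.
have R_det : forall a c c', parentX a c -> parentX a c' -> c = c'.
  move=> a c c' H H'; apply: val_inj.
  by apply: (parent_det _ _ _ H H'); rewrite size_tuple.
have R_rk : forall a c : X, parentX a c -> parent_rank M S a < parent_rank M S c.
  by move=> a c; apply: parent_rank_lt; rewrite size_tuple.
have R_z : forall c, ~~ parentX zeroX c.
  move=> c; rewrite /parentX parent_root ?size_tuple //=.
  by rewrite [all negb _]all_nseq !orbT.
have R_mx : forall c, ~~ parentX maxX c.
  move=> c; rewrite /parentX parent_root ?size_tuple //=.
  by rewrite [all id _]all_nseq orbT.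
have R_total : forall a, a != zeroX -> a != maxX -> exists c, parentX a c.
  move=> a nz nm; have [||c sc H] := @parent_total M S a (size_tuple a).
  - by rewrite all_id_eq ?size_tuple.
  - by rewrite all_neg_eq ?size_tuple.
  - by exists (Tuple (introT eqP sc)).
have [nr1 nr2] := node_not_root S_gt0 (nseq (kk * S) false) size_lc.
have i_z : initX != zeroX by rewrite -val_eqE /= -all_neg_eq // size_init.
have i_m : initX != maxX by rewrite -val_eqE /= -all_id_eq // size_init.
have [H1 H2 H3] := tour_game nx_det nx_max en_path en_last en_all zm R_det R_rk
  R_z R_mx R_total i_z i_m vertK unvertK edge_strand.
split=> //; rewrite /reach H3.
pose N := 2 ^ (kk * S).
have Eacc : has (@is_acc M) (iter N.-1 (@ca_step M) (map letter_cell gs)) =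
    tm_accept M (c_state (run M x t)).
  rewrite letters_cells; apply: ca_decides halts _.
    move=> t'; have := space_ok t'; rewrite /polybnd /pad; lia.
  (* From [kk < 2 ^ kk] follows [kk ^ S <= 2 ^ (kk * S)]: the clock outlasts every halting run. *)
  rewrite size_start_conf -/(ncols k (size x)) /N expnM leq_exp2r ?S_gt0 //.
  exact: ltnW (ltn_expl _ _).
have [ph lh] := history_path S_gt0 size_lc (size_nseq _ _) (counter_path (kk * S)).
(* From zero to its maximum the clock makes [N - 1] steps, the number of iterations in [Eacc]. *)
rewrite size_counter -/N counter_last in lh.
set gN := iter _ _ _ in lh Eacc.
have sgN : size gN = S by rewrite /gN size_iter_ca size_lc.
have [hs Ehs] : exists hs : seq X,
    map val hs = history (map letter_cell gs) (counter_tail (kk * S)).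
  apply: lift_tuples.
  have: forall (ts : seq (seq bool)) (l : seq (cell M)),
     (forall b, b \in ts -> size b = kk * S) -> size l = S ->
     forall b, b \in history l ts -> size b = m.
    elim=> //= b ts IH l H sl c; rewrite inE.
    have sl' : size (ca_step l) = S by rewrite size_ca_step.
    case/predU1P=> [->|]; first by apply: size_node sl' _; apply: H; rewrite mem_head.
    by apply: IH => // d din; apply: H; rewrite inE din orbT.
  by apply; [exact: counter_sizes|exact: size_lc].
have pX : path parentX initX hs.
  by move: ph; rewrite -Ehs -[node _ _]/(val initX) path_map.
pose final := last initX hs.
have Ef : val final = node gN (nseq (kk * S) true).
  by rewrite -lh -Ehs -[node _ (nseq _ false)]/(val initX) last_map.
pose r := if has (@is_acc M) gN then zeroX else maxX.
have fr : parentX final r.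
  have alT : all id (nseq (kk * S) true) by rewrite all_nseq orbT.
  rewrite /parentX Ef (parent_last S_gt0 sgN (size_nseq _ _) alT (size_tuple _)) /r.
  by case: (has _ gN); [rewrite [all negb _]all_nseq orbT|rewrite [all id _]all_nseq orbT].
have pr : path parentX initX (rcons hs r) by rewrite rcons_path pX.
have w_r : (initX, maxX) \in tour zeroX en parentX (parent_rank M S) r.
  have := tour_ancestor en_all R_rk pr; rewrite last_rcons; apply.
  exact: tour_own.
rewrite -Eacc; move: w_r; rewrite /r; case: ifP => _ wr.
  exact: (tour_disjoint nx_det nx_max en_path en_last zm R_det R_rk R_z R_mx wr).
by rewrite wr.
Qed.

End Input.

End Reduction.

Theorem mainTheorem13 : PSPACE_hard_promise Nim6_YES Nim6_NO.
Proof.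
move=> L [M [k HM]].
have [C [pt HC]] := reg_polytime (2 * kk M) k (Reg_edge M).
exists (fun x => encode (Inst (nbits (2 * kk M) k (size x)) (C x) None)); split=> // x.
(* The halting time [t] serves the correctness proof; the instance is built from [M], [k] and
   [x]. *)
have [wf ok] := HC x; have [sp [t [ht acc]]] := HM x.
have [A Pc G] := game_decides ok sp ht.
have P : promise6 (Inst (nbits (2 * kk M) k (size x)) (C x) None) by split.
have W : inst_wf (Inst (nbits (2 * kk M) k (size x)) (C x) None).
  by rewrite /inst_wf /= wf.
split=> Lx; eexists; (split; [reflexivity|split=> //; split=> //=]); rewrite G.
  exact/acc.
by apply/negP => /acc.
Qed.
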